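(* Let $1\leq p<\infty$. Let $f\in L'^{\,p}$ with primitive $F\in L^p$. For $t>0$ and $x\in\mathbb{R}$ define $v(x,t)=v_t(x)=f\ast\Theta_t(x)$. Then the following hold. (a) For each $t>0$ and each $x\in\mathbb{R}$, $$v_t(x)=\int_{-\infty}^\infty f(y)\Theta_t(x-y)\,dy=F\ast\Theta_t'(x)=\Theta_t'\ast F(x)=(F\ast\Theta_t)'(x),$$ and the function $v_t$ is uniformly continuous on $\mathbb{R}$. (b) For each $n\geq 1$, $v_t^{(n)}(x)=f\ast\Theta_t^{(n)}(x)$ and $\partial^n v(x,t)/\partial t^n=f\ast\frac{\partial^n\Theta}{\partial t^n}(x,t)$ (convolution in the space variable). Hence $v_t\in C^\infty(\mathbb{R})$ for each $t>0$ and $v(x,\cdot)\in C^\infty((0,\infty))$ for each $x\in\mathbb{R}$. (c) If $p\leq s<\infty$ then $f\ast\Theta_t\in L'^{\,s}$ for each $t>0$. (d) Let $q,r\in[1,\infty]$ be such that $1/p+1/q=1+1/r$. There is a constant $K_{p,q}$, namely $K_{p,q}=(c_pc_q/c_r)^{1/2}\alpha_q$, such that $\|f\ast\Theta_t\|'_r\leq K_{p,q}\|f\|'_p\,t^{-(1-1/q)/2}$ for all $t>0$ (and all $f\in L'^{\,p}$). The estimate is sharp in the sense that if $\psi:(0,\infty)\to(0,\infty)$ is such that $\psi(t)=o(t^{-(1-1/q)/2})$ as $t\to0^+$ or as $t\to\infty$, then there is $g\in L'^{\,p}$ such that $\|g\ast\Theta_t\|'_r/\psi(t)$ is not bounded.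 The constant $K_{p,q}$ cannot be replaced by any smaller number. In particular, $\|f\ast\Theta_t\|'_p\leq\|f\|'_p$ is a sharp estimate. (e) If $1\leq s<p$ then $f\ast\Theta_t$ need not be in $L'^{\,s}$; that is, for each $t>0$ there is $f\in L'^{\,p}$ such that $f\ast\Theta_t\notin L'^{\,s}$.
   Context: All functions are real-valued on $\mathbb{R}$; $L^p=L^p(\mathbb{R})$ with norm $\|\cdot\|_p$; $\mathcal{S}'$ is the space of tempered distributions on $\mathbb{R}$. For $1\leq p<\infty$, $L'^{\,p}=\{f\in\mathcal{S}' : f=F' \text{ (distributional derivative) for some } F\in L^p\}$. Each $f\in L'^{\,p}$ has a unique primitive $F\in L^p$ (i.e. $F'=f$), and $\|f\|'_p:=\|F\|_p$. A function is said to be in $L'^{\,p}$ if, as a distribution, it is the derivative of an $L^p$ function. Integration in $L'^{\,p}$: if $f\in L'^{\,p}$ has primitive $F\in L^p$, $q$ is the conjugate exponent of $p$, and $G$ is an (indefinite) integral of a function $g\in L^q$, then $\int_{-\infty}^\infty fG:=-\int_{-\infty}^\infty F(y)g(y)\,dy$. The convolution is $f\ast G(x)=\int_{-\infty}^\infty f(y)G(x-y)\,dy$ in this sense, so $f\ast G(x)=\int_{-\infty}^\infty F(y)G'(x-y)\,dy$. The Gauss–Weierstrass heat kernel is $\Theta(x,t)=\Theta_t(x)=\frac{1}{2\sqrt{\pi t}}\exp(-x^2/(4t))$, $t>0$; primes and superscripts $(n)$ on $\Theta_t$ denote derivatives in $x$. Constants: $c_p=p^{1/p}/(p')^{1/p'}$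 with $p,p'$ conjugate exponents, and $c_1=c_\infty=1$. $\alpha_1=1$, $\alpha_q=\frac{1}{(2\sqrt{\pi})^{1-1/q}q^{1/(2q)}}$ for $1<q<\infty$, $\alpha_\infty=\frac{1}{2\sqrt\pi}$. For $r=\infty$ in (d), $\|f\ast\Theta_t\|'_\infty$ means $\|F\ast\Theta_t\|_\infty$, where $F$ is the $L^p$ primitive of $f$ (note $f\ast\Theta_t=(F\ast\Theta_t)'$). *)

(* Defs.v *)
From HB Require Import structures.
From mathcomp Require Import all_boot all_order all_algebra.
From mathcomp Require Import all_classical all_reals all_analysis.

Set Implicit Arguments.
Unset Strict Implicit.
Unset Printing Implicit Defensive.

Import Order.TTheory GRing.Theory Num.Theory.
Import numFieldNormedType.Exports.

Local Open Scope classical_set_scope.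
Local Open Scope ring_scope.

Section Schwartz.
Context {R : realType}.
Implicit Types (f g : R -> R).

Definition smooth_on (A : set R) f : Prop :=
  forall n x, A x -> derivable (derive1n n f) x 1.

Definition rapidly_decreasing f : Prop :=
  forall m n : nat, exists C : R, forall x : R, `|x ^+ m * derive1n n f x| <= C.

Definition schwartz_pred : {pred R -> R} :=
  mem [set f | smooth_on setT f /\ rapidly_decreasing f].

Lemma derive1n_lin (a : R) f g : smooth_on setT f -> smooth_on setT g ->
  forall n, derive1n n (a *: f + g) = a *: derive1n n f + derive1n n g.
Proof.
move=> sf sg; elim=> [//|n IH].
rewrite !derive1nS IH; apply/funext => x.
have df : derivable (derive1n n f) x 1 by exact: sf.
have dg : derivable (derive1n n g) x 1 by exact: sg.
rewrite derive1E deriveD//; last exact: derivableZ.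
by rewrite deriveZ// -!derive1E.
Qed.

Lemma derive1nSr f n : derive1n n (derive1 f) = derive1n n.+1 f.
Proof. by rewrite /derive1n iterSr. Qed.

Lemma derive1n_cst0 n : derive1n n (0 : R -> R) = 0.
Proof.
elim: n => [//|n IH]; rewrite derive1nS IH; apply/funext => x.
by rewrite derive1_cst.
Qed.

Lemma schwartz_submod_closed : submod_closed schwartz_pred.
Proof.
split.
  rewrite inE; split.
    by move=> n x _; rewrite derive1n_cst0; exact: derivable_cst.
  by move=> m n; exists 0 => x; rewrite derive1n_cst0 mulr0 normr0.
move=> a f g; rewrite !inE => -[sf df] [sg dg]; split.
  move=> n x _; rewrite derive1n_lin//; apply: derivableD; last exact: sg.
  by apply: derivableZ; exact: sf.
move=> m n; have [C hC] := df m n; have [D hD] := dg m n.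
exists (`|a| * C + D) => x; rewrite derive1n_lin// fctE.
rewrite mulrDr (le_trans (ler_normD _ _))// lerD//.
by rewrite /GRing.scale/= mulrCA normrM ler_wpM2l.
Qed.

HB.instance Definition _ :=
  GRing.isSubmodClosed.Build _ _ schwartz_pred schwartz_submod_closed.

Record schwartz := Schwartz {
  schwartz_val :> R -> R ;
  schwartz_valP : schwartz_val \in schwartz_pred }.

HB.instance Definition _ := [isSub for schwartz_val].
HB.instance Definition _ := [Choice of schwartz by <:].
HB.instance Definition _ := [SubChoice_isSubLmodule of schwartz by <:].

Lemma schwartz_deriv_subproof (phi : schwartz) :
  derive1 (phi : R -> R) \in schwartz_pred.
Proof.
have := schwartz_valP phi; rewrite !inE => -[sp dp]; split.
  by move=> n x _; rewrite derive1nSr; exact: sp.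
by move=> m n; rewrite derive1nSr; exact: dp.
Qed.

Definition schwartz_deriv (phi : schwartz) : schwartz :=
  Schwartz (schwartz_deriv_subproof phi).

Definition schwartz_cvg (phi_ : nat -> schwartz) (phi : schwartz) : Prop :=
  forall m n : nat,
    {uniform, (fun k (x : R) =>
                 x ^+ m * derive1n n (phi_ k - phi : schwartz) x) @ \oo
              --> (cst 0 : R -> R)}.

Definition tempered (T : schwartz -> R) : Prop :=
  scalar T /\
  forall phi_ phi, schwartz_cvg phi_ phi -> T (phi_ k) @[k --> \oo] --> T phi.

Definition distr_deriv (T : schwartz -> R) : schwartz -> R :=
  fun phi => - T (schwartz_deriv phi).

Definition distr_of_fun (f : R -> R) : schwartz -> R :=
  fun phi => \int[lebesgue_measure]_x (f x * phi x).

End Schwartz.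
Arguments schwartz R : clear implicits.

(* Lets the Landau notations of the library be used at +oo. *)
Canonical pinfty_filter_on (R : realType) : filter_on R :=
  FilterType (pinfty_nbhs R) _.

Section DerivativesOfLp.
Context {R : realType}.
Local Notation mu := (@lebesgue_measure R).
Implicit Types (p : R) (q r : \bar R) (f : schwartz R -> R) (F G g : R -> R).

Definition is_primitive p f F : Prop :=
  F \in Lfun mu p%:E /\ f = distr_deriv (distr_of_fun F).

Definition LpD p : set (schwartz R -> R) :=
  [set f | tempered f /\ exists F, is_primitive p f F].

(* The choice is determined up to equality almost everywhere when
   [LpD p f] holds. *)
Definition primitive p f : R -> R := xget (cst 0) [set F | is_primitive p f F].

(* A distribution without an L^p primitive gets norm +oo. *)
Definition LpD_norm p f : \bar R :=
  if `[< LpD p f >] then Lnorm mu p%:E (EFin \o primitive p f) else +oo%E.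

Definition indefinite_integral G g : Prop :=
  forall a b : R, a <= b -> G b - G a = \int[mu]_(y in `[a, b]) g y.

(* Two densities of the same G agree almost everywhere, so the choice does not
   affect [LpD_int]. *)
Definition Lq_density q G : R -> R :=
  xget (cst 0) [set g | g \in Lfun mu q /\ indefinite_integral G g].

(* The integral of f G is minus the integral of F g, where F is the L^p
   primitive of f and G is an indefinite integral of g in L^q. *)
Definition LpD_int p f G : R :=
  - \int[mu]_y (primitive p f y
                * Lq_density (hoelder_conjugate p%:E) G y).

Definition LpD_conv p f G : R -> R :=
  fun x => LpD_int p f (fun y => G (x - y)).

Definition convolvable F G : Prop :=
  forall x, mu.-integrable setT (EFin \o (fun y => F y * G (x - y))).

Definition convolution F G : R -> R := fun x => \int[mu]_y (F y * G (x - y)).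

(* For r = +oo the convolution is measured by the essential supremum of
   F * G, F being the L^p primitive of f, as f * G = (F * G)'. *)
Definition LpD_conv_norm p r f G : \bar R :=
  match r with
  | r%:E => LpD_norm r (distr_of_fun (LpD_conv p f G))
  | _ => Lnorm mu +oo (EFin \o convolution (primitive p f) G)
  end.

Definition heat (t x : R) : R :=
  (2 * Num.sqrt (pi * t))^-1 * expR (- x ^+ 2 / (4 * t)).

Definition heat_dt n (t x : R) : R := derive1n n (fun s => heat s x) t.

Definition c_ q : R :=
  match q with
  | q%:E => if q == 1 then 1
            else let q' := fine (hoelder_conjugate q%:E) in
                 q `^ q^-1 / (q' `^ q'^-1)
  | _ => 1
  end.

Definition alpha_ q : R :=
  match q with
  | q%:E => if q == 1 then 1
            else ((2 * Num.sqrt pi) `^ (1 - q^-1) * q `^ (2 * q)^-1)^-1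
  | _ => (2 * Num.sqrt pi)^-1
  end.

(* r is a function of p and q through 1/p + 1/q = 1 + 1/r. *)
Definition K_ p q r : R := (c_ p%:E * c_ q / c_ r) `^ 2^-1 * alpha_ q.

Definition decay_rate q : R := - (1 - fine (q^-1)%E) / 2.

Definition heat_estimate p r (K b : R) : Prop :=
  forall f, LpD p f -> forall t : R, 0 < t ->
    (LpD_conv_norm p r f (heat t) <= K%:E * LpD_norm p f * (t `^ b)%:E)%E.

Definition rate_sharp p r (b : R) : Prop :=
  forall psi : R -> R, (forall t : R, 0 < t -> 0 < psi t) ->
    psi =o_ (0^'+) (fun t => t `^ b) \/ psi =o_ (+oo) (fun t => t `^ b) ->
  exists2 g, LpD p g &
    ~ exists M : R, forall t : R, 0 < t ->
        (LpD_conv_norm p r g (heat t) / (psi t)%:E <= M%:E)%E.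

Definition constant_sharp p r (K b : R) : Prop :=
  forall k : R, k < K -> ~ heat_estimate p r k b.

End DerivativesOfLp.

(* Main.v *)
(** If F is the L^p primitive of f, then f * heat t = (F * heat t)', so that the
statements (a) and (b) are differentiation under the integral sign, with Gaussian
bounds on the derivatives of the kernel, and the primitive of f * heat t in L^r
is F * heat t: two primitives of the same distribution agree almost everywhere,
as one sees by testing against heat t (x - .) and letting t tend to 0.

The estimate in (d) is Young's inequality with the sharp constant, for a Gaussian
kernel.  It follows by duality from a bound on the bilinear form
[\int \int F x * H y * heat t (x - y)], proved by Barthe's transport argument:
if T and S transport Gaussians to F^p and H^r', then after substituting
x = T (z + th v), y = S (z - (1 - th) v), the Jacobian factors are dominated by
the power 1/q of the v-derivative of x - y (by the arithmetic-geometric mean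
inequality), and Hoelder's inequality in v leaves only Gaussian integrals.

Gaussians are extremal, possibly in the limit of a degenerate variance, which
gives the sharpness of the constant.  The sharpness of the rate and (e) follow by
condensation: one function of L^p dominates 2^-(n+1) times each of a sequence of
normalized Gaussians with prescribed variances. *)

Require Import Defs.
From mathcomp Require Import all_boot all_order all_algebra.
From mathcomp Require Import all_classical all_reals all_analysis.
From mathcomp Require Import measurable_realfun ess_sup_inf ring lra.
Import Order.TTheory GRing.Theory Num.Theory.
Import numFieldNormedType.Exports.
Local Open Scope classical_set_scope.
Local Open Scope ring_scope.

Set Implicit Arguments.
Unset Strict Implicit.
Unset Printing Implicit Defensive.

(** * The heat kernel and its derivatives *)

(** The exponents enter through their reciprocals [u = 1/p], [w = 1/r] and [s = 1/q = 1 + w - u];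
    with [0 ^ 0 = 1] the formulas for the constants then cover the endpoints. The transport argument
    needs [0 < w < u < 1], so the cases [r = p], [p = 1] and [r = +oo] are settled apart, by
    Jensen's and Hoelder's inequalities or a pointwise bound on the kernel. The dual function is not
    arbitrary. For [g = F * heat t] it is [H = g ^ (r - 1)], which makes the bilinear form equal to
    the integral [I] of [g ^ r], and the bound becomes [I <= C I ^ (1 - w)]. Dividing requires [I]
    finite, which is known beforehand because [g] is bounded and in [L^p]. Transport also requires
    positive continuous densities; the semigroup law provides them by spending part of the time [t]
    on smoothing [|F|]. The definitions choose a primitive and a density, each determined only
    almost everywhere. Both choices are eliminated once and for all, after which only the ordinary
    convolution of [F] with derivatives of the kernel remains. *)

Section affine.
Context {R : realType}.
Local Notation mu := (@lebesgue_measure R).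
Local Open Scope ereal_scope.

Lemma measurable_affine (a c : R) : measurable_fun setT (fun x : R => a + c * x)%R.
Proof. by apply: measurable_funD => //; apply: measurable_funM. Qed.

(** Uniqueness of Lebesgue measure reduces the claim to half-open intervals. For [c < 0] their
    preimages are closed at the other end, which does not change the length. *)
Lemma lebesgue_measure_affine (a c : R) (A : set R) : c != 0%R -> measurable A ->
  mu A = `|c|%:E * mu ((fun x => a + c * x)%R @^-1` A).
Proof.
move=> c0 mA.
have mf : @measurable_fun _ _ (measurableTypeR R) (measurableTypeR R) setT (fun x : R => a + c * x)%R := measurable_affine a c.
pose f : measurableTypeR R -> measurableTypeR R := fun x => (a + c * x)%R.
pose k : {nonneg R} := NngNum (normr_ge0 c).
have H := @lebesgue_measure_unique R (mscale k (pushforward mu f)).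
rewrite (H mf _ _ mA)//.
move=> _ [[u v] _ <-]/=; transitivity (`|c|%:E * mu ((fun x : R => a + c * x)%R @^-1` [set` `]u, v]])); last by [].
have [cp|cn|c00] := ltgtP c 0%R; last by rewrite c00 eqxx in c0.
- have -> : (fun x : R => a + c * x)%R @^-1` [set` `]u, v]] = [set` `[(v - a) / c, (u - a) / c[]%R.
    apply/seteqP; split => x /=; rewrite !in_itv/= ler_ndivrMr// ltr_ndivlMr// => /andP[h1 h2]; apply/andP; split; lra.
  rewrite !lebesgue_measure_itv/= !lte_fin.
  rewrite ltr_nM2r ?invr_lt0// ltrD2r.
  case: ifPn => uv; last by rewrite mule0.
  by rewrite -!EFinB -EFinM ltr0_norm//; congr EFin; field.
- have -> : (fun x : R => a + c * x)%R @^-1` [set` `]u, v]] = [set` `](u - a) / c, (v - a) / c]]%R.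
    apply/seteqP; split => x /=; rewrite !in_itv/= ler_pdivlMr// ltr_pdivrMr// => /andP[h1 h2]; apply/andP; split; lra.
  rewrite !lebesgue_measure_itv/= !lte_fin.
  rewrite ltr_pM2r ?invr_gt0// ltrD2r.
  case: ifPn => uv; last by rewrite mule0.
  by rewrite -!EFinB -EFinM gtr0_norm//; congr EFin; field.
Qed.

Lemma ge0_integral_affine (a c : R) (f : R -> \bar R) : c != 0%R ->
  measurable_fun setT f -> (forall x, 0 <= f x) ->
  \int[mu]_x f (a + c * x)%R = `|c|^-1%:E * \int[mu]_x f x.
Proof.
move=> c0 mf f0.
have mg : @measurable_fun _ _ (measurableTypeR R) (measurableTypeR R) setT (fun x : R => a + c * x)%R := measurable_affine a c.
pose g : measurableTypeR R -> measurableTypeR R := fun x => (a + c * x)%R.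
pose k : {nonneg R} := NngNum (normr_ge0 c).
have E := @eq_measure_integral _ _ R setT (mscale k (pushforward mu g)).
rewrite [X in _ * X](E mg mu f); last by move=> A mA _; exact: lebesgue_measure_affine.
rewrite ge0_integral_mscale//= ge0_integral_pushforward//.
by rewrite muleA -EFinM mulVf ?normr_eq0// mul1e preimage_setT.
Qed.

Lemma ge0_integral_subl (a : R) (f : R -> \bar R) :
  measurable_fun setT f -> (forall x, 0 <= f x) ->
  \int[mu]_x f (a - x)%R = \int[mu]_x f x.
Proof.
move=> mf f0; have := @ge0_integral_affine a (-1) f.
rewrite oppr_eq0 oner_eq0 normrN1 invr1 mul1e => <- //.
by apply: eq_integral => x _; rewrite mulN1r.
Qed.

Lemma ge0_integral_addr (a : R) (f : R -> \bar R) :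
  measurable_fun setT f -> (forall x, 0 <= f x) ->
  \int[mu]_x f (x + a)%R = \int[mu]_x f x.
Proof.
move=> mf f0; have := @ge0_integral_affine a 1 f.
rewrite oner_eq0 normr1 invr1 mul1e => <- //.
by apply: eq_integral => x _; rewrite mul1r addrC.
Qed.

Lemma measurable_subl (a : R) : measurable_fun setT (fun x : R => a - x)%R.
Proof. by apply: measurable_funB. Qed.

Lemma integral_subl (a : R) (f : R -> \bar R) : measurable_fun setT f ->
  \int[mu]_x f (a - x)%R = \int[mu]_x f x.
Proof.
move=> mf; rewrite integralE [RHS]integralE.
congr (_ - _).
- rewrite -(@ge0_integral_subl a (funepos f)) => //; last exact: measurable_funepos.
  by apply: eq_integral => x _; rewrite !funeposE.
- rewrite -(@ge0_integral_subl a (funeneg f)) => //; last exact: measurable_funeneg.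
  by apply: eq_integral => x _; rewrite !funenegE.
Qed.

Lemma Rintegral_subl (a : R) (f : R -> R) : measurable_fun setT f ->
  (\int[mu]_x f (a - x) = \int[mu]_x f x)%R.
Proof.
by move=> mf; congr fine; apply: (@integral_subl a (EFin \o f)); exact/measurable_EFinP.
Qed.

Lemma integrable_subl (a : R) (f : R -> \bar R) : mu.-integrable setT f ->
  mu.-integrable setT (fun x => f (a - x)%R).
Proof.
move=> /integrableP[mf f1]; apply/integrableP; split.
  by apply: measurableT_comp => //; exact: measurable_subl.
rewrite (@integral_subl a (fun x => `|f x|))//.
exact: measurableT_comp.
Qed.

End affine.

Section heat_kernel.
Context {R : realType}.
Local Notation mu := (@lebesgue_measure R).

Lemma integral_gauss (a : R) : 0 < a ->
  (\int[mu]_x (expR (- (a * x ^+ 2)))%:E = (Num.sqrt (pi / a))%:E)%E.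
Proof.
move=> a0.
have sa0 : Num.sqrt a != 0 by rewrite sqrtr_eq0 -ltNge.
have := @ge0_integral_affine R 0 (Num.sqrt a) (EFin \o gauss_fun) sa0.
rewrite integralT_gauss => H.
rewrite [LHS](_ : _ = (\int[mu]_x (EFin \o gauss_fun) (0 + Num.sqrt a * x)%R)%E); last first.
  apply: eq_integral => x _ /=.
  by rewrite /gauss_fun add0r exprMn sqr_sqrtr// ltW.
rewrite H; last 2 first.
- by apply/measurable_EFinP; exact: measurable_gauss_fun.
- by move=> x; rewrite lee_fin gauss_fun_ge0.
by rewrite ger0_norm ?sqrtr_ge0// -EFinM mulrC sqrtrM ?pi_ge0// sqrtrV// ltW.
Qed.

Lemma heat_cst_gt0 (t : R) : 0 < t -> 0 < 2 * Num.sqrt (pi * t).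
Proof. by move=> t0; rewrite mulr_gt0// sqrtr_gt0 mulr_gt0// pi_gt0. Qed.

Lemma heat_gt0 (t x : R) : 0 < t -> 0 < heat t x.
Proof. by move=> t0; rewrite /heat mulr_gt0 ?expR_gt0// invr_gt0 heat_cst_gt0. Qed.

Lemma heat_ge0 (t x : R) : 0 < t -> 0 <= heat t x.
Proof. by move=> t0; rewrite ltW// heat_gt0. Qed.

Lemma heatN (t x : R) : heat t (- x) = heat t x.
Proof. by rewrite /heat sqrrN. Qed.

Lemma heatBC (t x y : R) : heat t (x - y) = heat t (y - x).
Proof. by rewrite -heatN opprB. Qed.

Lemma continuous_heat (t : R) : continuous (heat t : R -> R).
Proof.
move=> x; rewrite /heat /=; apply: cvgM; first exact: cvg_cst.
apply: (@continuous_comp _ _ _ (fun y : R => - y ^+ 2 / (4 * t)) expR); last exact: continuous_expR.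
apply: cvgM; last exact: cvg_cst.
by apply: cvgN; exact: exprn_continuous.
Qed.

Lemma measurable_heat (t : R) : measurable_fun setT (heat t : R -> R).
Proof. by apply: continuous_measurable_fun; exact: continuous_heat. Qed.

Lemma integral_heat (t : R) : 0 < t -> (\int[mu]_x (heat t x)%:E = 1)%E.
Proof.
move=> t0; rewrite /heat.
under eq_integral do rewrite EFinM.
rewrite ge0_integralZl//=; last first.
  apply/measurable_EFinP; apply: measurableT_comp => //.
  by apply: measurable_funM => //; apply: measurableT_comp.
have t40 : 0 < (4 * t)^-1 by rewrite invr_gt0 mulr_gt0.
rewrite [X in (_ * X)%E](_ : _ = (\int[mu]_x (expR (- ((4 * t)^-1 * x ^+ 2)))%:E)%E); last first.
  by apply: eq_integral => x _; rewrite mulNr mulrC.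
rewrite integral_gauss// -EFinM invrK.
have -> : pi * (4 * t) = 2 ^+ 2 * (pi * t) by ring.
rewrite (@sqrtrM _ (2 ^+ 2)) ?sqr_ge0// sqrtr_sqr ger0_norm// mulVf//.
by rewrite gt_eqF// heat_cst_gt0.
Qed.

Lemma integrable_heat (t : R) : 0 < t -> mu.-integrable setT (EFin \o heat t).
Proof.
move=> t0; apply/integrableP; split.
  by apply/measurable_EFinP; exact: measurable_heat.
under eq_integral do rewrite /= ger0_norm ?heat_ge0//.
by rewrite integral_heat// ltry.
Qed.

(** Completing the square in [y]. On the right only the second factor depends on [y], and it is a
    translated heat kernel of mass [1]; integration gives the semigroup law. *)
Lemma heatM (s t x y : R) : 0 < s -> 0 < t ->
  heat s (x - y) * heat t y =
  heat (s + t) x * heat (s * t / (s + t)) (y - t * x / (s + t)).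
Proof.
move=> s0 t0; rewrite /heat.
have st0 : 0 < s + t by rewrite addr_gt0.
rewrite mulrACA [RHS]mulrACA -!expRD; congr (_ * _).
  rewrite -!invfM; congr (_^-1); rewrite mulrACA [RHS]mulrACA; congr (_ * _).
  rewrite -!sqrtrM ?mulr_ge0 ?pi_ge0 ?ltW//; congr Num.sqrt.
  by field; rewrite gt_eqF.
by congr expR; field; rewrite !gt_eqF// ?mulr_gt0.
Qed.

Lemma heat_semigroup (s t x : R) : 0 < s -> 0 < t ->
  (\int[mu]_y (heat s (x - y) * heat t y)%:E = (heat (s + t) x)%:E)%E.
Proof.
move=> s0 t0; have st0 : 0 < s + t by rewrite addr_gt0.
have u0 : 0 < s * t / (s + t) by rewrite divr_gt0// mulr_gt0.
under eq_integral do rewrite heatM// EFinM.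
rewrite ge0_integralZl//=; last 3 first.
- apply/measurable_EFinP; apply: measurableT_comp => //; first exact: measurable_heat.
  exact: measurable_funB.
- by move=> y _; rewrite lee_fin heat_ge0.
- by rewrite lee_fin heat_ge0.
have := @ge0_integral_addr R (- (t * x / (s + t))) (EFin \o heat (s * t / (s + t))).
move=> /= ->; first by rewrite integral_heat// mule1.
  by apply/measurable_EFinP; exact: measurable_heat.
by move=> y; rewrite lee_fin heat_ge0.
Qed.

End heat_kernel.

Section derivatives.
Context {R : realType}.
Implicit Types (f g : R -> R) (x a b c k : R).

Lemma is_derive_cstfun c x : is_derive x 1 (fun=> c : R) 0.
Proof. exact: is_derive_cst. Qed.

Lemma is_derive_idfun x : is_derive x 1 (fun y : R => y) 1.
Proof. exact: is_derive_id. Qed.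

Lemma is_derive_addfun f g x a b : is_derive x 1 f a -> is_derive x 1 g b ->
  is_derive x 1 (fun y => f y + g y) (a + b).
Proof. by move=> fa gb; exact: is_deriveD. Qed.

Lemma is_derive_oppfun f x a : is_derive x 1 f a ->
  is_derive x 1 (fun y => - f y) (- a).
Proof. by move=> fa; exact: is_deriveN. Qed.

Lemma is_derive_mulfun f g x a b : is_derive x 1 f a -> is_derive x 1 g b ->
  is_derive x 1 (fun y => f y * g y) (a * g x + f x * b).
Proof.
move=> fa gb; apply: (@is_derive_eq _ _ _ _ _ _ _ _ (is_deriveM fa gb)).
by rewrite addrC /GRing.scale/= [g x * a]mulrC.
Qed.

Lemma is_derive_compfun f g x a b : is_derive (g x) 1 f a -> is_derive x 1 g b ->
  is_derive x 1 (fun y => f (g y)) (a * b).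
Proof. by move=> fa gb; exact: is_derive1_comp. Qed.

Lemma is_derive_invfun f x a : f x != 0 -> is_derive x 1 f a ->
  is_derive x 1 (fun y => (f y)^-1) (- a / f x ^+ 2).
Proof.
move=> fx fa; apply: (@is_derive_eq _ _ _ _ _ _ _ _ (is_deriveV fx fa)).
by rewrite /GRing.scale/= !mulNr mulrC.
Qed.

Lemma is_derive_eqfun f g x a b : is_derive x 1 f a -> f =1 g -> a = b ->
  is_derive x 1 g b.
Proof. by move=> fa /funext <- <-. Qed.

Lemma is_derive_near f g x a : is_derive x 1 f a -> (\near x, f x = g x) ->
  is_derive x 1 g a.
Proof.
by move=> fa fg; apply: near_eq_is_derive fa.
Qed.

Lemma derive1_is_derive f x a : is_derive x 1 f a -> derive1 f x = a.
Proof. by move=> fa; rewrite derive1E; exact: derive_val. Qed.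

Lemma is_derive_continuous f x a : is_derive x 1 f a -> {for x, continuous f}.
Proof. by case=> dfx _; exact/differentiable_continuous/derivable1_diffP. Qed.

End derivatives.

Section heat_derivatives.
Context {R : realType}.

(* The recurrence is the Leibniz rule applied to [heat' = - x / (2 t) * heat]; at
   [k' = 0] the truncated predecessor is harmless, its coefficient being [0]. *)
Fixpoint heatD (k : nat) (t x : R) : R :=
  if k is k'.+1 then - (x * heatD k' t x + k'%:R * heatD k'.-1 t x) / (2 * t)
  else heat t x.

Lemma heatD1 (t x : R) : heatD 1 t x = - (x * heat t x) / (2 * t).
Proof. by rewrite /= mul0r addr0. Qed.

Lemma is_derive_heat (t x : R) : t != 0 -> is_derive x 1 (heat t) (heatD 1 t x).
Proof.
move=> t0; rewrite heatD1 /heat; set c := (2 * _)^-1; apply: is_derive_eq.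
by rewrite /GRing.scale/=; field.
Qed.

Lemma is_derive_heatD k (t x : R) : t != 0 -> is_derive x 1 (heatD k t) (heatD k.+1 t x).
Proof.
move=> t0.
(* The recurrence reaches back two orders, so the induction carries two consecutive ones. *)
suff : is_derive x 1 (heatD k.-1 t) (heatD k.-1.+1 t x) /\ is_derive x 1 (heatD k t) (heatD k.+1 t x) by case.
elim: k => [|k [IH1 IH]]; first by split; exact: is_derive_heat.
split=> //.
have E : k%:R * heatD k.-1.+1 t x = k%:R * heatD k t x.
  by case: k {IH IH1} => [|k]; rewrite ?mul0r.
have -> : heatD k.+1 t = fun y => - (y * heatD k t y + k%:R * heatD k.-1 t y) / (2 * t) by [].
have -> : heatD k.+2 t x = - (x * heatD k.+1 t x + k.+1%:R * heatD k t x) / (2 * t) by [].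
apply: is_derive_eq.
have sE (a b : R) : a *: b = a * b by [].
by rewrite !sE E -natr1; field.
Qed.

(** This is the heat equation, [heatD 2] being the second derivative in [x]. *)
Lemma is_derive_heat_time (t x : R) : 0 < t -> is_derive t 1 (fun s => heat s x) (heatD 2 t x).
Proof.
move=> t0; rewrite /heat.
have pi0 : 0 < pi :> R := pi_gt0 R.
have pt0 : 0 < pi * t by rewrite mulr_gt0.
have st0 : Num.sqrt (pi * t) != 0 by rewrite gt_eqF// sqrtr_gt0.
have t4 : 4 * t != 0 by rewrite mulf_neq0// gt_eqF.
have dpi := is_derive_mulfun (is_derive_cstfun (pi : R) t) (is_derive_idfun t).
have d4 := is_derive_mulfun (is_derive_cstfun (4 : R) t) (is_derive_idfun t).
have dsq := is_derive_compfun (is_derive1_sqrt pt0) dpi.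
have c0 : 2 * Num.sqrt (pi * t) != 0 by rewrite mulf_neq0.
have d1 := is_derive_invfun (f := fun s => 2 * Num.sqrt (pi * s)) c0 (is_derive_mulfun (is_derive_cstfun (2 : R) t) dsq).
have d2 := is_derive_compfun (is_derive_expR _)
  (is_derive_mulfun (is_derive_cstfun (- x ^+ 2) t) (is_derive_invfun (f := fun s => 4 * s) t4 d4)).
apply: (is_derive_eqfun (is_derive_mulfun d1 d2)) => //.
rewrite /heatD/= /heat !mul0r !add0r !mulr1.
have -> : (2 * Num.sqrt (pi * t)) ^+ 2 = 4 * (pi * t).
  by rewrite exprMn sqr_sqrtr ?(ltW pt0)//; ring.
move: {d1 d2 dsq} (2 * Num.sqrt (pi * t))^-1 (expR (- x ^+ 2 / (4 * t))) => c e.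
move: {t4 c0 st0 pt0 dpi d4} (pi : R) pi0 => q q0.
by field; rewrite !gt_eqF.
Qed.

(** Differentiating the recurrence itself in [t] extends the heat equation to all orders without
    interchanging mixed partial derivatives. *)
Lemma is_derive_heatD_time k (t x : R) : 0 < t ->
  is_derive t 1 (fun s => heatD k s x) (heatD k.+2 t x).
Proof.
move=> t0; have tN0 : t != 0 by rewrite gt_eqF.
suff : is_derive t 1 (fun s => heatD k.-1 s x) (heatD k.-1.+2 t x) /\
    is_derive t 1 (fun s => heatD k s x) (heatD k.+2 t x) by case.
elim: k => [|k [IH1 IH]]; first by split; exact: is_derive_heat_time.
split; first exact: IH.
have E : k%:R * heatD k.-1.+2 t x = k%:R * heatD k.+1 t x.
  by case: k {IH IH1} => [|k]; rewrite ?mul0r.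
have E3 : heatD k.+3 t x = - (x * heatD k.+2 t x + k.+2%:R * heatD k.+1 t x) / (2 * t) by [].
have E1 : heatD k.+1 t x = - (x * heatD k t x + k%:R * heatD k.-1 t x) / (2 * t) by [].
have E1' : x * heatD k t x + k%:R * heatD k.-1 t x = - (2 * t) * heatD k.+1 t x by rewrite E1; field.
have t2 : 2 * t != 0 by rewrite mulf_neq0.
have d2 := is_derive_mulfun (is_derive_cstfun (2 : R) t) (is_derive_idfun t).
have dx := is_derive_mulfun (is_derive_cstfun x t) IH.
have dk := is_derive_mulfun (is_derive_cstfun (k%:R : R) t) IH1.
apply: (is_derive_eqfun (is_derive_mulfun (is_derive_oppfun (is_derive_addfun dx dk))
  (is_derive_invfun (f := fun s => 2 * s) t2 d2))) => //.
by rewrite E3 E1' E !mul0r !add0r mulr1 -!natr1; field.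
Qed.

Lemma derive1n_heat k (t : R) : 0 < t -> derive1n k (heat t) = heatD k t.
Proof.
move=> t0; elim: k => [//|k IH]; rewrite derive1nS IH; apply/funext => x.
by apply: derive1_is_derive; apply: is_derive_heatD; rewrite gt_eqF.
Qed.

Lemma heat_dtE k (t x : R) : 0 < t -> heat_dt k t x = heatD (k.*2) t x.
Proof.
rewrite /heat_dt; elim: k t => [//|k IH] t t0.
rewrite derive1nS; apply: derive1_is_derive.
(* The closed form is known at positive times only, and these fill a neighbourhood of [t]. *)
apply: (is_derive_near (f := fun s => heatD k.*2 s x)); first exact: is_derive_heatD_time.
near=> s; rewrite IH//; near: s; exact: lt_nbhsr.
Unshelve. all: end_near. Qed.

End heat_derivatives.

(** * Convolution with the heat kernel *)

Lemma measurable_fun_powR d (T : measurableType d) (R : realType) (f : T -> R) (a : R) :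
  measurable_fun setT f -> measurable_fun setT (fun x => f x `^ a).
Proof. exact: (@measurableT_comp _ _ _ _ _ _ (@powR R ^~ a)). Qed.

Lemma powR_pred (R : realType) (x q : R) : 0 <= x -> 0 < q ->
  x `^ q = x `^ (q - 1) * x.
Proof.
move=> x0 q0; rewrite -[in LHS](subrK 1 q) [LHS]powRD ?powRr1//.
by rewrite subrK gt_eqF.
Qed.

Section weights.
Context {R : realType}.
Local Notation mu := (@lebesgue_measure R).
Implicit Types (F w g f : R -> R) (p c x : R) (q : \bar R).

Lemma LfunE q f : f \in Lfun mu q <->
  measurable_fun setT f /\ ('N[mu]_q[EFin \o f] < +oo)%E.
Proof.
split=> [|[mf nf]]; first by rewrite inE => /andP[]; rewrite !inE.
by rewrite inE; apply/andP; rewrite !inE.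
Qed.

(* Weights against which every L^p function is integrable, since
   [|F| w <= |F|^p w + w]; this replaces Hoelder's inequality uniformly in
   [1 <= p < oo]. *)
Definition tame w := [/\ measurable_fun setT w,
  (exists M : R, forall x, `|w x| <= M) & mu.-integrable setT (EFin \o w)].

Lemma tame_le c w g : tame w -> measurable_fun setT g ->
  (forall x, `|g x| <= c * w x) -> tame g.
Proof.
move=> [mw [M wM] iw] mg gw; split => //.
  exists (`|c| * M) => x; rewrite (le_trans (gw x))// (le_trans (ler_norm _))//.
  by rewrite normrM ler_wpM2l.
apply: (le_integrable _ _ _ (integrableZl measurableT c iw)) => //.
- exact/measurable_EFinP.
- by move=> x _; rewrite /= lee_fin (le_trans (gw x))// ler_norm.
Qed.

Lemma tame_norm w : tame w -> tame (fun x => `|w x|).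
Proof.
move=> [mw [M wM] iw]; split; first exact: measurableT_comp.
  by exists M => x; rewrite normr_id.
exact: (integrable_abse iw).
Qed.

Lemma tame_subl x w : tame w -> tame (fun y => w (x - y)).
Proof.
move=> [mw [M wM] iw]; split.
- by apply: measurableT_comp => //; exact: measurable_subl.
- by exists M => y.
- exact: (integrable_subl x iw).
Qed.

Lemma le_powR_add1 p x : 1 <= p -> `|x| <= `|x| `^ p + 1.
Proof.
move=> p1; have [x1|x1] := leP `|x| 1; first by rewrite (le_trans x1)// lerDr powR_ge0.
rewrite (@le_trans _ _ (`|x| `^ p))// ?lerDl//.
by rewrite -{1}(powRr1 (normr_ge0 x)) ler_powR// ltW.
Qed.

Lemma integrable_Lfun_tame p F w : 1 <= p -> F \in Lfun mu p%:E -> tame w ->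
  mu.-integrable setT (EFin \o (fun x => F x * w x)).
Proof.
move=> p1 Fp [mw [M wM] iw].
have /LfunE[mF _] := Fp.
have iFp := Lfun_integrable p1 Fp.
have iFw : mu.-integrable setT
    ((fun x => (`|F x| `^ p)%:E) \* (EFin \o w))%E.
  apply: integrableMl => //.
  by exists M; split; [exact: num_real|move=> y My x _; exact: le_trans (wM x) (ltW My)].
have iFw' := integrableD measurableT (integrable_abse iFw) (integrable_abse iw).
apply: le_integrable iFw' => //.
  by apply/measurable_EFinP; exact: measurable_funM.
move=> x _; rewrite /= lee_fin [leRHS]ger0_norm ?addr_ge0//.
rewrite !normrM [X in _ <= X * _ + _]ger0_norm ?powR_ge0//.
by rewrite -[X in _ + X]mul1r -mulrDl ler_wpM2r// le_powR_add1.
Qed.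

Lemma integrable_norm_Lfun_tame p F w : 1 <= p -> F \in Lfun mu p%:E -> tame w ->
  mu.-integrable setT (EFin \o (fun x => `|F x| * `|w x|)).
Proof.
move=> p1 Fp tw; have := integrable_abse (integrable_Lfun_tame p1 Fp tw).
by apply: eq_integrable => // x _ /=; rewrite normrM.
Qed.

(** For finite [q], [|w|^q <= M^(q-1) |w|] where [M] bounds [|w|]. *)
Lemma Lfun_tame q w : (1 <= q)%E -> tame w -> w \in Lfun mu q.
Proof.
move=> q1 [mw [M wM] iw]; apply/LfunE; split => //.
case: q q1 => [q|_|//]; last first.
  rewrite unlock; case: ifPn => // _.
  apply: (@le_lt_trans _ _ M%:E); last exact: ltry.
  by apply/ess_supP; apply: aeW => x /=; rewrite lee_fin.
rewrite lee_fin => q1.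
have q0 : 0 < q by exact: lt_le_trans q1.
rewrite unlock /=; apply: poweR_lty.
have M0 : 0 <= M by exact: le_trans (normr_ge0 _) (wM 0).
apply: (@le_lt_trans _ _ ((M `^ (q - 1))%:E * \int[mu]_x `|(EFin \o w) x|)%E).
  rewrite -ge0_integralZl//=; last 2 first.
  - by apply/measurable_EFinP; exact: measurableT_comp.
  - by rewrite lee_fin powR_ge0.
  apply: ge0_le_integral => //=.
  - apply/measurable_EFinP.
    by apply: measurable_fun_powR; exact: measurableT_comp.
  - by apply/measurable_EFinP; apply: measurable_funM => //; exact: measurableT_comp.
  move=> x _; rewrite lee_fin.
  by rewrite powR_pred// ler_wpM2r// ge0_ler_powR ?nnegrE// subr_ge0.
have /integrableP[_ ?] := iw.
by rewrite lte_mul_pinfty// lee_fin powR_ge0.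
Qed.

Definition gauss_weight c x : R := expR (- (c * x ^+ 2)).

Lemma gauss_weight_ge0 c x : 0 <= gauss_weight c x.
Proof. exact: expR_ge0. Qed.

Lemma measurable_gauss_weight c : measurable_fun setT (gauss_weight c).
Proof. by apply: measurableT_comp => //; apply: measurableT_comp => //; apply: measurable_funM. Qed.

Lemma tame_gauss_weight c : 0 < c -> tame (gauss_weight c).
Proof.
move=> c0; split; first exact: measurable_gauss_weight.
  exists 1 => x; rewrite ger0_norm ?gauss_weight_ge0//.
  by rewrite -expR0 ler_expR oppr_le0 mulr_ge0 ?sqr_ge0// ltW.
apply/integrableP; split; first by apply/measurable_EFinP; exact: measurable_gauss_weight.
under eq_integral do rewrite /= ger0_norm ?gauss_weight_ge0//.
by rewrite integral_gauss// ltry.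
Qed.

End weights.

Section heat_bounds.
Context {R : realType}.
Local Notation mu := (@lebesgue_measure R).
Implicit Types (F f g w : R -> R) (p t x y : R).

(** Absorbs a factor [x] into a Gaussian at the cost of an arbitrarily small change [d] of its
    rate. *)
Lemma normr_le_gauss (d x : R) : 0 < d -> `|x| <= (1 + d^-1) * expR (d * x ^+ 2).
Proof.
move=> d0; have dx := expR_ge1Dx (d * x ^+ 2).
have d1 : 0 < 1 + d^-1 by rewrite addr_gt0// invr_gt0.
apply: (@le_trans _ _ ((1 + d^-1) * (1 + d * x ^+ 2))); last by rewrite ler_wpM2l// ltW.
rewrite mulrDl mul1r mulrDr mulr1 mulKf ?gt_eqF//.
have h : `|x| <= 1 + x ^+ 2.
  rewrite -real_normK ?num_real//; have := sqr_ge0 (`|x| - 1); nra.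
have : 0 <= d^-1 by rewrite invr_ge0 ltW.
have : 0 <= d * x ^+ 2 by rewrite mulr_ge0 ?sqr_ge0// ltW.
lra.
Qed.

(** Each use of the recurrence brings a factor [x], paid for by a loss of rate. Quantifying over all
    rates strictly below the limiting one lets the induction start from a slightly larger rate. *)
Lemma heatD_bound0 k (a b c : R) : 0 < a -> a <= b -> 0 < c -> c < (4 * b)^-1 ->
  exists2 C : R, 0 <= C & forall t x, a <= t -> t <= b -> `|heatD k t x| <= C * gauss_weight c x.
Proof.
move=> a0 ab; have b0 := lt_le_trans a0 ab.
suff H : forall c : R, 0 < c -> c < (4 * b)^-1 ->
  (exists2 C : R, 0 <= C & forall t x, a <= t -> t <= b -> `|heatD k.-1 t x| <= C * gauss_weight c x) /\
  (exists2 C : R, 0 <= C & forall t x, a <= t -> t <= b -> `|heatD k t x| <= C * gauss_weight c x).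
  by move=> c0 cb; have [] := H c c0 cb.
elim: k => [|k IH] {}c c0 cb.
  suff H : exists2 C : R, 0 <= C & forall t x, a <= t -> t <= b -> `|heatD 0 t x| <= C * gauss_weight c x by [].
  exists ((2 * Num.sqrt (pi * a))^-1); first by rewrite invr_ge0 mulr_ge0// sqrtr_ge0.
  move=> t x at_ tb; have t0 := lt_le_trans a0 at_.
  rewrite ger0_norm ?heat_ge0// /= /heat ler_pM ?expR_ge0//.
  - rewrite lef_pV2 ?posrE ?heat_cst_gt0// ler_wpM2l// ler_wsqrtr//.
    by rewrite ler_wpM2l// pi_ge0.
  rewrite ler_expR mulNr lerN2 mulrC ler_wpM2l ?sqr_ge0//.
  rewrite (le_trans (ltW cb))// lef_pV2 ?posrE ?mulr_gt0//.
  by rewrite ler_wpM2l.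
split; first by have [] := IH c c0 cb.
(* The gap [d] between the rates is what [normr_le_gauss] spends on the factor [x]. *)
pose c' := (c + (4 * b)^-1) / 2; pose d := c' - c.
have c'b : c' < (4 * b)^-1 by rewrite /c'; lra.
have d0 : 0 < d by rewrite /d /c'; lra.
have c'0 : 0 < c' by rewrite /c'; lra.
have [[C1 C10 H1] [C C0 H]] := IH c' c'0 c'b.
exists (((1 + d^-1) * C + k%:R * C1) / (2 * a)).
  rewrite divr_ge0// ?mulr_ge0 ?(ltW a0)// addr_ge0// mulr_ge0// addr_ge0// invr_ge0 ltW//.
move=> t x at_ tb; have t0 := lt_le_trans a0 at_.
have -> : heatD k.+1 t x = - (x * heatD k t x + k%:R * heatD k.-1 t x) / (2 * t) by [].
rewrite normrM normrN mulrAC ler_pM//.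
  rewrite (le_trans (ler_normD _ _))// !normrM [`|k%:R|]ger0_norm// mulrDl lerD//.
    rewrite (le_trans (ler_pM (normr_ge0 _) (normr_ge0 _) (normr_le_gauss x d0) (H t x at_ tb)))//.
    rewrite mulrACA ler_wpM2l//; first by rewrite mulr_ge0// addr_ge0// invr_ge0 ltW.
    by rewrite -expRD ler_expR -mulNr -mulrDl /d; lra.
  rewrite -mulrA ler_wpM2l// (le_trans (H1 t x at_ tb))// ler_wpM2l//.
  rewrite ler_expR lerN2 ler_wpM2r ?sqr_ge0//; move: d0; rewrite /d; lra.
by rewrite ger0_norm ?invr_ge0 ?mulr_ge0 ?(ltW t0)// lef_pV2 ?posrE ?mulr_gt0// ler_wpM2l.
Qed.

(** One Gaussian dominates the kernel for all times in a compact range and all shifts of size at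
    most [1]; this is the majorant for differentiating under the integral, in space and in time. *)
Lemma heatD_bound k (a b : R) : 0 < a -> a <= b ->
  exists C c : R, [/\ 0 <= C, 0 < c & forall t x h, a <= t -> t <= b -> `|h| <= 1 ->
    `|heatD k t (x + h)| <= C * gauss_weight c x].
Proof.
move=> a0 ab; have b0 := lt_le_trans a0 ab.
have b8 : 0 < (8 * b)^-1 by rewrite invr_gt0 mulr_gt0.
have b84 : (8 * b)^-1 < (4 * b)^-1 by rewrite ltf_pV2 ?posrE ?mulr_gt0// ltr_pM2r// ltr_nat.
have [C C0 H] := heatD_bound0 k a0 ab b8 b84.
(* Since [(x + h)^2 >= x^2 / 2 - h^2], half of the rate survives, and [h^2 <= 1] goes into the
   constant. *)
exists (C * expR ((8 * b)^-1)), ((8 * b)^-1 / 2); split.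
- by rewrite mulr_ge0// expR_ge0.
- by rewrite divr_gt0.
move=> t x h at_ tb h1; rewrite (le_trans (H t _ at_ tb))// -mulrA ler_wpM2l//.
rewrite /gauss_weight -expRD ler_expR; move: {H b84} (_^-1) b8 => e e0.
have h2 : h ^+ 2 <= 1 by rewrite -real_normK ?num_real// expr_le1.
have : 0 <= e * ((x + 2 * h) ^+ 2 / 2 + (1 - h ^+ 2)).
  by rewrite mulr_ge0 ?(ltW e0)// addr_ge0 ?subr_ge0// divr_ge0 ?sqr_ge0.
lra.
Qed.

Lemma continuous_heatD k t : t != 0 -> continuous (heatD k t).
Proof. by move=> t0 x; apply: is_derive_continuous; exact: is_derive_heatD. Qed.

Lemma measurable_heatD k t : t != 0 -> measurable_fun setT (heatD k t).
Proof. by move=> t0; apply: continuous_measurable_fun; exact: continuous_heatD. Qed.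

Lemma tame_heatD k t : 0 < t -> tame (heatD k t).
Proof.
move=> t0; have [C [c [C0 c0 H]]] := heatD_bound k t0 (lexx t).
apply: (tame_le (c := C) (tame_gauss_weight c0)).
  by apply: measurable_heatD; rewrite gt_eqF.
by move=> x; have := H t x 0; rewrite addr0; apply => //; rewrite normr0.
Qed.

Lemma is_derive_under_integral (f df : R -> R -> R) (G : R -> R) (a u v : R) :
  u < a < v ->
  (forall x, u < x < v -> mu.-integrable setT (EFin \o f x)) ->
  (forall x y, u < x < v -> is_derive x 1 (f ^~ y) (df x y)) ->
  mu.-integrable setT (EFin \o G) ->
  (forall x y, u < x < v -> `|df x y| <= G y) ->
  is_derive a 1 (fun x => \int[mu]_y f x y) (\int[mu]_y df a y).
Proof.
move=> auv fi fd iG dG.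
have Iuv x : `]u, v[%classic x -> u < x < v by rewrite /= in_itv.
have aI : `]u, v[%classic a by rewrite /= in_itv.
have pE x y : `]u, v[%classic x -> partial1of2 f x y = df x y.
  by move=> xI; apply: derive1_is_derive; apply: fd; exact: Iuv.
have G0 y : 0 <= G y by exact: le_trans (normr_ge0 _) (dG a y auv).
have fi' x : `]u, v[%classic x -> mu.-integrable setT (EFin \o f x).
  by move=> /Iuv; exact: fi.
have fd' x y : `]u, v[%classic x -> setT y -> derivable (f ^~ y) x 1.
  by move=> /Iuv xI _; have [] := fd x y xI.
have dG' x y : `]u, v[%classic x -> setT y -> `|partial1of2 f x y| <= G y.
  by move=> xI _; rewrite pE//; apply: dG; exact: Iuv.
split; first exact: (derivable_under_integral measurableT aI fi' fd' G0 iG dG').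
rewrite -derive1E (differentiation_under_integral measurableT aI fi' fd' G0 iG dG').
by apply: eq_Rintegral => y _; exact: pE.
Qed.

Lemma integrable_conv k t p F x : 0 < t -> 1 <= p -> F \in Lfun mu p%:E ->
  mu.-integrable setT (EFin \o (fun y => F y * heatD k t (x - y))).
Proof.
move=> t0 p1 Fp; apply: (integrable_Lfun_tame (w := fun y => heatD k t (x - y)) p1 Fp).
by apply: tame_subl; exact: tame_heatD.
Qed.

Lemma is_derive_conv k t p F x : 0 < t -> 1 <= p -> F \in Lfun mu p%:E ->
  is_derive x 1 (convolution F (heatD k t)) (convolution F (heatD k.+1 t) x).
Proof.
move=> t0 p1 Fp; have [C [c [C0 c0 H]]] := heatD_bound k.+1 t0 (lexx t).
have tw : tame (fun y => C * gauss_weight c (x - y)).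
  apply: (tame_le (c := C) (tame_subl x (tame_gauss_weight c0))).
    apply: measurable_funM => //; apply: measurableT_comp.
      exact: measurable_gauss_weight.
    exact: measurable_subl.
  by move=> y; rewrite ger0_norm// mulr_ge0// gauss_weight_ge0.
(* The interval of radius [1] around [x] is the range of shifts that [heatD_bound] allows. *)
apply: (@is_derive_under_integral (fun x y => F y * heatD k t (x - y))
  (fun x y => F y * heatD k.+1 t (x - y)) (fun y => `|F y| * `|C * gauss_weight c (x - y)|) x (x - 1) (x + 1)).
- by apply/andP; split; lra.
- by move=> z _; exact: (integrable_conv k z t0 p1 Fp).
- move=> z y _.
  have dz : is_derive z 1 (fun z => z - y) (1 + 0).
    exact: (is_derive_addfun (is_derive_idfun z) (is_derive_cstfun (- y) z)).
  have dh := is_derive_compfun (g := fun z => z - y) (is_derive_heatD k (z - y) (lt0r_neq0 t0)) dz.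
  apply: (is_derive_eqfun (is_derive_mulfun (is_derive_cstfun (F y) z) dh)) => //.
  by rewrite mul0r add0r addr0 mulr1.
- exact: (integrable_norm_Lfun_tame p1 Fp tw).
move=> z y /andP[z1 z2]; rewrite normrM ler_wpM2l//.
rewrite [X in _ <= X]ger0_norm ?mulr_ge0 ?gauss_weight_ge0//.
have -> : z - y = (x - y) + (z - x) by lra.
by apply: H => //; rewrite ler_norml; apply/andP; split; lra.
Qed.

Lemma is_derive_conv_time k t p F x : 0 < t -> 1 <= p -> F \in Lfun mu p%:E ->
  is_derive t 1 (fun s => convolution F (heatD k s) x) (convolution F (heatD k.+2 t) x).
Proof.
move=> t0 p1 Fp.
(* Times stay between [t / 2] and [2 t], so the majorant is uniform and away from the singular time
   [0]. *)
have t20 : 0 < t / 2 by rewrite divr_gt0.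
have tt : t / 2 <= 2 * t by lra.
have [C [c [C0 c0 H]]] := heatD_bound k.+2 t20 tt.
have tw : tame (fun y => C * gauss_weight c (x - y)).
  apply: (tame_le (c := C) (tame_subl x (tame_gauss_weight c0))).
    apply: measurable_funM => //; apply: measurableT_comp.
      exact: measurable_gauss_weight.
    exact: measurable_subl.
  by move=> y; rewrite ger0_norm// mulr_ge0// gauss_weight_ge0.
apply: (@is_derive_under_integral (fun s y => F y * heatD k s (x - y))
  (fun s y => F y * heatD k.+2 s (x - y)) (fun y => `|F y| * `|C * gauss_weight c (x - y)|) t (t / 2) (2 * t)).
- by apply/andP; split; lra.
- by move=> z /andP[z0 _]; exact: (integrable_conv k x (lt_trans t20 z0) p1 Fp).
- move=> z y /andP[z0 _].
  have zp : 0 < z by exact: lt_trans z0.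
  apply: (is_derive_eqfun (is_derive_mulfun (is_derive_cstfun (F y) z) (is_derive_heatD_time k (x - y) zp))) => //.
  by rewrite mul0r add0r.
- exact: (integrable_norm_Lfun_tame p1 Fp tw).
move=> z y /andP[z1 z2]; rewrite normrM ler_wpM2l//.
rewrite [X in _ <= X]ger0_norm ?mulr_ge0 ?gauss_weight_ge0//.
by have := H z (x - y) 0; rewrite addr0; apply; rewrite ?normr0// ltW.
Qed.

End heat_bounds.

(** * Functions determined by their integrals over intervals *)

Section almost_everywhere_lebesgue.
Context {R : realType}.
Local Notation mu := (@lebesgue_measure R).

Lemma ae_imply (P Q : R -> Prop) : (forall x, P x -> Q x) ->
  {ae mu, forall x, P x} -> {ae mu, forall x, Q x}.
Proof. by move=> PQ; apply: filterS; first exact: (ae_filter_ringOfSetsType mu). Qed.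

Lemma ae_imply2 (P Q S : R -> Prop) : (forall x, P x -> Q x -> S x) ->
  {ae mu, forall x, P x} -> {ae mu, forall x, Q x} -> {ae mu, forall x, S x}.
Proof. by move=> PQ; apply: filterS2; first exact: (ae_filter_ringOfSetsType mu). Qed.

End almost_everywhere_lebesgue.

Section locally_integrable_functions.
Context {R : realType}.
Local Notation mu := (@lebesgue_measure R).
Implicit Types (f g : R -> R) (a b : R) (q : \bar R).

Lemma locally_integrable_itv f a b : locally_integrable setT f ->
  mu.-integrable `[a, b] (EFin \o f).
Proof.
move=> [mf _ lf]; apply/integrableP; split.
  by apply/measurable_EFinP; exact: measurable_funS mf.
by apply: lf => //; exact: segment_compact.
Qed.

(** Lebesgue differentiation of the integrals based at [- n] gives equality almost everywhere to the
    right of [- n]; countably many [n] cover the line. *)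
Lemma ae_eq_itv_Rintegral f g :
  locally_integrable setT f -> locally_integrable setT g ->
  (forall a b, a <= b -> \int[mu]_(y in `[a, b]) f y = \int[mu]_(y in `[a, b]) g y) ->
  {ae mu, forall x, f x = g x}.
Proof.
move=> lf lg fg.
have H (n : nat) : {ae mu, forall x, - n%:R < x -> f x = g x}.
  have Hf := FTC1 (a := BLeft (- n%:R)) (fun y => locally_integrable_itv _ y lf) lf.
  have Hg := FTC1 (a := BLeft (- n%:R)) (fun y => locally_integrable_itv _ y lg) lg.
  have E : (fun x => \int[mu]_(t in [set` Interval (BLeft (- n%:R)) (BRight x)]) f t) =
           (fun x => \int[mu]_(t in [set` Interval (BLeft (- n%:R)) (BRight x)]) g t).
    apply/funext => x; have [nx|nx] := leP (- n%:R) x; first exact: fg.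
    by rewrite set_itv_ge ?bnd_simp -?ltNge// !Rintegral_set0.
  move: Hf Hg; apply: ae_imply2 => x /= + + nx.
  have nx' : ((- n%:R)%:E < x%:E)%E by rewrite lte_fin.
  by rewrite E => /(_ nx')[_ <-] /(_ nx')[_ <-].
move/ae_foralln : H; apply: ae_imply => x Hx.
apply: (Hx (Num.trunc `|x|).+1).
rewrite ltrNl; apply: le_lt_trans (truncnS_gt _).
by rewrite -normrN ler_norm.
Qed.

Lemma lebesgue_measureT_gt0 : (0 < mu setT)%E.
Proof. apply: (@lt_le_trans _ _ (mu (`[0, 1]%classic : set R))).
  by rewrite lebesgue_measure_itv/= lte_fin ltr01 oppr0 adde0 lte_fin.
by apply: le_measure; rewrite ?inE. Qed.

Lemma LnormyE f : 'N[mu]_+oo[EFin \o f]%E = ess_sup mu (fun x => `|f x|%:E).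
Proof. by rewrite unlock lebesgue_measureT_gt0. Qed.

Lemma LnormE (p : R) f : 'N[mu]_p%:E[EFin \o f]%E = ((\int[mu]_x (`|f x| `^ p)%:E) `^ p^-1)%E.
Proof. by rewrite unlock. Qed.

(** On a set of finite measure, [|f| <= |f|^q + 1] is integrable, and so is the essential bound when
    [q = +oo]. *)
Lemma Lfun_locally_integrable q f : (1 <= q)%E -> f \in Lfun mu q -> locally_integrable setT f.
Proof.
move=> q1 fq; have /LfunE[mf fin_f] := fq.
split=> // [|K _ cK]; first exact: openT.
have muK : (mu K < +oo)%E by exact: compact_finite_measure.
have mK : measurable K by exact: compact_measurable.
have mfn : measurable_fun K (fun x => `|f x|).
  by apply: measurable_funTS; exact: measurableT_comp.
case: q q1 fq fin_f => [q|_ _ fin_f|//]; last first.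
  have E0 : (0 <= 'N[mu]_+oo[EFin \o f])%E by exact: Lnorm_ge0.
  have fN : ('N[mu]_+oo[EFin \o f] \is a fin_num)%E by rewrite ge0_fin_numE.
  apply: (@le_lt_trans _ _ (\int[mu]_(x in K) 'N[mu]_+oo[EFin \o f])%E).
    apply: ae_ge0_le_integral => //.
    - by apply/measurable_EFinP.
    - have := ess_sup_ge mu (fun x => `|f x|%:E); rewrite -LnormyE.
      by apply: ae_imply => x fx _.
  rewrite integral_cst// lte_mul_pinfty//.
rewrite lee_fin => q1 fq _.
have /integrableP[mfq ifq] := Lfun_integrable q1 fq.
apply: (@le_lt_trans _ _ (\int[mu]_(x in K) ((`|f x| `^ q)%:E + 1))%E).
  apply: ge0_le_integral => //=.
  - exact/measurable_EFinP.
  - by apply: emeasurable_funD => //; exact: measurable_funTS.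
  - by move=> x _; rewrite lee_fin le_powR_add1.
rewrite ge0_integralD//=; last exact: measurable_funTS.
rewrite integral_cst//= mul1e lte_add_pinfty//.
apply: le_lt_trans ifq.
under [leRHS]eq_integral do rewrite gee0_abs ?lee_fin ?powR_ge0//.
by apply: ge0_subset_integral.
Qed.

Lemma ae_eq_Lfun_itv q1 q2 f g : (1 <= q1)%E -> (1 <= q2)%E ->
  f \in Lfun mu q1 -> g \in Lfun mu q2 ->
  (forall a b, a <= b -> \int[mu]_(y in `[a, b]) f y = \int[mu]_(y in `[a, b]) g y) ->
  {ae mu, forall x, f x = g x}.
Proof.
move=> q11 q21 fq gq; apply: ae_eq_itv_Rintegral.
- exact: Lfun_locally_integrable fq.
- exact: Lfun_locally_integrable gq.
Qed.

Lemma indefinite_integralP (G g : R -> R) : continuous g ->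
  (forall x : R, is_derive x 1 G (g x)) -> indefinite_integral G g.
Proof.
move=> cg dG a b; rewrite le_eqVlt => /predU1P[->|ab].
  by rewrite subrr set_itv1 Rintegral_set1.
have cG x : {for x, continuous G} by exact: is_derive_continuous.
rewrite /Rintegral (continuous_FTC2 (F := G) ab)//.
- exact: continuous_subspaceT.
- split=> [x _||]; first by have [] := dG x.
    by apply: cvg_at_right_filter; exact: cG.
  by apply: cvg_at_left_filter; exact: cG.
- by move=> x _; exact: derive1_is_derive.
Qed.

End locally_integrable_functions.

Section integral_pairing.
Context {R : realType}.
Local Notation mu := (@lebesgue_measure R).
Implicit Types (F G : R -> R) (f : schwartz R -> R) (p t x : R) (k : nat).

Lemma is_derive_heatD_subl k t x (y : R) : t != 0 ->
  is_derive y 1 (fun y => heatD k t (x - y)) (- heatD k.+1 t (x - y)).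
Proof.
move=> t0.
have dx : is_derive y 1 (fun y => x - y) (0 + - 1).
  exact: (is_derive_addfun (is_derive_cstfun x y) (is_derive_oppfun (is_derive_idfun y))).
have dh := is_derive_compfun (g := fun y => x - y) (is_derive_heatD k (x - y) t0) dx.
by apply: (is_derive_eqfun dh) => //; rewrite add0r mulrN1.
Qed.

Lemma continuous_heatD_subl k t x : t != 0 -> continuous (fun y => heatD k t (x - y)).
Proof. by move=> t0 y; apply: is_derive_continuous; exact: is_derive_heatD_subl. Qed.

Lemma tameN (w : R -> R) : tame w -> tame (fun x => - w x).
Proof.
move=> tw; apply: (tame_le (c := 1) (tame_norm tw)).
  by have [mw _ _] := tw; exact: measurableT_comp.
by move=> x; rewrite normrN mul1r.
Qed.

(** The density is a choice. The explicit derivative in [y] shows that a density exists, and any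
    other has the same integral over every interval, hence agrees with it almost everywhere. *)
Lemma Lq_density_heatD (q : \bar R) k t x : (1 <= q)%E -> 0 < t ->
  Lq_density q (fun y => heatD k t (x - y)) \in Lfun mu q /\
  {ae mu, forall y, Lq_density q (fun y => heatD k t (x - y)) y = - heatD k.+1 t (x - y)}.
Proof.
move=> q1 t0; have tN0 : t != 0 by rewrite gt_eqF.
pose g y := - heatD k.+1 t (x - y).
have cg : continuous g by move=> y; apply: cvgN; exact: continuous_heatD_subl.
have gq : g \in Lfun mu q.
  by apply: Lfun_tame => //; apply: tameN; apply: tame_subl; exact: tame_heatD.
have gi : indefinite_integral (fun y => heatD k t (x - y)) g.
  by apply: indefinite_integralP => // y; exact: is_derive_heatD_subl.
have [dq di] : [set g | g \in Lfun mu q /\ indefinite_integral (fun y => heatD k t (x - y)) g]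
    (Lq_density q (fun y => heatD k t (x - y))).
  by apply: xgetPex; exists g.
by split=> //; apply: (ae_eq_Lfun_itv q1 q1 dq gq) => a b ab; rewrite -di// -gi.
Qed.

End integral_pairing.

(** * Fubini's theorem and the symmetry of the heat convolution *)

Section fubini_pairing.
Context {R : realType}.
Local Notation mu := (@lebesgue_measure R).
Implicit Types (F k : R -> R) (p t s x y z : R).

Lemma measurable_fst_fun (f : R -> R) : measurable_fun setT f ->
  measurable_fun setT (fun u : measurableTypeR R * measurableTypeR R => f u.1).
Proof. by move=> mf; apply: (measurableT_comp mf); exact: measurable_fst. Qed.

Lemma measurable_snd_fun (f : R -> R) : measurable_fun setT f ->
  measurable_fun setT (fun u : measurableTypeR R * measurableTypeR R => f u.2).
Proof. by move=> mf; apply: (measurableT_comp mf); exact: measurable_snd. Qed.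

Lemma measurable_sub_fun (f : R -> R) : measurable_fun setT f ->
  measurable_fun setT (fun u : measurableTypeR R * measurableTypeR R => f (u.1 - u.2)).
Proof.
move=> mf; apply: (measurableT_comp mf).
by apply: measurable_funB; [exact: measurable_fst|exact: measurable_snd].
Qed.

Lemma EFin_Rintegral (f : R -> R) : mu.-integrable setT (EFin \o f) ->
  (\int[mu]_x f x)%:E = (\int[mu]_x (f x)%:E)%E.
Proof. by move=> fi; rewrite /Rintegral fineK//; exact: integrable_fin_num. Qed.

Lemma Rintegral_fubini (f : R -> R -> R) :
  (mu \x mu)%E.-integrable setT (fun u => (f u.1 u.2)%:E) ->
  (forall x, mu.-integrable setT (EFin \o f x)) ->
  (forall y, mu.-integrable setT (EFin \o f ^~ y)) ->
  mu.-integrable setT (EFin \o (fun x => \int[mu]_y f x y)) /\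
  \int[mu]_x \int[mu]_y f x y = \int[mu]_y \int[mu]_x f x y.
Proof.
move=> fi f1 f2; split.
  have := integrable_fubini_F fi; apply: eq_integrable => // x _.
  by rewrite /fubini_F /= EFin_Rintegral.
rewrite /Rintegral; congr fine.
transitivity (\int[mu]_x \int[mu]_y (f x y)%:E)%E.
  by apply: eq_integral => x _; exact: EFin_Rintegral.
transitivity (\int[mu]_y \int[mu]_x (f x y)%:E)%E; first exact: (Fubini fi).
by apply: eq_integral => y _; rewrite -EFin_Rintegral.
Qed.

Lemma measurable_heat_subl t x : measurable_fun setT (fun y => heat t (x - y)).
Proof. by apply: measurableT_comp; [exact: measurable_heat|exact: measurable_subl]. Qed.

Lemma measurable_heat_subr t y : measurable_fun setT (fun x => heat t (x - y)).
Proof. by apply: measurableT_comp; [exact: measurable_heat|exact: measurable_funB]. Qed.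

Lemma heat_semigroup_sub s t y z : 0 < s -> 0 < t ->
  (\int[mu]_x (heat t (y - x) * heat s (x - z))%:E = (heat (s + t) (y - z))%:E)%E.
Proof.
move=> s0 t0; rewrite [s + t]addrC -(heat_semigroup _ t0 s0).
rewrite -(@ge0_integral_addr R z); last 2 first.
- by apply/measurable_EFinP; apply: measurable_funM;
    [exact: measurable_heat_subl|exact: measurable_heat_subr].
- by move=> x; rewrite lee_fin mulr_ge0// heat_ge0.
by apply: eq_integral => x _; rewrite addrK opprD addrA addrAC.
Qed.

(** By Tonelli one may integrate in [x] first: the semigroup law bounds the inner integral by a
    multiple of [heat (s + t) (y - z)], a tame weight for [F]. *)
Lemma integrable_conv_pairing p F t s (C : R) z k : 0 < t -> 0 < s -> 1 <= p ->
  F \in Lfun mu p%:E -> measurable_fun setT k -> (forall x, `|k x| <= C * heat s (x - z)) ->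
  (mu \x mu)%E.-integrable setT (fun u => (F u.2 * heat t (u.1 - u.2) * k u.1)%:E).
Proof.
move=> t0 s0 p1 Fp mk kC; have /LfunE[mF _] := Fp.
have st0 : 0 < s + t by rewrite addr_gt0.
have C0 : 0 <= C.
  by have := le_trans (normr_ge0 _) (kC z); rewrite pmulr_lge0// heat_gt0.
pose f (u : measurableTypeR R * measurableTypeR R) := (F u.2 * heat t (u.1 - u.2) * k u.1)%:E.
have mf : measurable_fun setT f.
  apply/measurable_EFinP; apply: measurable_funM; last exact: measurable_fst_fun.
  apply: measurable_funM; first exact: measurable_snd_fun.
  by apply: measurable_sub_fun; exact: measurable_heat.
apply/(integrable12ltyP mu mu mf).
rewrite (fubini_tonelli (fun u => `|f u|)%E); last 2 first.
- exact: measurableT_comp.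
- by move=> u; exact: abse_ge0.
have tw : tame (fun y => C * heat (s + t) (y - z)).
  apply: (tame_le (c := C) (tame_subl z (tame_heatD 0 st0))).
    apply: measurable_funM => //; apply: measurableT_comp; first exact: measurable_heat.
    exact: measurable_funB.
  by move=> y /=; rewrite ger0_norm ?mulr_ge0 ?heat_ge0// heatBC.
have /integrableP[_] := integrable_norm_Lfun_tame p1 Fp tw.
apply: le_lt_trans; apply: ge0_le_integral => //.
- by move=> y _; apply: integral_ge0 => x _; exact: abse_ge0.
- by apply: (measurable_fun_fubini_tonelli_G (m1 := mu) (fun u => `|f u|)%E) => //; exact: measurableT_comp.
- apply: measurableT_comp => //; apply/measurable_EFinP; apply: measurable_funM; first exact: measurableT_comp.
  by have [mw _ _] := tw; exact: measurableT_comp.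
move=> y _ /=.
have bound (x : R) : `|F y * heat t (x - y) * k x| <= `|F y| * C * (heat t (y - x) * heat s (x - z)).
  rewrite 2!normrM [`|heat t (x - y)|]ger0_norm ?heat_ge0// heatBC.
  by rewrite -[leLHS]mulrA -[leRHS]mulrA ler_wpM2l// [leRHS]mulrCA ler_wpM2l ?heat_ge0.
apply: (@le_trans _ _ (\int[mu]_x ((`|F y| * C)%:E * (heat t (y - x) * heat s (x - z))%:E))%E).
  apply: ge0_le_integral => //.
  - apply/measurable_EFinP; apply: measurableT_comp => //; apply: measurable_funM => //.
    by apply: measurable_funM => //; exact: measurable_heat_subr.
  - apply/measurable_EFinP; apply: measurable_funM => //; apply: measurable_funM;
    [exact: measurable_heat_subl|exact: measurable_heat_subr].
  by move=> x _; rewrite lee_fin; exact: bound.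
rewrite ge0_integralZl//=; last 3 first.
- apply/measurable_EFinP; apply: measurable_funM;
    [exact: measurable_heat_subl|exact: measurable_heat_subr].
- by move=> x _; rewrite lee_fin mulr_ge0// heat_ge0.
- by rewrite lee_fin mulr_ge0.
rewrite heat_semigroup_sub// -EFinM lee_fin [leRHS]ger0_norm ?mulr_ge0//.
by rewrite -mulrA ler_wpM2l// ler_norm.
Qed.

(** Convolution with an even kernel is symmetric for the integral pairing. It is applied to
    indicators, for uniqueness, and to a heat kernel, for the semigroup law on [L^p]. *)
Lemma conv_pairing p F t s (C : R) z k : 0 < t -> 0 < s -> 1 <= p ->
  F \in Lfun mu p%:E -> measurable_fun setT k -> (forall x, `|k x| <= C * heat s (x - z)) ->
  mu.-integrable setT (EFin \o (fun x => convolution F (heat t) x * k x)) /\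
  \int[mu]_x (convolution F (heat t) x * k x) = \int[mu]_y (F y * convolution k (heat t) y).
Proof.
move=> t0 s0 p1 Fp mk kC.
have tk : tame k.
  apply: (tame_le (c := C) (tame_subl z (tame_heatD 0 s0))) => // x.
  by rewrite (le_trans (kC x))//= heatBC.
have k1 : k \in Lfun mu 1%:E by exact: Lfun_tame.
have E1 x : \int[mu]_y (F y * heat t (x - y) * k x) = convolution F (heat t) x * k x.
  by rewrite RintegralZr//; exact: (integrable_conv 0 x t0 p1 Fp).
have E2 y : \int[mu]_x (F y * heat t (x - y) * k x) = F y * convolution k (heat t) y.
  rewrite -RintegralZl//; last exact: (integrable_conv 0 y t0 (lexx 1) k1).
  by apply: eq_Rintegral => x _; rewrite -mulrA [k x * _]mulrC heatBC.
have [|||h1 h2] := @Rintegral_fubini (fun x y => F y * heat t (x - y) * k x).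
- exact: (integrable_conv_pairing t0 s0 p1 Fp mk kC).
- move=> x; have := integrableZr measurableT (k x) (integrable_conv 0 x t0 p1 Fp).
  by apply: eq_integrable.
- move=> y; have := integrableZl measurableT (F y) (integrable_conv 0 y t0 (lexx 1) k1).
  by apply: eq_integrable => // x _ /=; rewrite -EFinM -mulrA [k x * _]mulrC heatBC.
split.
  by apply: eq_integrable h1 => // x _ /=; rewrite E1.
under eq_Rintegral do rewrite -E1.
by rewrite h2; apply: eq_Rintegral => y _; exact: E2.
Qed.

End fubini_pairing.

(** * Uniqueness of the primitive *)

Section schwartz_heat.
Context {R : realType}.
Local Notation mu := (@lebesgue_measure R).
Implicit Types (A F G f : R -> R) (p t s x y z c : R) (m n k : nat).

Lemma derive1n_heat_subl n t x : 0 < t ->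
  derive1n n (fun y => heat t (x - y)) = fun y => (-1) ^+ n * heatD n t (x - y).
Proof.
move=> t0; elim: n => [|n IH]; first by apply/funext => y; rewrite mul1r.
rewrite derive1nS IH; apply/funext => y; apply: derive1_is_derive.
have := is_derive_mulfun (is_derive_cstfun ((-1) ^+ n : R) y)
  (is_derive_heatD_subl n x y (lt0r_neq0 t0)).
by move=> /is_derive_eqfun; apply => //; rewrite mul0r add0r exprS mulN1r mulNr mulrN.
Qed.

(** Half of the Gaussian rate absorbs one factor, and the other half is left for the induction. *)
Lemma monomial_gauss_bound m x c : 0 < c ->
  exists2 C : R, 0 <= C & forall z, `|x - z| ^+ m * gauss_weight c z <= C.
Proof.
elim: m c => [|m IH] c c0.
  exists 1 => // z; rewrite expr0 mul1r -expR0 ler_expR oppr_le0.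
  by rewrite mulr_ge0 ?sqr_ge0// ltW.
have c2 : 0 < c / 2 by rewrite divr_gt0.
have [C C0 H] := IH _ c2.
have d0 : 0 <= (c / 2)^-1 by rewrite invr_ge0 ltW.
exists ((`|x| + (1 + (c / 2)^-1)) * C).
  by rewrite mulr_ge0// addr_ge0// addr_ge0.
move=> z; rewrite exprS.
have -> : gauss_weight c z = gauss_weight (c / 2) z * gauss_weight (c / 2) z.
  by rewrite /gauss_weight -expRD; congr expR; lra.
rewrite mulrACA ler_pM ?mulr_ge0 ?exprn_ge0 ?gauss_weight_ge0//.
have zc := normr_le_gauss z c2.
have e1 : gauss_weight (c / 2) z <= 1.
  by rewrite -[leRHS]expR0 ler_expR oppr_le0 mulr_ge0 ?sqr_ge0// ltW.
apply: (@le_trans _ _ ((`|x| + `|z|) * gauss_weight (c / 2) z)).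
  by rewrite ler_wpM2r ?gauss_weight_ge0// ler_normB.
rewrite mulrDl lerD//; first by rewrite ler_piMr.
apply: (le_trans (ler_wpM2r (gauss_weight_ge0 _ _) zc)).
by rewrite /gauss_weight -[leLHS]mulrA -expRD subrr expR0 mulr1.
Qed.

Lemma heat_test_subproof t x : 0 < t -> (fun y => heat t (x - y)) \in schwartz_pred.
Proof.
move=> t0; rewrite inE; split.
  move=> n y _; rewrite derive1n_heat_subl//.
  have := is_derive_mulfun (is_derive_cstfun ((-1) ^+ n : R) y)
    (is_derive_heatD_subl n x y (lt0r_neq0 t0)).
  by case.
move=> m n; have [C [c [C0 c0 H]]] := heatD_bound n t0 (lexx t).
have [D D0 HD] := monomial_gauss_bound m x c0.
exists (C * D) => y; rewrite derive1n_heat_subl// !normrM !normrX normrN1 expr1n mul1r.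
have Hy : `|heatD n t (x - y)| <= C * gauss_weight c (x - y).
  by have := H t (x - y) 0; rewrite addr0 normr0; apply.
apply: (le_trans (ler_wpM2l (exprn_ge0 m (normr_ge0 y)) Hy)).
rewrite mulrCA ler_wpM2l//.
by have := HD (x - y); rewrite opprB addrCA subrr addr0.
Qed.

Definition heat_test t x (t0 : 0 < t) : schwartz R := Schwartz (heat_test_subproof x t0).

(** Evaluating the distribution on translated kernels recovers a genuine function. The sign of the
    distributional derivative cancels the one produced by [x - y]. *)
Lemma distr_deriv_heat_test p F t x (t0 : 0 < t) : 1 <= p -> F \in Lfun mu p%:E ->
  distr_deriv (distr_of_fun F) (heat_test x t0) = convolution F (heatD 1 t) x.
Proof.
move=> p1 Fp; rewrite /distr_deriv /distr_of_fun /convolution.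
have E y : schwartz_deriv (heat_test x t0) y = - heatD 1 t (x - y).
  exact: (derive1_is_derive (is_derive_heatD_subl 0 x y (lt0r_neq0 t0))).
rewrite -mulN1r -RintegralZl//.
  by apply: eq_Rintegral => y _; rewrite E mulrN mulN1r opprK.
have := integrableN (integrable_conv 1 x t0 p1 Fp).
apply: eq_integrable => // y _.
by change (- (F y * heatD 1 t (x - y))%:E = (F y * schwartz_deriv (heat_test x t0) y)%:E)%E; rewrite E mulrN.
Qed.

End schwartz_heat.

Section uniqueness.
Context {R : realType}.
Local Notation mu := (@lebesgue_measure R).
Implicit Types (A F G f : R -> R) (p t s x y z c : R) (m n k : nat).

(** Substituting [x = y + sqrt t * z] moves [t] into the argument of [k], so that for bounded [k]
    the fixed kernel [heat 1] gives a majorant as [t] tends to [0]. *)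
Lemma conv_heat_scaling (k : R -> R) t y : 0 < t -> measurable_fun setT k ->
  (forall x, 0 <= k x) ->
  convolution k (heat t) y = \int[mu]_z (k (y + Num.sqrt t * z) * heat 1 z).
Proof.
move=> t0 mk k0; rewrite /convolution /Rintegral; congr fine.
have st0 : 0 < Num.sqrt t by rewrite sqrtr_gt0.
have mf : measurable_fun setT (fun x => (k x * heat t (y - x))%:E).
  by apply/measurable_EFinP; apply: measurable_funM => //; exact: measurable_heat_subl.
have := @ge0_integral_affine R y (Num.sqrt t) _ (lt0r_neq0 st0) mf.
rewrite (gtr0_norm st0) => H.
transitivity ((Num.sqrt t)%:E * ((Num.sqrt t)^-1%:E * \int[mu]_x (k x * heat t (y - x))%:E))%E.
  by rewrite muleA -EFinM mulfV ?gt_eqF// mul1e.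
rewrite -H; last by move=> x; rewrite lee_fin mulr_ge0// heat_ge0.
have mg : measurable_fun setT (fun z => (k (y + Num.sqrt t * z) * heat t (y - (y + Num.sqrt t * z)))%:E).
  by apply: (measurableT_comp mf); exact: measurable_affine.
rewrite -ge0_integralZl//; last by move=> z _; rewrite lee_fin mulr_ge0// heat_ge0.
apply: eq_integral => z _; rewrite -EFinM mulrCA; congr (_ * _)%:E.
rewrite opprD addrA subrr add0r heatN /heat !mulr1 mulrA.
congr (_ * expR _).
  by rewrite sqrtrM ?pi_ge0// [X in X^-1]mulrA invfM mulrCA mulfV ?mulr1 ?gt_eqF.
by rewrite exprMn sqr_sqrtr ?(ltW t0)//; field; rewrite gt_eqF.
Qed.

(** Away from the endpoints the rescaled integrand is, for each [z], eventually constant in [n];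
    dominated convergence does the rest. *)
Lemma conv_indic_cvg (a b y : R) : y != a -> y != b ->
  convolution (\1_(`[a, b]) : R -> R) (heat n.+1%:R^-1) y @[n --> \oo] --> (\1_(`[a, b]) y : R).
Proof.
move=> ya yb.
have mI : measurable_fun setT (\1_(`[a, b]) : R -> R) by exact: measurable_indic.
have e0 n : 0 < n.+1%:R^-1 :> R by rewrite invr_gt0.
pose f_ n z := (\1_(`[a, b]) (y + Num.sqrt n.+1%:R^-1 * z) * heat 1 z : R)%:E.
have E n : convolution (\1_(`[a, b]) : R -> R) (heat n.+1%:R^-1) y = fine (\int[mu]_z f_ n z).
  by rewrite conv_heat_scaling.
under eq_fun do rewrite E.
have e_cvg : Num.sqrt (n.+1%:R^-1 : R) @[n --> \oo] --> (0 : R).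
  by have := cvg_comp _ _ (@cvg_harmonic R) (@sqrt_continuous R 0); rewrite sqrtr0.
have ptw z : \forall n \near \oo, \1_(`[a, b]) (y + Num.sqrt n.+1%:R^-1 * z) = \1_(`[a, b]) y :> R.
  have yz : y + Num.sqrt n.+1%:R^-1 * z @[n --> \oo] --> y.
    rewrite -[X in _ --> X]addr0; apply: cvgD; first exact: cvg_cst.
    by rewrite -[X in _ --> X](mul0r z); apply: cvgM => //; exact: cvg_cst.
  have [ay|ay] := ltP a y; last first.
    have {}ay : y < a by rewrite lt_neqAle ya.
    near=> n; have na : y + Num.sqrt n.+1%:R^-1 * z < a by near: n; exact: (cvgr_lt _ yz _ ay).
    by rewrite !indicE !mem_setE /= !in_itv/= !leNgt na ay.
  have [yltb|yb'] := ltP y b.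
    near=> n; rewrite !indicE !mem_setE /= !in_itv/= !(ltW ay) !(ltW yltb).
    rewrite !ltW//; near: n.
      exact: (cvgr_lt _ yz _ yltb).
    exact: (cvgr_gt _ yz _ ay).
  have {}yb' : b < y by rewrite lt_neqAle eq_sym yb.
  near=> n; have na : b < y + Num.sqrt n.+1%:R^-1 * z by near: n; exact: (cvgr_gt _ yz _ yb').
  by rewrite !indicE !mem_setE /= !in_itv/= ![_ <= b]leNgt na yb' !andbF.
have [|||||h1 _ h3] := @dominated_convergence _ _ _ mu setT measurableT f_
  (fun z => (\1_(`[a, b]) y * heat 1 z)%:E) (fun z => (heat 1 z)%:E).
- move=> n; apply/measurable_EFinP; apply: measurable_funM; last exact: measurable_heat.
  by apply: (measurableT_comp mI); exact: measurable_affine.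
- by apply/measurable_EFinP; apply: measurable_funM => //; exact: measurable_heat.
- apply: aeW => z _; apply: cvg_near_cst.
  by have := ptw z; apply: filterS => n; rewrite /f_ => ->.
- exact: integrable_heat.
- apply: aeW => z n _; rewrite /f_ /= lee_fin normrM [X in _ * X]ger0_norm ?heat_ge0//.
  by rewrite ler_piMl ?heat_ge0// indicE; case: (_ \in _); rewrite ?normr1 ?normr0.
have -> : \1_(`[a, b]) y = fine (\int[mu]_z (\1_(`[a, b]) y * heat 1 z : R)%:E)%E.
  have := RintegralZl (\1_(`[a, b]) y : R) measurableT (integrable_heat (ltr01 : 0 < 1 :> R)).
  by rewrite /Rintegral/= integral_heat// mulr1 => ->.
apply: fine_cvg; rewrite fineK//; exact: integrable_fin_num.
Unshelve. all: end_near. Qed.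

(** The constant is the inverse of the least value of the kernel over [|x| <= M]. The form [x - 0]
    is the one that [conv_pairing] expects. *)
Lemma indic_le_heat (a b : R) : exists C : R, forall x, `|\1_(`[a, b]) x : R| <= C * heat 1 (x - 0).
Proof.
pose M := Num.max `|a| `|b|; exists (heat 1 M)^-1 => x.
have h0 z : 0 < heat 1 z by exact: heat_gt0.
rewrite subr0 indicE; case: (boolP (x \in _)) => [|_]; last by rewrite normr0 mulr_ge0// ltW// ?invr_gt0.
rewrite mem_setE in_itv/= => /andP[ax xb]; rewrite normr1 ler_pdivlMl ?mulr1//.
rewrite /heat ler_wpM2l ?invr_ge0 ?(ltW (heat_cst_gt0 ltr01))// ler_expR !mulNr lerN2.
rewrite ler_wpM2r ?invr_ge0 ?mulr_ge0// -(real_normK (num_real x)) ler_pXn2r ?nnegrE//; last by rewrite le_max normr_ge0.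
rewrite ler_norml /M le_max lerNl !le_max; apply/andP; split.
  by apply/orP; left; rewrite lerNl (le_trans _ ax)// lerNl -normrN ler_norm.
by apply/orP; right; rewrite (le_trans xb)// ler_norm.
Qed.

(** Symmetry moves the regularization from [F] to the indicator of the interval, where convergence
    is pointwise almost everywhere and dominated by a Gaussian. *)
Lemma conv_heat_itv_cvg p F (a b : R) : 1 <= p -> F \in Lfun mu p%:E ->
  \int[mu]_(x in `[a, b]) convolution F (heat n.+1%:R^-1) x @[n --> \oo] -->
  \int[mu]_(x in `[a, b]) F x.
Proof.
move=> p1 Fp; have /LfunE[mF _] := Fp.
have mI : measurable_fun setT (\1_(`[a, b]) : R -> R) by exact: measurable_indic.
have e0 n : 0 < n.+1%:R^-1 :> R by rewrite invr_gt0.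
have [C HC] := indic_le_heat a b.
have C0 : 0 <= C.
  by have := le_trans (normr_ge0 _) (HC 0); rewrite pmulr_lge0// heat_gt0.
pose k : R -> R := \1_(`[a, b]).
have tk : tame k.
  by apply: (tame_le (c := C) (tame_heatD 0 ltr01)) => // x; have := HC x; rewrite subr0.
have kp : k \in Lfun mu 1%:E by exact: Lfun_tame.
have E n : \int[mu]_(x in `[a, b]) convolution F (heat n.+1%:R^-1) x =
    fine (\int[mu]_y (F y * convolution k (heat n.+1%:R^-1) y)%:E).
  have [_ H] := conv_pairing (e0 n) ltr01 p1 Fp mI HC.
  transitivity (\int[mu]_x (convolution F (heat n.+1%:R^-1) x * k x)); last exact: H.
  rewrite Rintegral_mkcond; apply: eq_Rintegral => x _.
  by rewrite patchE /k indicE; case: (_ \in _); rewrite ?mulr1 ?mulr0.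
under eq_fun do rewrite E.
have convk_le n y : `|convolution k (heat n.+1%:R^-1) y| <= C * heat (n.+1%:R^-1 + 1) y.
  have k0 x : 0 <= k x by rewrite /k indicE ler0n.
  rewrite ger0_norm; last by apply: Rintegral_ge0 => x _; rewrite mulr_ge0 ?heat_ge0.
  have -> : heat (n.+1%:R^-1 + 1) y = \int[mu]_x (heat n.+1%:R^-1 (y - x) * heat 1 x).
    by rewrite /Rintegral heat_semigroup.
  have ih : mu.-integrable setT (EFin \o (fun x => heat n.+1%:R^-1 (y - x) * heat 1 x)).
    have := integrable_conv 0 y (e0 n) (lexx 1) (Lfun_tame (lexx _) (tame_heatD 0 (ltr01 : 0 < 1 :> R))).
    by apply: eq_integrable => // x _ /=; rewrite mulrC.
  rewrite -RintegralZl//; apply: le_Rintegral => //.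
  - exact: (integrable_conv 0 y (e0 n) (lexx 1) kp).
  - exact: (integrableZl measurableT C ih).
  move=> x _; rewrite mulrC [leRHS]mulrCA ler_wpM2l ?heat_ge0//.
  by have := HC x; rewrite subr0 ger0_norm.
(* The times [1 / (n + 1) + 1] lie between [1] and [2], whence the rate [1/8] and a normalizing
   factor at most [1]. *)
have heat_le n y : heat (n.+1%:R^-1 + 1) y <= gauss_weight (8^-1) y.
  have n1 : (n.+1%:R^-1 : R) <= 1 by rewrite invf_le1// ler1n.
  have s1 : 1 <= (n.+1%:R^-1 : R) + 1 by rewrite lerDr.
  have s0 : 0 < (n.+1%:R^-1 : R) + 1 by exact: lt_le_trans s1.
  rewrite /heat -[leRHS]mul1r ler_pM ?expR_ge0 ?invr_ge0 ?(ltW (heat_cst_gt0 s0))//.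
    rewrite invf_le1 ?heat_cst_gt0//.
    have : 1 <= Num.sqrt (pi * (n.+1%:R^-1 + 1)) :> R.
      rewrite -[leLHS]sqrtr1 ler_wsqrtr// -[leLHS]mulr1 ler_pM//.
      by have := pi_ge2 R; lra.
    lra.
  rewrite ler_expR mulNr lerN2 mulrC ler_wpM2l ?sqr_ge0// lef_pV2 ?posrE ?mulr_gt0//.
  by move: {s1 s0} (n.+1%:R^-1) n1 => e; lra.
have tw : tame (fun y => C * gauss_weight (8^-1) y).
  apply: (tame_le (c := C) (tame_gauss_weight (c := 8^-1) _)) => //.
    by apply: measurable_funM => //; exact: measurable_gauss_weight.
  by move=> y; rewrite ger0_norm ?mulr_ge0 ?gauss_weight_ge0.
have mconv n : measurable_fun setT (convolution k (heat n.+1%:R^-1)).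
  apply: continuous_measurable_fun => y; apply: is_derive_continuous.
  exact: (is_derive_conv 0 y (e0 n) (lexx 1) kp).
have ae_ab : {ae mu, forall y, y != a /\ y != b}.
  exists ([set a] `|` [set b]); split.
  - by apply: measurableU.
  - apply/eqP; rewrite eq_le measure_ge0 andbT.
    by rewrite (le_trans (measureU2 _ _ _))//= !lebesgue_measure_set1 adde0.
  - move=> y /= /not_andP[] /negP; rewrite negbK => /eqP ->; [by left|by right].
have [|||||h1 _ h3] := @dominated_convergence _ _ _ mu setT measurableT
    (fun n y => (F y * convolution k (heat n.+1%:R^-1) y)%:E) (fun y => (F y * k y)%:E)
    (EFin \o (fun y => `|F y| * `|C * gauss_weight (8^-1) y|)).
- by move=> n; apply/measurable_EFinP; exact: (measurable_funM mF (mconv n)).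
- by apply/measurable_EFinP; exact: (measurable_funM mF mI).
- apply: ae_imply ae_ab => y [ya yb] _; apply: cvg_EFin; first exact: nearW.
  by apply: cvgM; [exact: cvg_cst|exact: conv_indic_cvg].
- exact: (integrable_norm_Lfun_tame p1 Fp tw).
- apply: aeW => y n _; rewrite /= lee_fin normrM ler_wpM2l//.
  by rewrite (le_trans (convk_le n y))// (le_trans _ (ler_norm _))// ler_wpM2l.
have -> : \int[mu]_(x in `[a, b]) F x = fine (\int[mu]_y (F y * k y)%:E)%E.
  rewrite Rintegral_mkcond; apply: eq_Rintegral => x _.
  by rewrite patchE /k indicE; case: (_ \in _); rewrite ?mulr1 ?mulr0.
apply: fine_cvg; rewrite fineK//; exact: integrable_fin_num.
Qed.

End uniqueness.

Section primitives.
Context {R : realType}.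
Local Notation mu := (@lebesgue_measure R).
Implicit Types (A F G : R -> R) (f : schwartz R -> R) (p t s x y z c : R) (m n k : nat).

Lemma ae_eq_Rintegral F G : measurable_fun setT F -> measurable_fun setT G ->
  {ae mu, forall x, F x = G x} -> \int[mu]_x F x = \int[mu]_x G x.
Proof.
move=> mF mG FG; congr fine; apply: ae_eq_integral => //; try exact/measurable_EFinP.
by apply: ae_imply FG => x -> _.
Qed.

Lemma lebesgue_measureT : (mu setT = +oo)%E.
Proof. by rewrite -(set_itvNyy R) lebesgue_measure_itv. Qed.

(** If [c] were not [0], then almost everywhere [|A|] or [|G|] would be at least [|c| / 2]. Scaled
    accordingly, [|A|^p] and [|G|^s] would then have sum at least [1], against the infinite measure
    of the line. *)
Lemma Lfun_cst_eq0 p s A G c : 1 <= p -> 1 <= s -> A \in Lfun mu p%:E -> G \in Lfun mu s%:E ->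
  {ae mu, forall x, A x = G x + c} -> c = 0.
Proof.
move=> p1 s1 Ap Gs AG; apply: contrapT => /eqP c0.
have c20 : 0 < `|c| / 2 by rewrite divr_gt0// normr_gt0.
have iA := Lfun_integrable p1 Ap; have iG := Lfun_integrable s1 Gs.
have i2 := integrableD measurableT (integrableZl measurableT ((`|c| / 2) `^ (- p)) iA)
   (integrableZl measurableT ((`|c| / 2) `^ (- s)) iG).
have /integrableP[m2 fin2] := i2.
have : (+oo <= \int[mu]_x `|((`|c| / 2) `^ (- p))%:E * (`|A x| `^ p)%:E + ((`|c| / 2) `^ (- s))%:E * (`|G x| `^ s)%:E|)%E.
  rewrite -lebesgue_measureT -[X in (X <= _)%E]mul1e -integral_cst//.
  apply: ae_ge0_le_integral => //; first exact: measurableT_comp.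
  have key (r q : R) : 1 <= r -> `|c| / 2 <= `|q| -> 1 <= (`|c| / 2) `^ (- r) * `|q| `^ r.
    move=> r1 cq; rewrite powRN ler_pdivlMl ?powR_gt0// mulr1.
    by rewrite ge0_ler_powR ?nnegrE// ?(ltW c20)// (le_trans ler01).
  apply: ae_imply AG => x AGx _; rewrite /= lee_fin ger0_norm ?addr_ge0 ?mulr_ge0 ?powR_ge0//.
  have [h|h] := leP (`|c| / 2) `|A x|.
    by rewrite -[leLHS]addr0 lerD ?key// mulr_ge0// powR_ge0.
  rewrite -[leLHS]add0r lerD ?mulr_ge0 ?powR_ge0// key//.
  have : `|c| <= `|A x| + `|G x|.
    by rewrite (_ : c = A x - G x) ?ler_normB// AGx addrAC subrr add0r.
  lra.
by rewrite leye_eq => /eqP E; rewrite E in fin2.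
Qed.

Lemma Lfuny_cst c : cst c \in Lfun mu +oo%E.
Proof.
apply/LfunE; split => //; rewrite LnormyE.
apply: (@le_lt_trans _ _ `|c|%:E); last exact: ltry.
by apply/ess_supP; apply: aeW.
Qed.

Lemma integrable_itv_continuous (f : R -> R) (a b : R) : continuous f ->
  mu.-integrable `[a, b] (EFin \o f).
Proof.
move=> cf; apply: continuous_compact_integrable; first exact: segment_compact.
exact: continuous_subspaceT.
Qed.

Lemma continuous_conv k t p F : 0 < t -> 1 <= p -> F \in Lfun mu p%:E ->
  continuous (convolution F (heatD k t)).
Proof. by move=> t0 p1 Fp x; apply: is_derive_continuous; exact: (is_derive_conv k x t0 p1 Fp). Qed.

Lemma Rintegral_itv_cst (a b c : R) : a <= b -> \int[mu]_(x in `[a, b]) c = c * (b - a).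
Proof.
move=> ab; rewrite Rintegral_cst//.
rewrite [X in fine X](_ : _ = if (a%:E < b%:E)%E then (b%:E - a%:E)%E else 0%E); last first.
  exact: (lebesgue_measure_itv `[a, b]).
rewrite lte_fin; move: ab; rewrite le_eqVlt => /predU1P[->|->//]; first by rewrite ltxx subrr !mulr0.
Qed.

(** The regularizations have equal derivatives, so they differ by constants [d n]. Integrals over
    intervals converge, hence [d n] tends to some [c] and [A = G + c] almost everywhere;
    integrability at infinity forces [c = 0]. *)
Lemma conv_heatD1_inj p s A G : 1 <= p -> 1 <= s -> A \in Lfun mu p%:E -> G \in Lfun mu s%:E ->
  (forall t x, 0 < t -> convolution A (heatD 1 t) x = convolution G (heatD 1 t) x) ->
  {ae mu, forall x, A x = G x}.
Proof.
move=> p1 s1 Ap Gs AG.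
pose d n := convolution A (heat n.+1%:R^-1) 0 - convolution G (heat n.+1%:R^-1) 0.
have e0 n : 0 < n.+1%:R^-1 :> R by rewrite invr_gt0.
have dE n x : convolution A (heat n.+1%:R^-1) x = convolution G (heat n.+1%:R^-1) x + d n.
  pose D x := convolution A (heat n.+1%:R^-1) x - convolution G (heat n.+1%:R^-1) x.
  have : D x = D 0.
    apply: is_derive_0_is_cst => z.
    have := is_derive_addfun (is_derive_conv 0 z (e0 n) p1 Ap)
      (is_derive_oppfun (is_derive_conv 0 z (e0 n) s1 Gs)).
    by rewrite AG// subrr.
  have gen (u v w : R) : u - v = w -> u = v + w by move=> <-; rewrite addrC subrK.
  exact: gen.
have iE (a b : R) n : a <= b -> \int[mu]_(x in `[a, b]) convolution A (heat n.+1%:R^-1) x =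
    \int[mu]_(x in `[a, b]) convolution G (heat n.+1%:R^-1) x + d n * (b - a).
  move=> ab; under eq_Rintegral do rewrite dE.
  rewrite RintegralD//; first by rewrite Rintegral_itv_cst.
    exact: (integrable_itv_continuous a b (continuous_conv (k := 0) (e0 n) s1 Gs)).
  by apply: (integrable_itv_continuous (f := fun=> d n)) => x; exact: cvg_cst.
(* On an interval of length [1] the difference of the integrals is [d n] itself. *)
pose c := \int[mu]_(x in `[0, 1]) A x - \int[mu]_(x in `[0, 1]) G x.
have dc : d n @[n --> \oo] --> c.
  have -> : d = (fun n => \int[mu]_(x in `[0, 1]) convolution A (heat n.+1%:R^-1) x
      - \int[mu]_(x in `[0, 1]) convolution G (heat n.+1%:R^-1) x).
    by apply/funext => n; rewrite iE// subr0 mulr1 addrAC subrr add0r.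
  by apply: cvgB; [exact: (conv_heat_itv_cvg p1 Ap)|exact: (conv_heat_itv_cvg s1 Gs)].
have E (a b : R) : a <= b -> \int[mu]_(x in `[a, b]) A x = \int[mu]_(x in `[a, b]) (G x + c).
  move=> ab; rewrite RintegralD//; last 2 first.
  - by apply: locally_integrable_itv; exact: Lfun_locally_integrable Gs.
  - by apply: (integrable_itv_continuous (f := fun=> c)) => x; exact: cvg_cst.
  rewrite Rintegral_itv_cst//.
  apply: (cvg_unique _ (conv_heat_itv_cvg (a := a) (b := b) p1 Ap)); first exact: Rhausdorff.
  rewrite /=; under eq_fun do rewrite iE//.
  apply: cvgD; first exact: (conv_heat_itv_cvg s1 Gs).
  by apply: cvgM => //; exact: cvg_cst.
have AGc : {ae mu, forall x, A x = G x + c}.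
  apply: ae_eq_itv_Rintegral => //; first exact: Lfun_locally_integrable Ap.
  apply: locally_integrableD; first exact: Lfun_locally_integrable Gs.
  exact: (Lfun_locally_integrable (leey _) (Lfuny_cst c)).
have c0 := Lfun_cst_eq0 p1 s1 Ap Gs AGc.
by move: AGc; apply: ae_imply => x ->; rewrite c0 addr0.
Qed.

(** The two exponents may differ; this is what excludes an unrelated [L^s] primitive in (e). *)
Lemma primitive_unique p s f A G : 1 <= p -> 1 <= s ->
  is_primitive p f A -> is_primitive s f G -> {ae mu, forall x, A x = G x}.
Proof.
move=> p1 s1 [Ap fA] [Gs fG]; apply: (conv_heatD1_inj p1 s1 Ap Gs) => t x t0.
by rewrite -(distr_deriv_heat_test x t0 p1 Ap) -(distr_deriv_heat_test x t0 s1 Gs) -fA -fG.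
Qed.

Lemma is_primitive_primitive p f : LpD p f -> is_primitive p f (primitive p f).
Proof. by move=> [_ [F fF]]; apply: xgetPex; exists F. Qed.

(** Replaces both choices made by [LpD_int], of the primitive and of the density, by explicit
    functions equal to them almost everywhere. The two minus signs cancel. *)
Lemma LpD_int_heatD p f F k t x : 1 <= p -> LpD p f -> is_primitive p f F -> 0 < t ->
  LpD_int p f (fun y => heatD k t (x - y)) = convolution F (heatD k.+1 t) x.
Proof.
move=> p1 fp fF t0; have p1' : (1 <= p%:E)%E by rewrite lee_fin.
have q1 := hoelder_conj_ge1 p1'.
have fP := is_primitive_primitive fp.
have PF := primitive_unique p1 p1 fP fF.
have [dL dE] := Lq_density_heatD k x q1 t0.
have /LfunE[mP _] := fP.1; have /LfunE[mF _] := fF.1; have /LfunE[md _] := dL.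
rewrite /LpD_int (@ae_eq_Rintegral _ (fun y => - (F y * heatD k.+1 t (x - y)))).
- have := RintegralZl (-1) measurableT (integrable_conv k.+1 x t0 p1 fF.1).
  under eq_Rintegral do rewrite mulN1r.
  by move=> ->; rewrite mulN1r opprK.
- exact: (measurable_funM mP md).
- apply: measurableT_comp => //; apply: (measurable_funM mF).
  apply: measurableT_comp; last exact: measurable_subl.
  by apply: measurable_heatD; rewrite gt_eqF.
by apply: ae_imply2 PF dE => y -> ->; rewrite mulrN.
Qed.

End primitives.

(** * Derivatives of L^p functions as tempered distributions *)

Section tempered_derivatives.
Context {R : realType}.
Local Notation mu := (@lebesgue_measure R).
Implicit Types (F G u v : R -> R) (phi : schwartz R) (p t s x y z c : R) (m n k : nat).

Lemma uniform_cvg0P (f_ : nat -> R -> R) (e : R) : 0 < e ->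
  {uniform, f_ @ \oo --> (cst 0 : R -> R)} ->
  \forall k \near \oo, forall x, `|f_ k x| <= e.
Proof.
move=> e0 H; apply: (H [set h | forall x, `|h x| <= e]).
apply/uniform_nbhs; exists [set xy | ball xy.1 e xy.2]; split; first by rewrite -entourage_ballE; exists e.
move=> h /= hb x; have := hb x I; rewrite /ball/= sub0r normrN.
exact: ltW.
Qed.

Lemma tame_oneDsqrV : tame (fun x : R => (oneDsqr x)^-1).
Proof.
have mo : measurable_fun setT (fun x : R => (oneDsqr x)^-1).
  by apply: continuous_measurable_fun; exact: continuous_oneDsqrV.
have o0 x : 0 <= (oneDsqr x)^-1 :> R by rewrite invr_ge0 (le_trans ler01)// oneDsqr_ge1.
split=> //; first by exists 1 => x; rewrite ger0_norm// oneDsqrV_le1.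
apply/integrableP; split; first exact/measurable_EFinP.
under eq_integral do rewrite /= ger0_norm//.
rewrite ge0_symfun_integralT//; first last.
- by move=> x; rewrite /= /oneDsqr sqrrN.
- exact: continuous_oneDsqrV.
have -> : [set x : R | 0 <= x] = `[0, +oo[%classic.
  by apply/seteqP; split => x /=; rewrite in_itv/= andbT.
by rewrite integral0y_oneDsqr -EFinM ltry.
Qed.

Lemma schwartz_smooth phi n x : derivable (derive1n n phi) x 1.
Proof. by have := schwartz_valP phi; rewrite inE => -[+ _]; apply. Qed.

Lemma schwartz_is_derive phi x : is_derive x 1 phi (schwartz_deriv phi x).
Proof.
have h := @schwartz_smooth phi 0%N x.
apply: DeriveDef; first exact: h.
by rewrite -derive1E.
Qed.

Lemma continuous_schwartz phi : continuous phi.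
Proof. by move=> x; apply: is_derive_continuous; exact: schwartz_is_derive. Qed.

Lemma schwartz_bound phi : exists2 C : R, 0 <= C & forall x, `|phi x| <= C * (oneDsqr x)^-1.
Proof.
have := schwartz_valP phi; rewrite inE => -[_ dphi].
have [C0 H0] := dphi 0%N 0%N; have [C2 H2] := dphi 2%N 0%N.
have C00 : 0 <= C0 by exact: le_trans (normr_ge0 _) (H0 0).
have C20 : 0 <= C2 by exact: le_trans (normr_ge0 _) (H2 0).
exists (C0 + C2); first exact: addr_ge0.
move=> x; rewrite ler_pdivlMr; last by rewrite (lt_le_trans ltr01)// oneDsqr_ge1.
have := H0 x; have := H2 x; rewrite expr0 mul1r normrM [`|x ^+ 2|]ger0_norm ?sqr_ge0//= /oneDsqr.
lra.
Qed.

Lemma tame_schwartz phi : tame phi.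
Proof.
have [C C0 H] := schwartz_bound phi.
apply: (tame_le tame_oneDsqrV _ H).
by apply: continuous_measurable_fun; exact: continuous_schwartz.
Qed.

Lemma integrable_Lfun_schwartz p F phi : 1 <= p -> F \in Lfun mu p%:E ->
  mu.-integrable setT (EFin \o (fun x => F x * phi x)).
Proof. by move=> p1 Fp; apply: (integrable_Lfun_tame p1 Fp); exact: tame_schwartz. Qed.

(** Continuity uses two seminorms only: the suprema of [|phi'|] and of [|x^2 phi'|] together control
    [(1 + x^2) |phi'|], and [F] is integrable against [1 / (1 + x^2)]. *)
Lemma tempered_distr_deriv p F : 1 <= p -> F \in Lfun mu p%:E ->
  tempered (distr_deriv (distr_of_fun F)).
Proof.
move=> p1 Fp; split.
  move=> a u v; rewrite /distr_deriv /distr_of_fun.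
  have E x : schwartz_deriv (a *: u + v) x = a * schwartz_deriv u x + schwartz_deriv v x.
    have D := is_derive_addfun (is_derive_mulfun (is_derive_cstfun a x) (schwartz_is_derive u x)) (schwartz_is_derive v x).
    by rewrite [LHS](derive1_is_derive D) mul0r add0r.
  under eq_Rintegral do rewrite E mulrDr mulrCA.
  rewrite RintegralD//; last 2 first.
  - exact: (integrableZl measurableT a (integrable_Lfun_schwartz (schwartz_deriv u) p1 Fp)).
  - exact: (integrable_Lfun_schwartz (schwartz_deriv v) p1 Fp).
  rewrite RintegralZl//; last exact: (integrable_Lfun_schwartz (schwartz_deriv u) p1 Fp).
  by rewrite opprD mulrN.
move=> phi_ phi cvg_phi.
have io := integrable_norm_Lfun_tame p1 Fp tame_oneDsqrV.
pose M := \int[mu]_x (`|F x| * `|(oneDsqr x)^-1|).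
have M0 : 0 <= M by apply: Rintegral_ge0 => x _; rewrite mulr_ge0.
apply/cvgrPdist_le => e e0.
(* Makes [2 * d * M <= e]; the [+ 1] covers [M = 0]. *)
pose d := e / (2 * (M + 1)).
have d0 : 0 < d by rewrite divr_gt0// mulr_gt0// ltr_wpDl.
have h0 := uniform_cvg0P d0 (cvg_phi 0%N 1%N).
have h2 := uniform_cvg0P d0 (cvg_phi 2%N 1%N).
have [N0 _ H0] := h0; have [N2 _ H2] := h2.
exists (maxn N0 N2) => // k /=; rewrite geq_max => /andP[N0k N2k].
have {}h0 x : `|schwartz_deriv (phi_ k - phi) x| <= d.
  by have := H0 _ N0k x; rewrite expr0 mul1r.
have {}h2 x : `|x ^+ 2 * schwartz_deriv (phi_ k - phi) x| <= d by exact: H2 _ N2k x.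
have h x : `|schwartz_deriv (phi_ k - phi) x| <= 2 * d * `|(oneDsqr x)^-1|.
  have o1 := oneDsqr_ge1 x.
  rewrite [`|(oneDsqr x)^-1|]ger0_norm ?invr_ge0 ?(le_trans ler01)// ler_pdivlMr ?(lt_le_trans ltr01)//.
  have := h0 x; have := h2 x; rewrite normrM [`|x ^+ 2|]ger0_norm ?sqr_ge0// /oneDsqr; lra.
have E x : schwartz_deriv (phi_ k - phi) x = schwartz_deriv (phi_ k) x - schwartz_deriv phi x.
  by apply: derive1_is_derive; exact: (is_derive_addfun (schwartz_is_derive (phi_ k) x)
    (is_derive_oppfun (schwartz_is_derive phi x))).
rewrite /distr_deriv /distr_of_fun opprK addrC -RintegralB//; last 2 first.
- exact: (integrable_Lfun_schwartz (schwartz_deriv (phi_ k)) p1 Fp).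
- exact: (integrable_Lfun_schwartz (schwartz_deriv phi) p1 Fp).
under eq_Rintegral do rewrite -mulrBr -E.
have iD := integrable_Lfun_schwartz (schwartz_deriv (phi_ k - phi)) p1 Fp.
apply: (le_trans (le_normr_Rintegral measurableT iD)).
apply: (@le_trans _ _ (2 * d * M)); last first.
  have M10 : 0 < M + 1 by rewrite ltr_wpDl.
  have -> : 2 * d * M = e * (M / (M + 1)).
    by rewrite /d; move: (M) M10 => a a0; field; rewrite gt_eqF.
  by rewrite ler_piMr ?(ltW e0)// ler_pdivrMr// mul1r lerDl.
rewrite /M -RintegralZl//; apply: le_Rintegral => //.
- exact: (integrable_abse iD).
- exact: (integrableZl measurableT (2 * d) io).
by move=> x _; rewrite normrM mulrCA ler_wpM2l// h.
Qed.

Lemma LpD_distr_deriv p F : 1 <= p -> F \in Lfun mu p%:E ->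
  LpD p (distr_deriv (distr_of_fun F)) /\ is_primitive p (distr_deriv (distr_of_fun F)) F.
Proof.
move=> p1 Fp; have fF : is_primitive p (distr_deriv (distr_of_fun F)) F by [].
by split => //; split; [exact: (tempered_distr_deriv p1 Fp)|exists F].
Qed.

(** Integration by parts without boundary terms: on [[- n - 1, n + 1]] the integral is a difference
    of two values of [u], which the quadratic decay sends to [0]. *)
Lemma Rintegral_derivative0 (u u' : R -> R) (C : R) :
  continuous u' -> mu.-integrable setT (EFin \o u') ->
  (forall x : R, is_derive x 1 u (u' x)) ->
  (forall x, `|u x| <= C * (oneDsqr x)^-1) -> \int[mu]_x u' x = 0.
Proof.
move=> cu' iu' du uC.
have C0 : 0 <= C by have := le_trans (normr_ge0 _) (uC 0); rewrite /oneDsqr expr0n addr0 invr1 mulr1.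
pose f_ n x := (u' x * \1_(`[- n.+1%:R, n.+1%:R]) x)%:E.
have mu' : measurable_fun setT u' by exact: continuous_measurable_fun.
have [|||||h1 _ h3] := @dominated_convergence _ _ _ mu setT measurableT f_ (EFin \o u') (fun x => `|(EFin \o u') x|)%E.
- move=> n; apply/measurable_EFinP; apply: (measurable_funM mu').
  by apply: measurable_indic; exact: measurable_itv.
- exact/measurable_EFinP.
- apply: aeW => x _; apply: cvg_near_cst.
  near=> n; rewrite /f_ indicE mem_set ?mulr1//= in_itv/= -ler_norml.
  rewrite (@le_trans _ _ n%:R)//; last by rewrite ler_nat.
  near: n; exact: nbhs_infty_ger.
- exact: (integrable_abse iu').
- apply: aeW => x n _; rewrite /f_ /= lee_fin normrM ler_piMr// indicE.
  by case: (_ \in _); rewrite ?normr1 ?normr0.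
have E n : fine (\int[mu]_x f_ n x) = u n.+1%:R - u (- n.+1%:R).
  rewrite (indefinite_integralP cu' du); last by rewrite (@le_trans _ _ 0)// oppr_le0.
  rewrite [RHS]Rintegral_mkcond; apply: eq_Rintegral => x _.
  by rewrite patchE indicE; case: (_ \in _); rewrite ?mulr1 ?mulr0.
have cvg1 : u n.+1%:R - u (- n.+1%:R) @[n --> \oo] --> \int[mu]_x u' x.
  under eq_fun do rewrite -E.
  by apply: fine_cvg; rewrite fineK//; exact: integrable_fin_num.
have cvg0 : u n.+1%:R - u (- n.+1%:R) @[n --> \oo] --> 0.
  apply/norm_cvg0P.
  apply: (@squeeze_cvgr _ _ _ _ (cst 0) (fun n => 2 * C * n.+1%:R^-1)).
  - apply: nearW => n; rewrite normr_ge0/= (le_trans (ler_normB _ _))//.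
    have o1 : (oneDsqr n.+1%:R)^-1 <= n.+1%:R^-1 :> R.
      rewrite lef_pV2 ?posrE ?ltr0n//.
      rewrite /oneDsqr (@le_trans _ _ (n.+1%:R ^+ 2))// ?lerDr//.
      by rewrite expr2 ler_peMr// ler1n.
    have h1' : `|u n.+1%:R| <= C * n.+1%:R^-1 by rewrite (le_trans (uC _))// ler_wpM2l.
    have h2' : `|u (- n.+1%:R)| <= C * n.+1%:R^-1.
      by rewrite (le_trans (uC _))// ler_wpM2l// /oneDsqr sqrrN.
    by rewrite -mulrA mulr_natl mulr2n lerD.
  - exact: cvg_cst.
  - rewrite -[X in _ --> X](mulr0 (2 * C)); apply: cvgM; first exact: cvg_cst.
    exact: cvg_harmonic.
by apply: (cvg_unique _ cvg1 cvg0).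
Unshelve. all: end_near. Qed.

End tempered_derivatives.

(** * The convolution as a distribution, its norm and its regularity *)

Section convolution_distribution.
Context {R : realType}.
Local Notation mu := (@lebesgue_measure R).
Implicit Types (F G u v : R -> R) (f : schwartz R -> R) (phi : schwartz R)
  (p t s x y z c : R) (m n k : nat) (q r : \bar R).

Lemma Rintegral_normr_subl (g : R -> R) x : measurable_fun setT g ->
  \int[mu]_y `|g (x - y)| = \int[mu]_y `|g y|.
Proof. by move=> mg; apply: (@Rintegral_subl R x (fun y => `|g y|)); exact: measurableT_comp. Qed.

(** From [|F| <= |F|^p + 1]: the first term meets the supremum of the kernel, the second its
    integral, and neither depends on [x]. *)
Lemma conv_heatD_bounded k t p F : 0 < t -> 1 <= p -> F \in Lfun mu p%:E ->
  exists B : R, forall x, `|convolution F (heatD k t) x| <= B.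
Proof.
move=> t0 p1 Fp; have th := tame_heatD k t0; have [mh [M hM] ih] := th.
have iFp := Lfun_integrable p1 Fp.
exists (M * \int[mu]_y (`|F y| `^ p) + \int[mu]_y `|heatD k t y|) => x.
have iF := integrable_conv k x t0 p1 Fp.
apply: (le_trans (le_normr_Rintegral measurableT iF)).
have i1 := integrableZl measurableT M iFp.
have i2 : mu.-integrable setT (EFin \o (fun y => `|heatD k t (x - y)|)).
  by have [_ _ h] := tame_norm (tame_subl x th).
rewrite -(Rintegral_normr_subl x mh) -RintegralZl// -RintegralD//.
apply: le_Rintegral => //.
- exact: (integrable_abse iF).
- exact: (integrableD measurableT i1 i2).
move=> y _; rewrite normrM.
apply: (@le_trans _ _ ((`|F y| `^ p + 1) * `|heatD k t (x - y)|)).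
  by rewrite ler_wpM2r// le_powR_add1.
by rewrite mulrDl mul1r lerD2r mulrC ler_wpM2r ?powR_ge0.
Qed.

(** Integration by parts against a Schwartz function. For [k = 0] it exhibits [F * heat t] as the
    primitive of [f * heat t]. *)
Lemma distr_of_fun_conv k t p F : 0 < t -> 1 <= p -> F \in Lfun mu p%:E ->
  distr_of_fun (convolution F (heatD k.+1 t)) =
  distr_deriv (distr_of_fun (convolution F (heatD k t))).
Proof.
move=> t0 p1 Fp; apply/funext => phi; rewrite /distr_deriv /distr_of_fun.
set V := convolution F (heatD k t); set V' := convolution F (heatD k.+1 t).
have [B VB] := conv_heatD_bounded k t0 p1 Fp.
have [B' VB'] := conv_heatD_bounded k.+1 t0 p1 Fp.
have cV : continuous V by exact: (continuous_conv t0 p1 Fp).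
have cV' : continuous V' by exact: (continuous_conv t0 p1 Fp).
have iM (W : R -> R) (b : R) (psi : schwartz R) : continuous W -> (forall x, `|W x| <= b) ->
    mu.-integrable setT (EFin \o (fun x => W x * psi x)).
  move=> cW Wb; have tp := tame_schwartz psi; have [mp _ _] := tp.
  have mW : measurable_fun setT W by exact: continuous_measurable_fun.
  have [|x|_ _ //] := tame_le (c := b) (g := fun x => W x * psi x) (tame_norm tp).
    exact: measurable_funM.
  by rewrite normrM ler_wpM2r.
have i1 := iM _ _ phi cV' VB'; have i2 := iM _ _ (schwartz_deriv phi) cV VB.
have [C C0 HC] := schwartz_bound phi.
have B0 : 0 <= B by exact: le_trans (normr_ge0 _) (VB 0).
have : \int[mu]_x (V' x * phi x + V x * schwartz_deriv phi x) = 0.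
  apply: (Rintegral_derivative0 (u := fun x => V x * phi x) (C := B * C)).
  - move=> x; apply: cvgD; apply: cvgM; [exact: cV'|exact: continuous_schwartz|exact: cV|exact: continuous_schwartz].
  - exact: (integrableD measurableT i1 i2).
  - by move=> x; exact: (is_derive_mulfun (is_derive_conv k x t0 p1 Fp) (schwartz_is_derive phi x)).
  - by move=> x; rewrite normrM -mulrA ler_pM.
by rewrite RintegralD// => /eqP; rewrite addr_eq0 => /eqP.
Qed.

Lemma eq_Lnorm_ae q (f g : R -> R) : (1 <= q)%E -> measurable_fun setT f -> measurable_fun setT g ->
  {ae mu, forall x, f x = g x} -> 'N[mu]_q[EFin \o f]%E = 'N[mu]_q[EFin \o g]%E.
Proof.
move=> q1 mf mg fg; case: q q1 => [q q1|_|//].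
  rewrite (LnormE q f) (LnormE q g); apply: (congr1 (poweR ^~ q^-1)).
  apply: ae_eq_integral; first exact: measurableT.
  - by apply/measurable_EFinP; apply: measurable_fun_powR; exact: measurableT_comp.
  - by apply/measurable_EFinP; apply: measurable_fun_powR; exact: measurableT_comp.
  - by move: fg; apply: ae_imply => x -> _.
by rewrite !LnormyE; apply: eq_ess_sup; move: fg; apply: ae_imply => x ->.
Qed.

Lemma LpD_norm_primitive p f F : 1 <= p -> LpD p f -> is_primitive p f F ->
  LpD_norm p f = 'N[mu]_p%:E[EFin \o F]%E.
Proof.
move=> p1 fp fF; rewrite /LpD_norm asboolT//.
have fP := is_primitive_primitive fp.
have /LfunE[mP _] := fP.1; have /LfunE[mF _] := fF.1.
by apply: eq_Lnorm_ae => //; exact: (primitive_unique p1 p1 fP fF).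
Qed.

Lemma LpD_conv_heatD k t p f F : 1 <= p -> LpD p f -> is_primitive p f F -> 0 < t ->
  LpD_conv p f (heatD k t) = convolution F (heatD k.+1 t).
Proof. by move=> p1 fp fF t0; apply/funext => x; exact: LpD_int_heatD. Qed.

Lemma LpD_conv_primitive t p s f F : 1 <= p -> 1 <= s -> LpD p f -> is_primitive p f F -> 0 < t ->
  convolution F (heat t) \in Lfun mu s%:E ->
  LpD s (distr_of_fun (LpD_conv p f (heat t))) /\
  is_primitive s (distr_of_fun (LpD_conv p f (heat t))) (convolution F (heat t)).
Proof.
move=> p1 s1 fp fF t0 Vs.
have -> : distr_of_fun (LpD_conv p f (heat t)) = distr_deriv (distr_of_fun (convolution F (heat t))).
  by rewrite (LpD_conv_heatD 0 p1 fp fF t0) (distr_of_fun_conv 0 t0 p1 fF.1).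
exact: LpD_distr_deriv.
Qed.

Lemma LpD_conv_normE t p r f F : 1 <= p -> (1 <= r)%E -> LpD p f -> is_primitive p f F -> 0 < t ->
  convolution F (heat t) \in Lfun mu r ->
  LpD_conv_norm p r f (heat t) = 'N[mu]_r[EFin \o convolution F (heat t)]%E.
Proof.
move=> p1 r1 fp fF t0; case: r r1 => [r r1|_|//] Vr.
  have [h1 h2] := LpD_conv_primitive p1 r1 fp fF t0 Vr.
  exact: (LpD_norm_primitive r1 h1 h2).
rewrite /LpD_conv_norm; congr (Lnorm _ _ (_ \o _)); apply/funext => x.
have fP := is_primitive_primitive fp.
have /LfunE[mP _] := fP.1; have /LfunE[mF _] := fF.1.
apply: ae_eq_Rintegral.
- by apply: measurable_funM => //; exact: measurable_heat_subl.
- by apply: measurable_funM => //; exact: measurable_heat_subl.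
by have := primitive_unique p1 p1 fP fF; apply: ae_imply => y ->.
Qed.

Lemma unif_continuous_bounded_derive (u u' : R -> R) (B : R) :
  (forall x : R, is_derive x 1 u (u' x)) -> (forall x, `|u' x| <= B) -> unif_continuous u.
Proof.
move=> du uB.
have lip (x y : R) : `|u y - u x| <= `|B| * `|y - x|.
  wlog xy : x y / x <= y.
    by move=> H; have [/H//|/ltW/H] := leP x y; rewrite distrC [`|x - y|]distrC.
  move: xy; rewrite le_eqVlt => /predU1P[->|xy]; first by rewrite !subrr normr0 mulr0.
  have cu : {within `[x, y], continuous u}.
    by apply: continuous_subspaceT => z; exact: is_derive_continuous.
  have [c _ ->] := MVT xy (fun z _ => du z) cu.
  by rewrite normrM ler_wpM2r// (le_trans (uB c))// ler_norm.
move=> E EE; have : entourage_ ball E by rewrite entourage_ballE.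
case=> e /= e0 eE.
change (entourage [set xy : R * R | E (u xy.1, u xy.2)]).
(* The mean value theorem gives the Lipschitz constant [|B|]; adding [1] keeps the quotient
   meaningful when [B = 0]. *)
rewrite -entourage_ballE; exists (e / (`|B| + 1)) => /=; first by rewrite divr_gt0// ltr_wpDl.
move=> [x y] /= xy; apply: eE; rewrite /ball/= in xy *.
rewrite distrC; apply: le_lt_trans (lip x y) _; rewrite distrC.
apply: (@le_lt_trans _ _ ((`|B| + 1) * `|x - y|)); first by rewrite ler_wpM2r// lerDl.
by rewrite mulrC -ltr_pdivlMr// ltr_wpDl.
Qed.

Lemma derive1n_conv n t p F : 0 < t -> 1 <= p -> F \in Lfun mu p%:E ->
  derive1n n (convolution F (heatD 1 t)) = convolution F (heatD n.+1 t).
Proof.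
move=> t0 p1 Fp; elim: n => [//|n IH]; rewrite derive1nS IH; apply/funext => x.
by apply: derive1_is_derive; exact: (is_derive_conv n.+1 x t0 p1 Fp).
Qed.

Lemma derive1n_conv_time n p F x (v : R -> R) : 1 <= p -> F \in Lfun mu p%:E ->
  (forall t, 0 < t -> v t = convolution F (heatD 1 t) x) ->
  forall t, 0 < t -> derive1n n v t = convolution F (heatD (n.*2).+1 t) x.
Proof.
move=> p1 Fp vE; elim: n => [|n IH] t t0; first exact: vE.
rewrite derive1nS; apply: derive1_is_derive.
apply: (is_derive_near (is_derive_conv_time n.*2.+1 x t0 p1 Fp)).
by near=> s; rewrite IH//; near: s; exact: lt_nbhsr.
Unshelve. all: end_near. Qed.

End convolution_distribution.

(** * Young's inequality with the sharp constant *)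

Lemma le_poweR (R : realType) (x y : \bar R) (r : R) : 0 <= r -> (0 <= x)%E ->
  (x <= y)%E -> (x `^ r <= y `^ r)%E.
Proof.
move=> r0 x0 xy; apply: gt0_ler_poweR => //; rewrite in_itv/= leey andbT//.
exact: le_trans xy.
Qed.

Section young.
Context {R : realType}.
Local Notation mu := (@lebesgue_measure R).
Implicit Types (F G g W k : R -> R) (p q r t x y : R).

(** Hoelder's inequality for [g W^(1/q)] and [W^(1/q')]. The case [q = 1], where [q'] is infinite,
    is immediate. *)
Lemma weighted_jensen g W q : 1 <= q -> measurable_fun setT g -> measurable_fun setT W ->
  (forall x, 0 <= g x) -> (forall x, 0 <= W x) -> (\int[mu]_x (W x)%:E < +oo)%E ->
  ((\int[mu]_x (g x * W x)%:E) `^ q <=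
   (\int[mu]_x (W x)%:E) `^ (q - 1) * \int[mu]_x (g x `^ q * W x)%:E)%E.
Proof.
move=> q1 mg mW g0 W0 finW.
have IW : (0 <= \int[mu]_x (W x)%:E)%E by apply: integral_ge0 => x _; rewrite lee_fin.
have Ig : (0 <= \int[mu]_x (g x * W x)%:E)%E by apply: integral_ge0 => x _; rewrite lee_fin mulr_ge0.
have Igq : (0 <= \int[mu]_x (g x `^ q * W x)%:E)%E.
  by apply: integral_ge0 => x _; rewrite lee_fin mulr_ge0// powR_ge0.
move: q1; rewrite le_eqVlt => /predU1P[<-|q1].
  rewrite subrr poweRe0 mul1e (poweRe1 Ig) le_eqVlt; apply/orP; left; apply/eqP.
  by apply: eq_integral => x _; rewrite powRr1.
have q0 : 0 < q by exact: lt_trans q1.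
have qm0 : 0 < q - 1 by rewrite subr_gt0.
pose q' := q / (q - 1).
have q'0 : 0 < q' by rewrite divr_gt0.
have qq' : q^-1 + q'^-1 = 1 by rewrite /q'; field; rewrite !gt_eqF.
have := hoelder mu (f := fun x => g x * W x `^ q^-1) (g := fun x => W x `^ q'^-1) (p := q) (q := q').
move=> /(_ _ _ q0 q'0 qq'); rewrite Lnorm1 !LnormE.
have -> : (\int[mu]_x `|(EFin \o ((fun x => g x * W x `^ q^-1) \* (fun x => W x `^ q'^-1))%R) x| =
   \int[mu]_x (g x * W x)%:E)%E.
  apply: eq_integral => x _ /=.
  rewrite ger0_norm ?mulr_ge0 ?powR_ge0// -mulrA -powRD; last by rewrite qq' oner_eq0.
  by rewrite qq' powRr1.
have -> : (\int[mu]_x (`|g x * W x `^ q^-1| `^ q)%:E = \int[mu]_x (g x `^ q * W x)%:E)%E.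
  apply: eq_integral => x _ /=.
  rewrite ger0_norm ?mulr_ge0 ?powR_ge0// powRM ?powR_ge0// -powRrM mulVf ?gt_eqF//.
  by rewrite powRr1.
have -> : (\int[mu]_x (`|W x `^ q'^-1| `^ q')%:E = \int[mu]_x (W x)%:E)%E.
  apply: eq_integral => x _ /=.
  by rewrite ger0_norm ?powR_ge0// -powRrM mulVf ?gt_eqF// powRr1.
move=> H; apply: (@le_trans _ _ (((\int[mu]_x (g x `^ q * W x)%:E) `^ q^-1 *
   (\int[mu]_x (W x)%:E) `^ q'^-1) `^ q)%E).
  apply: le_poweR (ltW q0) Ig _.
  apply: H; [by apply: measurable_funM => //; exact: measurable_fun_powR|exact: measurable_fun_powR].
rewrite poweRM ?poweR_ge0// -!poweRrM mulVf ?gt_eqF// poweRe1//.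
by rewrite muleC (_ : q'^-1 * q = q - 1)// /q'; field; rewrite !gt_eqF.
Qed.

Lemma tonelli_conv k G : measurable_fun setT k -> measurable_fun setT G ->
  (forall x, 0 <= k x) -> (forall x, 0 <= G x) ->
  (\int[mu]_x \int[mu]_y (G y * k (x - y))%:E = (\int[mu]_y (G y)%:E) * \int[mu]_x (k x)%:E)%E.
Proof.
move=> mk mG k0 G0.
rewrite (fubini_tonelli (fun u : measurableTypeR R * measurableTypeR R => (G u.2 * k (u.1 - u.2))%:E)); last 2 first.
- by apply/measurable_EFinP; apply: measurable_funM; [exact: measurable_snd_fun|exact: measurable_sub_fun].
- by move=> u; rewrite lee_fin mulr_ge0.
have E y : (\int[mu]_x (G y * k (x - y))%:E = (G y)%:E * \int[mu]_x (k x)%:E)%E.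
  under eq_integral do rewrite EFinM.
  rewrite ge0_integralZl//=.
  - congr (_ * _)%E; apply: (@ge0_integral_addr R (- y) (EFin \o k)); first exact/measurable_EFinP.
    by move=> x; rewrite lee_fin.
  - by apply/measurable_EFinP; apply: measurableT_comp => //; exact: measurable_funB.
  - by move=> x _; rewrite lee_fin.
  - by rewrite lee_fin.
transitivity (\int[mu]_y ((G y)%:E * \int[mu]_x (k x)%:E))%E.
  by apply: eq_integral => y _; exact: E.
rewrite ge0_integralZr//.
- exact/measurable_EFinP.
- by move=> x _; rewrite lee_fin.
- by apply: integral_ge0 => x _; rewrite lee_fin.
Qed.

Lemma Lfun_normP p F : 1 <= p -> F \in Lfun mu p%:E -> exists2 nF : R, 0 <= nF &
  'N[mu]_p%:E[EFin \o F]%E = nF%:E /\ (\int[mu]_x (`|F x| `^ p)%:E = (nF `^ p)%:E)%E.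
Proof.
move=> p1 /LfunE[mF fin]; have N0 : (0 <= 'N[mu]_p%:E[EFin \o F])%E by exact: Lnorm_ge0.
have p0 : p != 0 by rewrite gt_eqF// (lt_le_trans ltr01).
exists (fine 'N[mu]_p%:E[EFin \o F]%E); first exact: fine_ge0.
have E : 'N[mu]_p%:E[EFin \o F]%E = (fine 'N[mu]_p%:E[EFin \o F])%:E.
  by rewrite fineK// ge0_fin_numE.
split=> //; have := @poweR_Lnorm _ _ _ mu (EFin \o F) p p0.
by rewrite E poweR_EFin => ->; apply: eq_integral.
Qed.

Lemma Lnorm_le_real r (C : R) F : 0 < r -> 0 <= C ->
  (\int[mu]_x (`|F x| `^ r)%:E <= (C `^ r)%:E)%E -> ('N[mu]_r%:E[EFin \o F] <= C%:E)%E.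
Proof.
move=> r0 C0 H; rewrite LnormE.
have I0 : (0 <= \int[mu]_x (`|F x| `^ r)%:E)%E by apply: integral_ge0 => x _; rewrite lee_fin powR_ge0.
apply: (@le_trans _ _ ((C `^ r)%:E `^ r^-1)%E).
  by apply: le_poweR => //; rewrite invr_ge0 ltW.
by rewrite poweR_EFin -powRrM mulfV ?gt_eqF// powRr1.
Qed.

Lemma le_abse_conv t p F x : 0 < t -> 1 <= p -> F \in Lfun mu p%:E ->
  (`|convolution F (heat t) x|%:E <= \int[mu]_y (`|F y| * heat t (x - y))%:E)%E.
Proof.
move=> t0 p1 Fp; have iF := integrable_conv 0 x t0 p1 Fp.
rewrite -abse_EFin EFin_Rintegral//; apply: (le_trans (le_abse_integral mu measurableT _)).
  by have /integrableP[] := iF.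
apply: ge0_le_integral => //.
- by apply: measurableT_comp => //; have /integrableP[] := iF.
- have /LfunE[mF _] := Fp; apply/measurable_EFinP; apply: measurable_funM; first exact: measurableT_comp.
  exact: measurable_heat_subl.
- by move=> y _; rewrite lee_fin normrM [X in _ * X]ger0_norm// heat_ge0.
Qed.

Lemma powR_conv_le t p q F x : 0 < t -> 1 <= p -> 0 <= q -> F \in Lfun mu p%:E ->
  ((`|convolution F (heat t) x| `^ q)%:E <= (\int[mu]_y (`|F y| * heat t (x - y))%:E) `^ q)%E.
Proof.
move=> t0 p1 q0 Fp; rewrite -poweR_EFin; apply: le_poweR => //.
exact: (le_abse_conv x t0 p1 Fp).
Qed.

Lemma measurable_conv t p F : 0 < t -> 1 <= p -> F \in Lfun mu p%:E ->
  measurable_fun setT (convolution F (heat t)).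
Proof.
move=> t0 p1 Fp; apply: continuous_measurable_fun.
exact: (continuous_conv (k := 0) t0 p1 Fp).
Qed.

(** The case [r = p]: Jensen's inequality for the probability density [heat t (x - y)] in [y], then
    Tonelli. *)
Lemma young_contraction t p F : 0 < t -> 1 <= p -> F \in Lfun mu p%:E ->
  (\int[mu]_x (`|convolution F (heat t) x| `^ p)%:E <= \int[mu]_x (`|F x| `^ p)%:E)%E.
Proof.
move=> t0 p1 Fp; have /LfunE[mF _] := Fp; have p0 : 0 <= p by exact: le_trans p1.
have mFp : measurable_fun setT (fun x => `|F x| `^ p).
  by apply: measurable_fun_powR; exact: measurableT_comp.
rewrite -[leRHS]mule1 -(integral_heat t0) -tonelli_conv//; first last.
- by move=> x; exact: heat_ge0.
- exact: measurable_heat.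
apply: ge0_le_integral => //.
- apply/measurable_EFinP; apply: measurable_fun_powR; apply: measurableT_comp => //.
  exact: (measurable_conv t0 _ Fp).
- apply: (measurable_fun_fubini_tonelli_F (m2 := mu)
    (fun u : measurableTypeR R * measurableTypeR R => (`|F u.2| `^ p * heat t (u.1 - u.2))%:E)).
    apply/measurable_EFinP; apply: measurable_funM; first exact: (measurable_snd_fun mFp).
    by apply: measurable_sub_fun; exact: measurable_heat.
  by move=> u; rewrite lee_fin mulr_ge0 ?powR_ge0 ?heat_ge0.
move=> x _; apply: (le_trans (powR_conv_le x t0 p1 p0 Fp)).
have h1 : (\int[mu]_y (heat t (x - y))%:E = 1)%E.
  rewrite (@ge0_integral_subl R x (EFin \o heat t)) ?integral_heat//.
    by apply/measurable_EFinP; exact: measurable_heat.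
  by move=> y; rewrite lee_fin heat_ge0.
have := @weighted_jensen (fun y => `|F y|) (fun y => heat t (x - y)) p p1.
rewrite h1 poweR1r mul1e; apply => //.
- exact: measurableT_comp.
- exact: measurable_heat_subl.
- by move=> y; exact: heat_ge0.
- exact: ltry.
Qed.

(** The case [p = 1], with the roles exchanged: [|F|] is now the weight and the kernel is raised to
    the power [q]. *)
Lemma young_L1 t q F : 0 < t -> 1 <= q -> F \in Lfun mu 1%:E ->
  (\int[mu]_x (`|convolution F (heat t) x| `^ q)%:E <=
   (\int[mu]_x `|F x|%:E) `^ q * \int[mu]_x (heat t x `^ q)%:E)%E.
Proof.
move=> t0 q1 F1; have /LfunE[mF _] := F1; have q0 : 0 <= q by exact: le_trans q1.
have q0' : 0 < q by exact: lt_le_trans q1.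
have mFn : measurable_fun setT (fun x => `|F x|) by exact: measurableT_comp.
have mh : measurable_fun setT (fun x => heat t x `^ q).
  by apply: measurable_fun_powR; exact: measurable_heat.
have IF : (0 <= \int[mu]_x `|F x|%:E)%E by apply: integral_ge0 => x _; rewrite lee_fin.
have finF : (\int[mu]_x `|F x|%:E < +oo)%E.
  by have /Lfun1_integrable/integrableP[] := F1.
have IFfin : (\int[mu]_x `|F x|%:E \is a fin_num)%E by rewrite ge0_fin_numE.
(* The factor of exponent [q - 1] comes from Jensen's inequality, the remaining one from Tonelli. *)
have -> : ((\int[mu]_x `|F x|%:E) `^ q = (\int[mu]_x `|F x|%:E) `^ (q - 1) * \int[mu]_x `|F x|%:E)%E.
  by rewrite -(fineK IFfin) !poweR_EFin -EFinM -powR_pred// fine_ge0.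
rewrite -muleA -tonelli_conv//; last by move=> x; rewrite powR_ge0.
have mI : measurable_fun setT (fun x => (\int[mu]_y (`|F y| * heat t (x - y) `^ q)%:E)%E).
  apply: (measurable_fun_fubini_tonelli_F (m2 := mu)
    (fun u : measurableTypeR R * measurableTypeR R => (`|F u.2| * heat t (u.1 - u.2) `^ q)%:E)).
    apply/measurable_EFinP; apply: measurable_funM; first exact: (measurable_snd_fun mFn).
    exact: (measurable_sub_fun mh).
  by move=> u; rewrite lee_fin mulr_ge0 ?powR_ge0.
have I0 x : (0 <= \int[mu]_y (`|F y| * heat t (x - y) `^ q)%:E)%E.
  by apply: integral_ge0 => y _; rewrite lee_fin mulr_ge0 ?powR_ge0.
rewrite -ge0_integralZl//; last exact: poweR_ge0.
apply: ge0_le_integral => //.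
- apply/measurable_EFinP; apply: measurable_fun_powR; apply: measurableT_comp => //.
  exact: measurable_conv F1.
- exact: measurable_funeM.
move=> x _; apply: (le_trans (powR_conv_le x t0 (lexx 1) q0 F1)).
have E1 : (\int[mu]_y (`|F y| * heat t (x - y))%:E = \int[mu]_y (heat t (x - y) * `|F y|)%:E)%E.
  by apply: eq_integral => y _; rewrite [in LHS]mulrC.
have E2 : (\int[mu]_y (`|F y| * heat t (x - y) `^ q)%:E = \int[mu]_y (heat t (x - y) `^ q * `|F y|)%:E)%E.
  by apply: eq_integral => y _; rewrite [in LHS]mulrC.
rewrite E1 E2; apply: (@weighted_jensen (fun y => heat t (x - y)) (fun y => `|F y|) q q1) => //.
- exact: measurable_heat_subl.
- by move=> y; exact: heat_ge0.
Qed.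

End young.

Section heat_norm.
Context {R : realType}.
Local Notation mu := (@lebesgue_measure R).
Implicit Types (t q u x : R) (F : R -> R).

Lemma powR_expln (a x : R) : 0 < a -> a `^ x = expR (x * ln a).
Proof. by move=> a0; rewrite /powR gt_eqF. Qed.

Lemma sqrt_expln (a : R) : 0 < a -> Num.sqrt a = expR (ln a / 2).
Proof. by move=> a0; rewrite -powR12_sqrt ?ltW// powR_expln// mulrC. Qed.

Lemma inv_expln (a : R) : 0 < a -> a^-1 = expR (- ln a).
Proof. by move=> a0; rewrite expRN lnK. Qed.

Lemma heat_expln t x : 0 < t ->
  heat t x = expR (- (ln (4 * pi * t) / 2) - x ^+ 2 / (4 * t)).
Proof.
move=> t0; have pi0 : 0 < pi :> R by exact: pi_gt0.
have -> : heat t x = (2 * Num.sqrt (pi * t))^-1 * expR (- x ^+ 2 / (4 * t)) by [].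
have -> : 2 * Num.sqrt (pi * t) = Num.sqrt (4 * pi * t) :> R.
  rewrite [4 * pi * t](_ : _ = 2 ^+ 2 * (pi * t)); last by ring.
  by rewrite [in RHS]sqrtrM ?sqr_ge0// sqrtr_sqr ger0_norm.
rewrite sqrt_expln ?mulr_gt0// -expRN -expRD mulNr.
by [].
Qed.

(* The L^q norm of [heat t] for [u = 1 / q]; [q = +oo] is covered since
   [0 `^ 0 = 1]. *)
Definition heat_norm t u : R := (4 * pi * t) `^ (- ((1 - u) / 2)) * u `^ (u / 2).

Lemma integral_heat_powR t q : 0 < t -> 0 < q ->
  (\int[mu]_x (heat t x `^ q)%:E = (heat_norm t q^-1 `^ q)%:E)%E.
Proof.
move=> t0 q0; have pi0 : 0 < pi :> R by exact: pi_gt0.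
have pt0 : 0 < 4 * pi * t by rewrite !mulr_gt0.
transitivity (\int[mu]_x (expR (- (q / 2 * ln (4 * pi * t))) * expR (- (q / (4 * t) * x ^+ 2)))%:E)%E.
  apply: eq_integral => x _; congr (_%:E).
  rewrite heat_expln// powR_expln ?expR_gt0// expRK -expRD; congr expR.
  by move: (ln _) => l; field; rewrite gt_eqF.
under eq_integral do rewrite EFinM.
rewrite ge0_integralZl//; first last.
  apply/measurable_EFinP; apply: measurableT_comp => //; apply: measurable_funN; exact: measurable_funM.
rewrite integral_gauss ?divr_gt0 ?mulr_gt0// -EFinM; congr (_%:E).
have -> : pi / (q / (4 * t)) = (4 * pi * t) / q :> R.
  by move: pi pi0 pt0 => P *; field; rewrite !gt_eqF.
rewrite sqrt_expln ?divr_gt0// -expRD /heat_norm.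
rewrite (powR_expln _ pt0) (powR_expln _ (_ : 0 < q^-1)) ?invr_gt0// -expRD powR_expln ?expR_gt0//.
rewrite expRK; congr expR; rewrite ln_div ?posrE// lnV ?posrE//.
by move: (ln _) (ln _) => k l; field; rewrite gt_eqF.
Qed.

Lemma heat_le_heat_norm0 t x : 0 < t -> heat t x <= heat_norm t 0.
Proof.
move=> t0; have pi0 : 0 < pi :> R by exact: pi_gt0.
rewrite heat_expln// /heat_norm mul0r powRr0 mulr1 powR_expln ?mulr_gt0// ler_expR.
rewrite subr0 -[leRHS]addr0; apply: lerD; last by rewrite oppr_le0 divr_ge0 ?sqr_ge0 ?mulr_ge0 ?ltW.
by move: (ln _) => l; lra.
Qed.

Lemma heat_norm_ge0 t u : 0 <= heat_norm t u.
Proof. by rewrite mulr_ge0 ?powR_ge0. Qed.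

(** The case [r = +oo] with [p > 1], where Hoelder's inequality and the exact norm of the kernel
    suffice. *)
Lemma conv_heat_le_Lnorm t p q F x : 0 < t -> 1 <= p -> 0 < q -> p^-1 + q^-1 = 1 ->
  F \in Lfun mu p%:E ->
  (`|convolution F (heat t) x|%:E <= 'N[mu]_p%:E[EFin \o F] * (heat_norm t q^-1)%:E)%E.
Proof.
move=> t0 p1 q0 pq Fp; apply: (le_trans (le_abse_conv x t0 p1 Fp)).
have p0 : 0 < p by exact: lt_le_trans p1.
have /LfunE[mF _] := Fp.
have mh : measurable_fun setT (fun y : R => heat t (x - y)) by exact: measurable_heat_subl.
have := hoelder mu mF mh p0 q0 pq; rewrite Lnorm1.
have -> : (\int[mu]_x0 (`|F x0| * heat t (x - x0))%:E = \int[mu]_x0 `|(EFin \o (F \* (fun y : R => heat t (x - y)))%R) x0|)%E.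
  by apply: eq_integral => y _ /=; rewrite normrM [`|heat _ _|]ger0_norm ?heat_ge0.
suff -> : 'N[mu]_q%:E[EFin \o (fun y : R => heat t (x - y))]%E = (heat_norm t q^-1)%:E by [].
rewrite LnormE; transitivity ((\int[mu]_y (heat t (x - y) `^ q)%:E) `^ q^-1)%E.
  apply: (congr1 (poweR ^~ q^-1)); apply: eq_integral => y _.
  congr (_%:E).
  congr (_ `^ _).
  by rewrite (ger0_norm (heat_ge0 (x - y) t0)).
rewrite (@ge0_integral_subl R x (fun y => (heat t y `^ q)%:E)).
  rewrite integral_heat_powR// poweR_EFin -powRrM divff ?gt_eqF// powRr1//.
  exact: heat_norm_ge0.
  by apply/measurable_EFinP; apply: measurable_fun_powR; exact: measurable_heat.
by move=> y; rewrite lee_fin powR_ge0.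
Qed.

Lemma conv_heat_le_L1 t F x : 0 < t -> F \in Lfun mu 1%:E ->
  (`|convolution F (heat t) x|%:E <= 'N[mu]_1%:E[EFin \o F] * (heat_norm t 0)%:E)%E.
Proof.
move=> t0 F1; apply: (le_trans (le_abse_conv x t0 (lexx 1) F1)).
have /LfunE[mF _] := F1.
rewrite Lnorm1 muleC -ge0_integralZl//; last by rewrite lee_fin heat_norm_ge0.
  apply: ge0_le_integral => //.
  - by move=> y _; rewrite lee_fin mulr_ge0// heat_ge0.
  - apply/measurable_EFinP; apply: measurable_funM; first exact: measurableT_comp.
    exact: measurable_heat_subl.
  - apply: measurable_funeM; apply/measurable_EFinP; exact: measurableT_comp.
  - by move=> y _; rewrite -EFinM lee_fin mulrC ler_wpM2r// heat_le_heat_norm0.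
by apply/measurable_EFinP; exact: measurableT_comp.
Qed.

End heat_norm.

(** * Change of variables and monotone transport on the line *)

Section substitution.
Context {R : realType}.
Local Notation mu := (@lebesgue_measure R).
Implicit Types (T D G : R -> R).

Lemma is_derive_gt0_homo T D : (forall x : R, is_derive x 1 T (D x)) ->
  (forall x, 0 < D x) -> {homo T : x y / x < y}.
Proof.
move=> dT D0 x y xy.
apply: (@gtr0_derive1_lt_cc R T x y) => //.
- by move=> z _; rewrite (derive1_is_derive (dT z)).
- apply: continuous_subspaceT => z; exact: is_derive_continuous (dT z).
- by rewrite in_itv/= lexx ltW.
- by rewrite in_itv/= lexx ltW.
Qed.

Lemma substitution_itv T D G a b : a <= b ->
  (forall x : R, is_derive x 1 T (D x)) -> continuous D -> (forall x, 0 < D x) ->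
  continuous G ->
  (\int[mu]_(x in `[T a, T b]) (G x)%:E = \int[mu]_(x in `[a, b]) (G (T x) * D x)%:E)%E.
Proof.
move=> ab dT cD D0 cG.
have dTE : T^`()%classic = D by apply/funext => x; exact: derive1_is_derive (dT x).
have cT : continuous T by move=> z; exact: is_derive_continuous (dT z).
rewrite (@integration_by_substitution_increasing R T G a b)//.
- by rewrite dTE.
- by move=> x y _ _; exact: (is_derive_gt0_homo dT D0).
- by rewrite dTE => x _; exact: cD.
- by rewrite dTE; apply/cvg_ex; exists (D a); apply: cvg_at_right_filter; exact: cD.
- by rewrite dTE; apply/cvg_ex; exists (D b); apply: cvg_at_left_filter; exact: cD.
- split=> //.
  + by apply: cvg_at_right_filter; exact: cT.
  + by apply: cvg_at_left_filter; exact: cT.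
- exact: continuous_subspaceT.
Qed.

(** Monotone convergence along the intervals [[- n, n]]. The union of their images is the range of
    [T], possibly a proper part of the line. *)
Lemma substitution_bigcup T D G :
  (forall x : R, is_derive x 1 T (D x)) -> continuous D -> (forall x, 0 < D x) ->
  continuous G -> (forall x, 0 <= G x) ->
  (\int[mu]_(x in \bigcup_n `[T (- n%:R)%R, T n%:R]%classic) (G x)%:E = \int[mu]_x (G (T x) * D x)%:E)%E.
Proof.
move=> dT cD D0 cG G0.
have hT := ltW_homo (is_derive_gt0_homo dT D0).
have cT : continuous T by move=> z; exact: is_derive_continuous (dT z).
have nn (n : nat) : - n%:R <= n%:R :> R by rewrite (@le_trans _ _ 0)// oppr_le0.
have mono (m n : nat) : (m <= n)%N -> - n%:R <= - m%:R :> R /\ m%:R <= n%:R :> R.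
  by rewrite lerN2 !ler_nat.
have cGT : continuous (fun x => G (T x) * D x).
  by move=> x; apply: cvgM; [apply: continuous_comp; [exact: cT|exact: cG]|exact: cD].
have mG : measurable_fun setT (EFin \o G) by apply/measurable_EFinP; exact: continuous_measurable_fun.
have mGT : measurable_fun setT (fun x => (G (T x) * D x)%:E).
  by apply/measurable_EFinP; exact: continuous_measurable_fun.
have L := @ge0_nondecreasing_set_cvg_integral _ (measurableTypeR R) R (fun n => `[T (- n%:R), T n%:R]%classic) (EFin \o G) mu.
have Rr := @ge0_nondecreasing_set_cvg_integral _ (measurableTypeR R) R
  (fun n => `[(- n%:R : R), n%:R]%classic) (fun x => (G (T x) * D x)%:E) mu.
have E : \bigcup_n `[(- n%:R : R), n%:R]%classic = setT.
  apply/seteqP; split => // x _; have [n] := archi_boundP (normr_ge0 x).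
  exists (Num.bound `|x|) => //=; rewrite in_itv/= -ler_norml ltW//.
have EE : (fun n : nat => \int[mu]_(x in `[T (- n%:R)%R, T n%:R]) (EFin \o G) x)%E =
          (fun n : nat => \int[mu]_(x in `[(- n%:R)%R, n%:R]) (G (T x) * D x)%:E)%E.
  by apply/funext => n; rewrite -(substitution_itv (nn _) dT cD D0 cG).
rewrite EE E in L, Rr.
apply: (cvg_unique _ (L _ _ _ _) (Rr _ _ _ _)) => //.
- move=> m n mn; apply/subsetPset; apply: subset_itvScc; rewrite bnd_simp; apply: hT; by have [] := mono _ _ mn.
- by move=> i; exact: measurable_funS mG.
- by move=> i x _; rewrite lee_fin.
- move=> m n mn; apply/subsetPset; apply: subset_itvScc; rewrite bnd_simp; by have [] := mono _ _ mn.
- by move=> i; exact: measurable_funS mGT.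
- by move=> i x _; rewrite lee_fin mulr_ge0// ltW.
Qed.

(** Enlarging the range of [T] to the whole line only increases the integral; this inequality is all
    that the fibers of the transport argument require. *)
Lemma substitution_le T D G :
  (forall x : R, is_derive x 1 T (D x)) -> continuous D -> (forall x, 0 < D x) ->
  continuous G -> (forall x, 0 <= G x) ->
  (\int[mu]_x (G (T x) * D x)%:E <= \int[mu]_x (G x)%:E)%E.
Proof.
move=> dT cD D0 cG G0; rewrite -substitution_bigcup//.
apply: ge0_subset_integral => //.
- by apply: bigcup_measurable => n _.
- by apply/measurable_EFinP; exact: continuous_measurable_fun.
- by move=> x _; rewrite lee_fin.
Qed.

Lemma substitution_eq T D G :
  (forall x : R, is_derive x 1 T (D x)) -> continuous D -> (forall x, 0 < D x) ->
  (forall y, exists x, T x = y) ->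
  continuous G -> (forall x, 0 <= G x) ->
  (\int[mu]_x (G x)%:E = \int[mu]_x (G (T x) * D x)%:E)%E.
Proof.
move=> dT cD D0 sT cG G0; rewrite -substitution_bigcup//; congr integral.
apply/esym/seteqP; split => // y _; have [x <-] := sT y.
have hT := ltW_homo (is_derive_gt0_homo dT D0).
exists (Num.bound `|x|) => //=; rewrite in_itv/=.
have : `|x| <= (Num.bound `|x|)%:R by rewrite ltW// archi_boundP.
by rewrite ler_norml => /andP[? ?]; rewrite !hT.
Qed.

End substitution.

Section transport.
Context {R : realType}.
Local Notation mu := (@lebesgue_measure R).
Implicit Types (f g : R -> R).

Definition cdf f x : R := \int[mu]_(y in `]-oo, x]) f y.

Section cdf.
Variable f : R -> R.
Hypotheses (cf : continuous f) (f0 : forall x, 0 < f x)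
  (fi : mu.-integrable setT (EFin \o f)).

Let fiA (A : set R) : measurable A -> mu.-integrable A (EFin \o f).
Proof. by move=> mA; apply: integrableS fi. Qed.

Lemma is_derive_cdf (x : R) : is_derive x 1 (cdf f) (f x).
Proof.
have xu : x < x + 1 by rewrite ltrDl.
have [|dF EF] := @continuous_FTC1 R f -oo%O x (x + 1) xu (fiA (measurable_itv _)) _ (cf (x := x)).
  by rewrite ltNye.
by apply: DeriveDef; [exact: dF|rewrite -derive1E; exact: EF].
Qed.

Lemma cdf_homo : {homo cdf f : x y / x < y}.
Proof. exact: is_derive_gt0_homo is_derive_cdf f0. Qed.

Lemma cdf_ge0 x : 0 <= cdf f x.
Proof. by apply: Rintegral_ge0 => y _; exact: ltW. Qed.

Lemma le_Rintegral_subset (A B : set R) : measurable A -> measurable B -> A `<=` B ->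
  \int[mu]_(x in A) f x <= \int[mu]_(x in B) f x.
Proof.
move=> mA mB AB; have := fi => /integrableP[mf _].
rewrite fine_le ?integrable_fin_num//; [exact: fiA|exact: fiA|].
apply: ge0_subset_integral => //; first exact: measurable_funS mf.
by move=> x _; rewrite lee_fin ltW.
Qed.

Lemma lt_Rintegral_itv c : c < \int[mu]_x f x ->
  exists n : nat, c < \int[mu]_(x in `[- n%:R, n%:R]) f x.
Proof.
move=> cI; apply/not_existsP => H; have := fi => /integrableP[mf _].
have L := @ge0_nondecreasing_set_cvg_integral _ (measurableTypeR R) R
  (fun n => `[- n%:R, n%:R]%classic) (EFin \o f) mu.
have E : \bigcup_n `[(- n%:R : R), n%:R]%classic = setT.
  apply/seteqP; split => // x _; have := archi_boundP (normr_ge0 x).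
  by exists (Num.bound `|x|) => //=; rewrite in_itv/= -ler_norml ltW.
rewrite E in L.
have cL : (\int[mu]_(x in `[(- n%:R)%R, n%:R]) (EFin \o f) x)%E @[n --> \oo] --> (\int[mu]_x (EFin \o f) x)%E.
  apply: L => //.
  - move=> m n mn; apply/subsetPset; apply: subset_itvScc; rewrite bnd_simp.
      by rewrite lerN2 ler_nat.
    by rewrite ler_nat.
  - by move=> i; exact: measurable_funS mf.
  - by move=> i x _; rewrite lee_fin ltW.
have : (lim ((\int[mu]_(x in `[(- n%:R)%R, n%:R]) (EFin \o f) x)%E @[n --> \oo]) <= c%:E)%E.
  apply: lime_le; first by apply/cvg_ex; eexists; exact: cL.
  apply: nearW => n; have /negP := H n; rewrite -leNgt => Hn.
  rewrite -(@fineK _ (\int[mu]_(x in `[(- n%:R)%R, n%:R]) (EFin \o f) x)%E) ?lee_fin//.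
  by apply: integrable_fin_num => //; exact: fiA.
rewrite (cvg_lim _ cL)// -(@fineK _ (\int[mu]_x (EFin \o f) x)%E) ?lee_fin ?integrable_fin_num//.
by rewrite leNgt cI.
Qed.

Lemma lt_cdf c : c < \int[mu]_x f x -> exists x, c < cdf f x.
Proof.
move=> /lt_Rintegral_itv[n cn]; exists n%:R; apply: (lt_le_trans cn).
by apply: le_Rintegral_subset => // x /=; rewrite !in_itv/= => /andP[].
Qed.

(** An interval [[- n, n]] that carries more than the total mass minus [c] leaves less than [c] to
    its left. *)
Lemma gt_cdf c : 0 < c -> exists x, cdf f x < c.
Proof.
move=> c0; have : \int[mu]_x f x - c < \int[mu]_x f x by rewrite ltrBlDr ltrDl.
move=> /lt_Rintegral_itv[n cn]; exists (- n%:R - 1).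
suff : cdf f (- n%:R - 1) + \int[mu]_(x in `[- n%:R, n%:R]) f x <= \int[mu]_x f x.
  by move: cn; move: (Rintegral _ _ _) (Rintegral _ _ _) (cdf _ _) => x y z; lra.
rewrite -Rintegral_setU//.
- by apply: le_Rintegral_subset => //; exact: measurableU.
- by apply: fiA; exact: measurableU.
- apply/disj_setPLR => z /=; rewrite !in_itv/= => zn.
  apply/negP; rewrite negb_and -ltNge; apply/orP; left.
  by apply: (le_lt_trans zn); rewrite gtrDl.
Qed.

Lemma cdf_gt0 x : 0 < cdf f x.
Proof.
by apply: (le_lt_trans (cdf_ge0 (x - 1))); apply: cdf_homo; rewrite gtrDl.
Qed.

Lemma cdf_lt x : cdf f x < \int[mu]_y f y.
Proof.
apply: (@lt_le_trans _ _ (cdf f (x + 1))); first by apply: cdf_homo; rewrite ltrDl.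
exact: le_Rintegral_subset.
Qed.

Lemma cdf_surj c : 0 < c < \int[mu]_x f x -> exists x, cdf f x = c.
Proof.
move=> /andP[/gt_cdf[a ac] /lt_cdf[b cb]].
have ab : a <= b by rewrite leNgt; apply/negP => /cdf_homo; rewrite ltNge (ltW (lt_trans ac cb)).
have [||x _ <-] := @IVT R (cdf f) a b c ab; last by exists x.
  by apply: continuous_subspaceT => x; exact: is_derive_continuous (is_derive_cdf x).
by rewrite ge_min le_max (ltW ac) (ltW cb) orbT.
Qed.

Lemma cdf_inj : injective (cdf f).
Proof.
move=> x y xy; apply/eqP; rewrite eq_le !leNgt; apply/andP; split; apply/negP => /cdf_homo;
  by rewrite xy ltxx.
Qed.

End cdf.

(** [T] is the inverse of [cdf g] composed with [cdf f]. Equality of the masses makes the two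
    distribution functions have the same range, so [T] is defined everywhere and onto. *)
Lemma transport_map f g : continuous f -> (forall x, 0 < f x) ->
  mu.-integrable setT (EFin \o f) -> continuous g -> (forall x, 0 < g x) ->
  mu.-integrable setT (EFin \o g) -> \int[mu]_x f x = \int[mu]_x g x ->
  exists T : R -> R, (forall x : R, is_derive x 1 T (f x / g (T x))) /\ (forall y, exists x, T x = y).
Proof.
move=> cf f0 fi cg g0 gi fg.
have TE x : {y | cdf g y = cdf f x}.
  by apply: cid; apply: cdf_surj => //; rewrite cdf_gt0//= -fg cdf_lt.
(* A total left inverse of [cdf g], with the arbitrary value [0] outside its range. *)
have invE c : {y | forall y', c = cdf g y' -> y = y'}.
  apply: cid; have [[y cy]|H] := pselect (exists y, c = cdf g y).
    by exists y => y'; rewrite cy => /(cdf_inj cg g0 gi).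
  by exists 0 => y' cy'; exfalso; apply: H; exists y'.
pose S c := sval (invE c); have SE y : S (cdf g y) = y by apply: (svalP (invE _)).
pose T x := S (cdf f x).
have TgE x : cdf g (T x) = cdf f x by rewrite /T; have [y <-] := TE x; rewrite SE.
exists T; split.
  move=> x; rewrite [_ / _]mulrC; apply: is_derive_compfun; last exact: is_derive_cdf.
  rewrite -TgE; apply: is_derive_inverse.
  - by apply: (@filterE _ (nbhs (T x))) => y; exact: SE.
  - by apply: (@filterE _ (nbhs (T x))) => y; exact: is_derive_continuous (is_derive_cdf cg gi y).
  - exact: is_derive_cdf.
  - by rewrite gt_eqF.
move=> y; have [|x xy] := cdf_surj cf f0 fi (c := cdf g y).
  by rewrite cdf_gt0//= fg cdf_lt.
by exists x; rewrite /T xy SE.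
Qed.

End transport.

(** * The bilinear form: change of variables, constants and bound *)

Section tonelli_hoelder.
Context {R : realType}.
Local Notation mu := (@lebesgue_measure R).

Lemma ge0_tonelli (P : R -> R -> R) :
  measurable_fun setT (fun z : measurableTypeR R * measurableTypeR R => P z.1 z.2) ->
  (forall x y, 0 <= P x y) ->
  (\int[mu]_x \int[mu]_y (P x y)%:E = \int[mu]_y \int[mu]_x (P x y)%:E)%E.
Proof.
move=> mP P0.
apply: (fubini_tonelli (m1 := mu) (m2 := mu)
  (fun z : measurableTypeR R * measurableTypeR R => (P z.1 z.2)%:E)).
  exact/measurable_EFinP.
by move=> z; rewrite lee_fin.
Qed.

Lemma measurable_pair_comp (P : R -> R -> R) (a b : R -> R -> R) :
  measurable_fun setT (fun z : measurableTypeR R * measurableTypeR R => P z.1 z.2) ->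
  measurable_fun setT (fun z : measurableTypeR R * measurableTypeR R => a z.1 z.2) ->
  measurable_fun setT (fun z : measurableTypeR R * measurableTypeR R => b z.1 z.2) ->
  measurable_fun setT (fun z : measurableTypeR R * measurableTypeR R =>
    P (a z.1 z.2) (b z.1 z.2)).
Proof.
move=> mP ma mb.
apply: (measurableT_comp (f := fun z : measurableTypeR R * measurableTypeR R => P z.1 z.2)
  (g := fun z => (a z.1 z.2, b z.1 z.2))) => //.
exact: measurable_fun_pair.
Qed.

(** The map from [(z, v)] to the arguments of [P] has determinant [-1], and [v] is their difference.
    It factors into shears, so translations in one variable at a time, with Tonelli in between,
    replace a planar change of variables. *)
Lemma shear_tonelli (P : R -> R -> R) (th : R) :
  measurable_fun setT (fun z : measurableTypeR R * measurableTypeR R => P z.1 z.2) ->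
  (forall x y, 0 <= P x y) ->
  (\int[mu]_y \int[mu]_x (P x y)%:E =
   \int[mu]_z \int[mu]_v (P (z + th * v) (z - (1 - th) * v))%:E)%E.
Proof.
move=> mP P0.
have m1 : measurable_fun setT (fun z : measurableTypeR R * measurableTypeR R => z.1) by exact: measurable_fst.
have m2 : measurable_fun setT (fun z : measurableTypeR R * measurableTypeR R => z.2) by exact: measurable_snd.
transitivity (\int[mu]_y \int[mu]_v (P (v + y)%R y)%:E)%E.
  apply: eq_integral => y _; rewrite (@ge0_integral_addr R y (fun x => (P x y)%:E))//.
  - apply/measurable_EFinP; apply: (measurableT_comp (f := fun z : measurableTypeR R * measurableTypeR R => P z.1 z.2)
     (g := fun x => (x, y))) => //; exact: measurable_fun_pair.

  - by move=> x; rewrite lee_fin.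
have mPs : measurable_fun setT (fun z : measurableTypeR R * measurableTypeR R => P (z.2 + z.1) z.1).
  by apply: (@measurable_pair_comp P (fun a b => b + a) (fun a b => a)) => //; exact: measurable_funD.
rewrite (ge0_tonelli (P := fun y v => P (v + y) y) mPs (fun y v => P0 _ _)).
have mPs' : measurable_fun setT (fun z : measurableTypeR R * measurableTypeR R => P (z.2 + th * z.1) (z.2 - (1 - th) * z.1)).
  apply: (@measurable_pair_comp P (fun a b => b + th * a) (fun a b => b - (1 - th) * a)) => //.
    by apply: measurable_funD => //; apply: measurable_funM.
  by apply: measurable_funB => //; apply: measurable_funM.
rewrite -(ge0_tonelli (P := fun v z => P (z + th * v) (z - (1 - th) * v)) mPs' (fun v z => P0 _ _)).
apply: eq_integral => v _.
rewrite [RHS](_ : _ = \int[mu]_z ((fun y => (P (v + y)%R y)%:E) (z + - ((1 - th) * v))%R))%E.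
  rewrite (@ge0_integral_addr R (- ((1 - th) * v)) (fun y => (P (v + y)%R y)%:E))//.
  - apply/measurable_EFinP; apply: (measurableT_comp (f := fun z : measurableTypeR R * measurableTypeR R => P (z.2 + z.1) z.1)
     (g := fun y => (y, v))) => //; exact: measurable_fun_pair.

  - by move=> x; rewrite lee_fin.
by apply: eq_integral => z _; congr ((P _ _)%:E); ring.
Qed.

Lemma hoelder_powR (g k : R -> R) (s : R) : 0 < s < 1 ->
  measurable_fun setT g -> measurable_fun setT k ->
  (forall x, 0 <= g x) -> (forall x, 0 <= k x) ->
  (\int[mu]_x (g x `^ (1 - s) * k x `^ s)%:E <=
   (\int[mu]_x (g x)%:E) `^ (1 - s) * (\int[mu]_x (k x)%:E) `^ s)%E.
Proof.
move=> /andP[s0 s1] mg mk g0 k0.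
have s1' : 0 < 1 - s by rewrite subr_gt0.
have p0 : 0 < (1 - s)^-1 by rewrite invr_gt0.
have q0 : 0 < s^-1 by rewrite invr_gt0.
have mgp : measurable_fun setT (fun x => g x `^ (1 - s)) by exact: measurable_fun_powR.
have mkp : measurable_fun setT (fun x => k x `^ s) by exact: measurable_fun_powR.
have E (l : R -> R) (a : R) : 0 < a -> (forall x, 0 <= l x) ->
    'N[mu]_(a^-1)%:E[EFin \o (fun x => (l x `^ a)%R)]%E = ((\int[mu]_x (l x)%:E) `^ a)%E.
  move=> a0 l0; rewrite LnormE invrK; apply: (congr1 (poweR ^~ a)).
  apply: eq_integral => x _.
  by rewrite ger0_norm ?powR_ge0// -powRrM divff ?gt_eqF// powRr1.
have H := hoelder mu mgp mkp p0 q0.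
rewrite !invrK subrK in H; have {H} := H erefl.
rewrite (E _ _ s1' g0) (E _ _ s0 k0) Lnorm1 => H; apply: le_trans H.
rewrite le_eqVlt; apply/orP; left; apply/eqP; apply: eq_integral => x _.
by rewrite /= ger0_norm// mulr_ge0 ?powR_ge0.
Qed.

Lemma powR_amgm (th x y : R) : 0 < th < 1 -> 0 < x -> 0 < y ->
  x `^ th * y `^ (1 - th) <= th * x + (1 - th) * y.
Proof.
move=> /andP[th0 th1] x0 y0; have th1' : 0 < 1 - th by rewrite subr_gt0.
have := @conjugate_powR R (x `^ th) (y `^ (1 - th)) th^-1 (1 - th)^-1 (powR_ge0 _ _) (powR_ge0 _ _).
rewrite !invr_gt0 !invrK [th + _]addrC subrK -!powRrM !divff ?gt_eqF// (powRr1 (ltW x0)) (powRr1 (ltW y0)).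
by move=> /(_ th0 th1' erefl); rewrite [th * x]mulrC [(1 - th) * y]mulrC.
Qed.

End tonelli_hoelder.

Section bilinear.
Context {R : realType}.
Local Notation mu := (@lebesgue_measure R).
Implicit Types (f h k A J : R -> R) (s t u w : R).

(* The constant [c_ q] for [u = 1 / q], the endpoints included since
   [0 `^ 0 = 1]. *)
Definition young_cst u : R := (1 - u) `^ (1 - u) / u `^ u.

Lemma continuous_compfun (a b : R -> R) : continuous a -> continuous b ->
  continuous (fun x => a (b x)).
Proof. by move=> ca cb x; apply: (continuous_comp (g := a)); [exact: cb|exact: ca]. Qed.

Lemma continuous_powR_fun (k : R -> R) (e : R) : continuous k -> (forall x, 0 < k x) ->
  continuous (fun x => k x `^ e).
Proof.
move=> ck k0; rewrite (_ : (fun x => k x `^ e) = (fun x => expR (e * ln (k x)))).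
  move=> x; apply: continuous_comp; last exact: continuous_expR.
  apply: cvgM; first exact: cvg_cst.
  by apply: continuous_comp; [exact: ck|exact: continuous_ln].
by apply/funext => x; rewrite powR_expln.
Qed.

(** Meant for [x] a density composed with its transport map and [y] the Jacobian: then [x * y] is
    the transported Gaussian, which is separated here from a power of the Jacobian. *)
Lemma powR_mulr_split (x y u : R) : 0 < x -> 0 < y -> x `^ u * y = (x * y) `^ u * y `^ (1 - u).
Proof.
move=> x0 y0; rewrite powRM ?ltW// -mulrA -powRD ?subrKC ?(gt_eqF y0) ?implybT//.
by rewrite powRr1// ltW.
Qed.

(** [N] is the total mass, to be matched with that of the target density, and [c] is the rate. *)
Definition gaussian (N c x : R) : R := N * Num.sqrt (c / pi) * expR (- (c * x ^+ 2)).

Lemma gaussian_gt0 N c x : 0 < N -> 0 < c -> 0 < gaussian N c x.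
Proof. by move=> N0 c0; rewrite !mulr_gt0 ?expR_gt0// sqrtr_gt0 divr_gt0 ?pi_gt0. Qed.

Lemma continuous_gaussian N c : continuous (gaussian N c).
Proof.
move=> x; apply: cvgM; first exact: cvg_cst.
apply: continuous_comp; last exact: continuous_expR.
by apply: cvgN; apply: cvgM; [exact: cvg_cst|exact: exprn_continuous].
Qed.

Lemma integral_gaussian N c : 0 < N -> 0 < c -> (\int[mu]_x (gaussian N c x)%:E = N%:E)%E.
Proof.
move=> N0 c0; under eq_integral do rewrite EFinM.
rewrite ge0_integralZl//; first last.
- by rewrite lee_fin mulr_ge0 ?sqrtr_ge0// ltW.
- apply/measurable_EFinP; apply: continuous_measurable_fun => x.
  apply: continuous_comp; last exact: continuous_expR.
  by apply: cvgN; apply: cvgM; [exact: cvg_cst|exact: exprn_continuous].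
rewrite integral_gauss// -EFinM -mulrA -sqrtrM ?divr_ge0 ?pi_ge0 ?ltW//.
have pi0 : 0 < pi :> R by exact: pi_gt0.
have -> : c / pi * (pi / c) = 1 :> R by move: pi pi0 => P P0; field; rewrite !gt_eqF.
by rewrite sqrtr1 mulr1.
Qed.

Lemma integrable_gaussian N c : 0 < N -> 0 < c ->
  mu.-integrable setT (EFin \o gaussian N c).
Proof.
move=> N0 c0; apply/integrableP; split.
  by apply/measurable_EFinP; apply: continuous_measurable_fun; exact: continuous_gaussian.
under eq_integral do rewrite gee0_abs ?lee_fin ?ltW ?gaussian_gt0//.
by rewrite integral_gaussian// ltry.
Qed.

(** Hoelder's inequality with exponents [1 / (1 - s)] and [1 / s]: the Gaussian has an explicit
    integral, while [J v * k (A v) ^ (1 / s)] is a change of variables away from [k ^ (1 / s)]. *)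
Lemma fiber_bound A J k s (Nk : R) : 0 < s < 1 -> continuous k -> (forall x, 0 < k x) -> 0 <= Nk ->
  (\int[mu]_x (k x `^ s^-1)%:E = (Nk `^ s^-1)%:E)%E ->
  (forall x : R, is_derive x 1 A (J x)) -> continuous J -> (forall x, 0 < J x) ->
  (\int[mu]_v (expR (- (v ^+ 2 / s)) * (J v `^ s * k (A v)))%:E <=
   ((pi * s * (1 - s)) `^ ((1 - s) / 2) * Nk)%:E)%E.
Proof.
move=> s01 ck k0 Nk0 IG dA cJ J0; have /andP[s0 s1] := s01; have s1' : 0 < 1 - s by rewrite subr_gt0.
have pi0 : 0 < pi :> R by exact: pi_gt0.
have cA : continuous A by move=> x; exact: is_derive_continuous (dA x).
(* The power [1 / (1 - s)] of [exp (- v^2 / s)]. *)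
pose g v : R := expR (- ((s * (1 - s))^-1 * v ^+ 2)).
pose G x : R := k x `^ s^-1.
have cG : continuous G.
  exact: continuous_powR_fun.
have G0 x : 0 <= G x by exact: powR_ge0.
have mg : measurable_fun setT g.
  apply: continuous_measurable_fun => x.
  apply: continuous_comp; last exact: continuous_expR.
  by apply: cvgN; apply: cvgM; [exact: cvg_cst|exact: exprn_continuous].
have mk : measurable_fun setT (fun v => G (A v) * J v).
  by apply: continuous_measurable_fun => x; apply: cvgM; [apply: continuous_comp; [exact: cA|exact: cG]|exact: cJ].
have := hoelder_powR s01 mg mk (fun v => expR_ge0 _) (fun v => mulr_ge0 (G0 _) (ltW (J0 v))).
rewrite integral_gauss ?invr_gt0 ?mulr_gt0// => H.
apply: (@le_trans _ _ (((pi * s * (1 - s)) `^ ((1 - s) / 2))%:E * (\int[mu]_v (G (A v) * J v)%:E) `^ s)%E).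
  apply: le_trans (le_trans H _).
    rewrite le_eqVlt; apply/orP; left; apply/eqP; apply: eq_integral => v _.
    congr (_%:E); congr (_ * _).
      rewrite /g -expRM; congr expR; by field; rewrite !gt_eqF.
    rewrite powRM ?powR_ge0 ?ltW// -powRrM mulVf ?gt_eqF// powRr1 ?ltW//.
    by rewrite mulrC.
  have sq0 : 0 <= pi / (s * (1 - s))^-1 :> R by rewrite invrK ltW// !mulr_gt0.
  by rewrite poweR_EFin -(powR12_sqrt sq0) invrK -powRrM mulrA [2^-1 * _]mulrC.
rewrite EFinM; apply: lee_pmul => //; first by rewrite lee_fin powR_ge0.
  by apply: poweR_ge0.
apply: (@le_trans _ _ ((\int[mu]_x (G x)%:E) `^ s)%E).
  apply: le_poweR; first exact: ltW.
    by apply: integral_ge0 => v _; rewrite lee_fin mulr_ge0// ltW.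
  exact: substitution_le.
by rewrite IG poweR_EFin -powRrM mulVf ?gt_eqF// powRr1 ?Nk0.
Qed.

(* The two variances are chosen so that the cross term [z * v] vanishes. *)
Lemma gaussian_rotation (M N u w z v : R) : 0 < M -> 0 < N -> 0 < w -> w < u -> u < 1 ->
  let s := 1 + w - u in let th := (1 - u) / s in
  gaussian M (u * (1 - u))^-1 (z + th * v) `^ u *
  gaussian N (w * (1 - w))^-1 (z - (1 - th) * v) `^ (1 - w) =
  M `^ u * N `^ (1 - w) * ((pi * u * (1 - u)) `^ (- (u / 2)) * (pi * w * (1 - w)) `^ (- ((1 - w) / 2))) *
  expR (- (s / ((1 - u) * w) * z ^+ 2)) * expR (- (v ^+ 2 / s)).
Proof.
move=> M0 N0 w0 wu u1 s th.
have pi0 : 0 < pi :> R by exact: pi_gt0.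
have u0 : 0 < u by exact: lt_trans wu.
have u1' : 0 < 1 - u by rewrite subr_gt0.
have w1' : 0 < 1 - w by rewrite subr_gt0 (lt_trans wu).
have s0 : 0 < s by rewrite /s; lra.
have E (c x e : R) : 0 < c -> (Num.sqrt (c^-1 / pi) * expR (- (c^-1 * x ^+ 2))) `^ e =
    (pi * c) `^ (- (e / 2)) * expR (- (e / c * x ^+ 2)).
  move=> c0; rewrite sqrt_expln ?divr_gt0 ?invr_gt0// -expRD powR_expln ?expR_gt0// expRK.
  rewrite powR_expln ?mulr_gt0// -expRD; congr expR.
  rewrite ln_div ?posrE ?invr_gt0// lnV ?posrE// lnM ?posrE//.
  by move: (ln _) (ln _) => k l; field; rewrite gt_eqF.
rewrite /gaussian -2!mulrA (powRM _ (ltW M0)) ?mulr_ge0 ?sqrtr_ge0 ?expR_ge0//.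
rewrite (powRM _ (ltW N0)) ?mulr_ge0 ?sqrtr_ge0 ?expR_ge0//.
rewrite !E ?mulr_gt0//.
rewrite -[pi * u * _]mulrA -[pi * w * _]mulrA.
set X := _ `^ (- (u / 2)); set Y := _ `^ (- ((1 - w) / 2)).
have EE : expR (- (s / ((1 - u) * w) * z ^+ 2)) * expR (- (v ^+ 2 / s)) =
  expR (- (u / (u * (1 - u)) * (z + th * v) ^+ 2)) * expR (- ((1 - w) / (w * (1 - w)) * (z - (1 - th) * v) ^+ 2)).
  rewrite -2!expRD; congr expR; rewrite /th /s; field; rewrite !gt_eqF//=.
rewrite -[RHS]mulrA EE; ring.
Qed.

(** Collects the normalizations of the two Gaussians, the constant of the fiber bound and the
    Gaussian integral in [z]. After logarithms it is a linear relation between logarithms. *)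
Lemma young_cst_identity (u w : R) : 0 < w -> w < u -> u < 1 -> let s := 1 + w - u in
  (pi * u * (1 - u)) `^ (- (u / 2)) * (pi * w * (1 - w)) `^ (- ((1 - w) / 2)) *
  (pi * s * (1 - s)) `^ ((1 - s) / 2) * Num.sqrt (pi / (s / ((1 - u) * w))) =
  (young_cst u * young_cst s / young_cst w) `^ 2^-1.
Proof.
move=> w0 wu u1 s.
have pi0 : 0 < pi :> R by exact: pi_gt0.
have u0 : 0 < u by exact: lt_trans wu.
have u1' : 0 < 1 - u by rewrite subr_gt0.
have w1' : 0 < 1 - w by rewrite subr_gt0 (lt_trans wu).
have s0 : 0 < s by rewrite /s; lra.
have s1' : 0 < 1 - s by rewrite /s; lra.
have E (x : R) : 0 < x -> 0 < 1 - x -> young_cst x = expR ((1 - x) * ln (1 - x) - x * ln x).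
  by move=> x0 x1; rewrite /young_cst !powR_expln// expRB.
rewrite !E// -expRD -expRB -expRM.
rewrite sqrt_expln ?divr_gt0 ?mulr_gt0// !powR_expln ?mulr_gt0// -!expRD; congr expR.
have L3 (x y : R) : 0 < x -> 0 < y -> ln (pi * x * y) = ln pi + ln x + ln y.
  by move=> x0 y0; rewrite lnM ?posrE ?mulr_gt0// lnM ?posrE.
have LD : ln (pi / (s / ((1 - u) * w))) = ln pi - (ln s - (ln (1 - u) + ln w)).
  by rewrite !ln_div ?posrE ?divr_gt0 ?mulr_gt0// lnM ?posrE.
rewrite !L3// LD.
move: (ln pi) (ln u) (ln (1 - u)) (ln w) (ln (1 - w)) (ln s) (ln (1 - s)) => a b c d e f g.
by rewrite /s; field.
Qed.

End bilinear.

Section bilinear_bound.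
Context {R : realType}.
Local Notation mu := (@lebesgue_measure R).
Implicit Types (f h k A J : R -> R) (s t u w : R).

(** Stated for the densities [f = F^p] and [h = H^r'], on which transport acts; with [u = 1/p],
    [w = 1/r] and [s = 1/q], the integrand is [F x * H y * k (x - y)]. *)
Lemma bilinear_bound f h k s u w (Nk : R) : 0 < w -> w < u -> u < 1 -> s = 1 + w - u ->
  continuous f -> (forall x, 0 < f x) -> mu.-integrable setT (EFin \o f) ->
  continuous h -> (forall x, 0 < h x) -> mu.-integrable setT (EFin \o h) ->
  continuous k -> (forall x, 0 < k x) -> 0 <= Nk ->
  (\int[mu]_x (k x `^ s^-1)%:E = (Nk `^ s^-1)%:E)%E ->
  (\int[mu]_y \int[mu]_x (f x `^ u * h y `^ (1 - w) * k (x - y))%:E <=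
   ((young_cst u * young_cst s / young_cst w) `^ 2^-1 * Nk *
    ((\int[mu]_x f x) `^ u * (\int[mu]_x h x) `^ (1 - w)))%:E)%E.
Proof.
move=> w0 wu u1 sE cf f0 fi ch h0 hi ck k0 Nk0 IG.
have u0 : 0 < u by exact: lt_trans wu.
have u1' : 0 < 1 - u by rewrite subr_gt0.
have w1' : 0 < 1 - w by rewrite subr_gt0 (lt_trans wu).
have s0 : 0 < s by rewrite sE; lra.
have s1 : s < 1 by rewrite sE; lra.
pose M := \int[mu]_x f x; pose N := \int[mu]_x h x.
have M0 : 0 < M by exact: lt_trans (cdf_gt0 cf f0 fi 0) (cdf_lt cf f0 fi 0).
have N0 : 0 < N by exact: lt_trans (cdf_gt0 ch h0 hi 0) (cdf_lt ch h0 hi 0).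
have a0 : 0 < (u * (1 - u))^-1 by rewrite invr_gt0 mulr_gt0.
have b0 : 0 < (w * (1 - w))^-1 by rewrite invr_gt0 mulr_gt0.
pose phi := gaussian M (u * (1 - u))^-1; pose psi := gaussian N (w * (1 - w))^-1.
have Iphi : \int[mu]_x phi x = M by rewrite /Rintegral integral_gaussian.
have Ipsi : \int[mu]_x psi x = N by rewrite /Rintegral integral_gaussian.
have phi0 x : 0 < phi x by exact: gaussian_gt0.
have psi0 x : 0 < psi x by exact: gaussian_gt0.
have cphi : continuous phi by exact: continuous_gaussian.
have cpsi : continuous psi by exact: continuous_gaussian.
have [T [dT sT]] := transport_map cphi phi0 (integrable_gaussian M0 a0) cf f0 fi Iphi.
have [S [dS sS]] := transport_map cpsi psi0 (integrable_gaussian N0 b0) ch h0 hi Ipsi.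
have cT : continuous T by move=> x; exact: is_derive_continuous (dT x).
have cS : continuous S by move=> x; exact: is_derive_continuous (dS x).
have cdiv (a b c : R -> R) : continuous a -> continuous b -> continuous c -> (forall x, 0 < b x) ->
    continuous (fun x => a x / b (c x)).
  move=> ca cb cc bp x; apply: cvgM; first exact: ca.
  by apply: cvgV; [rewrite gt_eqF|apply: continuous_comp; [exact: cc|exact: cb]].
pose T1 x := phi x / f (T x); pose S1 x := psi x / h (S x).
have cT1 : continuous T1 by exact: cdiv.
have cS1 : continuous S1 by exact: cdiv.
have T10 x : 0 < T1 x by rewrite divr_gt0.
have S10 x : 0 < S1 x by rewrite divr_gt0.
(* As [f (T x) * T1 x = phi x], the unknown density disappears, leaving a Gaussian and a power of
   the Jacobian. *)
have pfu (x : R) : f (T x) `^ u * T1 x = phi x `^ u * T1 x `^ (1 - u).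
  by rewrite (powR_mulr_split u (f0 _) (T10 x)) [f _ * _]mulrC divfK ?gt_eqF.
have phw (y : R) : h (S y) `^ (1 - w) * S1 y = psi y `^ (1 - w) * S1 y `^ w.
  by rewrite (powR_mulr_split (1 - w) (h0 _) (S10 y)) subKr [h _ * _]mulrC divfK ?gt_eqF.
have cfT : continuous (fun x => f (T x) `^ u * T1 x).
  move=> x; apply: cvgM; last exact: cT1.
  apply: (continuous_powR_fun (k := f \o T)) => [{}x|{}x]; last exact: f0.
  by apply: continuous_comp; [exact: cT|exact: cf].
have chS : continuous (fun x => h (S x) `^ (1 - w) * S1 x).
  move=> x; apply: cvgM; last exact: cS1.
  apply: (continuous_powR_fun (k := h \o S)) => [{}x|{}x]; last exact: h0.
  by apply: continuous_comp; [exact: cS|exact: ch].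
have chp : continuous (fun x => h x `^ (1 - w)) by exact: continuous_powR_fun.
have cfp : continuous (fun x => f x `^ u) by exact: continuous_powR_fun.
have mprod (a b c d : R -> R) : continuous a -> continuous b -> continuous c -> continuous d ->
    measurable_fun setT (fun z : measurableTypeR R * measurableTypeR R => a z.1 * b z.2 * k (c z.1 - d z.2)).
  move=> /continuous_measurable_fun ma /continuous_measurable_fun mb.
  move=> /continuous_measurable_fun mc /continuous_measurable_fun md.
  apply: measurable_funM; first by apply: measurable_funM; [exact: (measurable_fst_fun ma)|exact: (measurable_snd_fun mb)].
  apply: measurableT_comp; first exact: continuous_measurable_fun.
  by apply: measurable_funB; [exact: (measurable_fst_fun mc)|exact: (measurable_snd_fun md)].
(* [Q] is the integrand after the substitution in [x] alone, [P] after both; since [T] and [S] are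
   onto, both substitutions are equalities. *)
pose Q x y := (f (T x) `^ u * T1 x) * h y `^ (1 - w) * k (T x - y).
pose P x y := (f (T x) `^ u * T1 x) * (h (S y) `^ (1 - w) * S1 y) * k (T x - S y).
have mQ : measurable_fun setT (fun z : measurableTypeR R * measurableTypeR R => Q z.1 z.2).
  apply: (mprod _ _ T (fun y => y) cfT chp cT) => x; exact: cvg_id.
have mP : measurable_fun setT (fun z : measurableTypeR R * measurableTypeR R => P z.1 z.2).
  exact: (mprod _ _ T S cfT chS cT cS).
have F0 x : 0 <= f (T x) `^ u * T1 x by apply: mulr_ge0; [exact: powR_ge0|exact: ltW].
have H0 x : 0 <= h (S x) `^ (1 - w) * S1 x by apply: mulr_ge0; [exact: powR_ge0|exact: ltW].
have Q0 x y : 0 <= Q x y.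
  by apply: mulr_ge0; [apply: mulr_ge0; [exact: F0|exact: powR_ge0]|exact: ltW].
have P0 x y : 0 <= P x y.
  by apply: mulr_ge0; [apply: mulr_ge0; [exact: F0|exact: H0]|exact: ltW].
have E1 y : (\int[mu]_x (f x `^ u * h y `^ (1 - w) * k (x - y))%:E = \int[mu]_x (Q x y)%:E)%E.
  rewrite (substitution_eq dT cT1 T10 sT).
  - by apply: eq_integral => x _; congr (_%:E); rewrite /Q /T1; ring.
  - move=> x; apply: cvgM; first by apply: cvgM; [exact: cfp|exact: cvg_cst].
    apply: continuous_comp; last exact: ck.
    by apply: cvgB; [exact: cvg_id|exact: cvg_cst].
  - by move=> x; rewrite !mulr_ge0 ?powR_ge0 ?(ltW (k0 _)).
have E2 x : (\int[mu]_y (Q x y)%:E = \int[mu]_y (P x y)%:E)%E.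
  rewrite (substitution_eq dS cS1 S10 sS).
  - by apply: eq_integral => y _; congr (_%:E); rewrite /P /Q /S1; ring.
  - move=> y; apply: cvgM; first by apply: cvgM; [exact: cvg_cst|exact: chp].
    apply: continuous_comp; last exact: ck.
    by apply: cvgB; [exact: cvg_cst|exact: cvg_id].
  - by move=> y; exact: Q0.
(* Chosen so that [th * s = 1 - u] and [(1 - th) * s = w], the exponents carried by the two
   Jacobians. *)
pose th := (1 - u) / s.
have -> : (\int[mu]_y \int[mu]_x (f x `^ u * h y `^ (1 - w) * k (x - y))%:E =
    \int[mu]_z \int[mu]_v (P (z + th * v) (z - (1 - th) * v))%:E)%E.
  rewrite -(shear_tonelli th mP P0) -(ge0_tonelli mP P0).
  transitivity (\int[mu]_y \int[mu]_x (Q x y)%:E)%E.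
    by apply: eq_integral => y _; exact: E1.
  by rewrite -(ge0_tonelli mQ Q0); apply: eq_integral => x _; exact: E2.
have ths : th * s = 1 - u by rewrite /th divfK// gt_eqF.
have ths' : (1 - th) * s = w by rewrite mulrBl ths sE; ring.
have th01 : 0 < th < 1.
  apply/andP; split; first exact: divr_gt0.
  by rewrite ltr_pdivrMr// mul1r sE ltrD2r ltrDl.
have /andP[th0 th1] := th01; have th1' : 0 < 1 - th by rewrite subr_gt0.
pose J (z v : R) := th * T1 (z + th * v) + (1 - th) * S1 (z - (1 - th) * v).
pose A (z v : R) := T (z + th * v) - S (z - (1 - th) * v).
have J0 z v : 0 < J z v by rewrite addr_gt0// mulr_gt0.
have clin (a b : R) : continuous (fun v : R => a + b * v).
  by move=> v; apply: cvgD; [exact: cvg_cst|apply: cvgM; [exact: cvg_cst|exact: cvg_id]].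
have clin' (a b : R) : continuous (fun v : R => a - b * v).
  by move=> v; apply: cvgB; [exact: cvg_cst|apply: cvgM; [exact: cvg_cst|exact: cvg_id]].
have cJ z : continuous (J z).
  move=> v; apply: cvgD; (apply: cvgM; first exact: cvg_cst).
    exact: (continuous_compfun cT1 (clin z th)).
  exact: (continuous_compfun cS1 (clin' z (1 - th))).
have dA z v : is_derive v (1 : R) (A z) (J z v).
  have dl : is_derive v (1 : R) (fun v : R => z + th * v) th.
    apply: (is_derive_eqfun (is_derive_addfun (is_derive_cstfun z v)
      (is_derive_mulfun (is_derive_cstfun th v) (is_derive_idfun v)))) => //; ring.
  have dl' : is_derive v (1 : R) (fun v : R => z - (1 - th) * v) (- (1 - th)).
    apply: (is_derive_eqfun (is_derive_addfun (is_derive_cstfun z v)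
      (is_derive_oppfun (is_derive_mulfun (is_derive_cstfun (1 - th) v) (is_derive_idfun v))))) => //; ring.
  apply: (is_derive_eqfun (is_derive_addfun (is_derive_compfun (dT _) dl)
    (is_derive_oppfun (is_derive_compfun (dS _) dl')))) => //.
  by rewrite /J /T1 /S1; ring.
pose B := M `^ u * N `^ (1 - w) * ((pi * u * (1 - u)) `^ (- (u / 2)) * (pi * w * (1 - w)) `^ (- ((1 - w) / 2))).
have B0 : 0 <= B by rewrite !mulr_ge0 ?powR_ge0.
have PJ z v : P (z + th * v) (z - (1 - th) * v) <=
   B * expR (- (s / ((1 - u) * w) * z ^+ 2)) * (expR (- (v ^+ 2 / s)) * (J z v `^ s * k (A z v))).
  have G : phi (z + th * v) `^ u * psi (z - (1 - th) * v) `^ (1 - w) =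
      B * expR (- (s / ((1 - u) * w) * z ^+ 2)) * expR (- (v ^+ 2 / s)).
    by have := gaussian_rotation z v M0 N0 w0 wu u1; rewrite /= -sE.
  rewrite [leRHS]mulrA -G /P pfu phw mulrACA -[leLHS]mulrA.
  apply: ler_wpM2l; first by apply: mulr_ge0; exact: powR_ge0.
  apply: ler_wpM2r; first exact: ltW.
  (* The Jacobians combine into [(T1 ^ th * S1 ^ (1 - th)) ^ s], whose base is at most [J], the
     derivative of [A] along the fiber. *)
  rewrite -[T1 _ `^ _](_ : (T1 (z + th * v) `^ th) `^ s = _); last by rewrite -powRrM ths.
  rewrite -[S1 _ `^ _](_ : (S1 (z - (1 - th) * v) `^ (1 - th)) `^ s = _); last by rewrite -powRrM ths'.
  rewrite -powRM ?powR_ge0//.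
  apply: ge0_ler_powR; rewrite ?nnegrE ?(ltW s0) ?mulr_ge0 ?powR_ge0 ?(ltW (J0 _ _))//.
  exact: powR_amgm.
have cJk z v : (\int[mu]_v (P (z + th * v) (z - (1 - th) * v))%:E <=
    (B * ((pi * s * (1 - s)) `^ ((1 - s) / 2) * Nk) * expR (- (s / ((1 - u) * w) * z ^+ 2)))%:E)%E.
  have cE : continuous (fun v : R => expR (- (v ^+ 2 / s))).
    apply: (continuous_compfun (a := expR)); first exact: continuous_expR.
    by move=> x; apply: cvgN; apply: cvgM; [exact: exprn_continuous|exact: cvg_cst].
  have cJs : continuous (fun v => J z v `^ s) by exact: continuous_powR_fun.
  have cA : continuous (A z) by move=> x; exact: is_derive_continuous (dA z x).
  have mJ : measurable_fun setT (fun v : R => expR (- (v ^+ 2 / s)) * (J z v `^ s * k (A z v))).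
    apply: measurable_funM; first exact: continuous_measurable_fun.
    apply: measurable_funM; first exact: continuous_measurable_fun.
    by apply: continuous_measurable_fun; exact: continuous_compfun.
  have K0 v' : 0 <= expR (- (v' ^+ 2 / s)) * (J z v' `^ s * k (A z v')).
    by apply: mulr_ge0; [exact: expR_ge0|apply: mulr_ge0; [exact: powR_ge0|exact: ltW]].
  pose c := B * expR (- (s / ((1 - u) * w) * z ^+ 2)).
  have c0 : 0 <= c by apply: mulr_ge0; [exact: B0|exact: expR_ge0].
  apply: (@le_trans _ _ (\int[mu]_v (c%:E * (expR (- (v ^+ 2 / s)) * (J z v `^ s * k (A z v)))%:E))%E).
    apply: ge0_le_integral => //.
    - by move=> x _; rewrite lee_fin.
    - apply/measurable_EFinP; apply: (measurableT_comp (f := fun q : measurableTypeR R * measurableTypeR R => P q.1 q.2)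
        (g := fun v => (z + th * v, z - (1 - th) * v))) => //.
      by apply: measurable_fun_pair; apply: continuous_measurable_fun; [exact: clin|exact: clin'].
    - by apply: measurable_funeM; exact/measurable_EFinP.
    - by move=> x _; rewrite -EFinM lee_fin PJ.
  rewrite ge0_integralZl//; [|exact/measurable_EFinP|by move=> x _; rewrite lee_fin].
  have H := fiber_bound (s := s) (Nk := Nk) _ ck k0 Nk0 IG (dA z) (cJ z) (J0 z).
  apply: (le_trans (lee_wpmul2l _ (H _))); rewrite ?lee_fin//; first by rewrite s0 s1.
  by rewrite le_eqVlt; apply/orP; left; apply/eqP; rewrite /c; ring.
pose D := B * ((pi * s * (1 - s)) `^ ((1 - s) / 2) * Nk).
have D0 : 0 <= D by apply: mulr_ge0 => //; apply: mulr_ge0 => //; exact: powR_ge0.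
pose e0 := s / ((1 - u) * w).
have e00 : 0 < e0 by rewrite divr_gt0 ?mulr_gt0.
have mE : measurable_fun setT (fun z : R => expR (- (e0 * z ^+ 2))).
  apply: continuous_measurable_fun; apply: (continuous_compfun (a := expR)); first exact: continuous_expR.
  by move=> x; apply: cvgN; apply: cvgM; [exact: cvg_cst|exact: exprn_continuous].
apply: (@le_trans _ _ (\int[mu]_z (D%:E * (expR (- (e0 * z ^+ 2)))%:E))%E).
  apply: ge0_le_integral => //.
  - by move=> z _; apply: integral_ge0 => v _; rewrite lee_fin.
  - apply: (measurable_fun_fubini_tonelli_F (m2 := mu) (fun q : measurableTypeR R * measurableTypeR R =>
      (P (q.1 + th * q.2) (q.1 - (1 - th) * q.2))%:E)).
      apply/measurable_EFinP; apply: (measurable_pair_comp (a := fun a b => a + th * b) (b := fun a b => a - (1 - th) * b)) => //.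
        by apply: measurable_funD => //; apply: measurable_funM.
      by apply: measurable_funB => //; apply: measurable_funM.
    by move=> q; rewrite lee_fin.
  - by apply: measurable_funeM; exact/measurable_EFinP.
  - by move=> z _; rewrite -EFinM; exact: cJk.
rewrite ge0_integralZl//; last exact/measurable_EFinP.
have Y := young_cst_identity w0 wu u1; rewrite /= -sE -/e0 in Y.
rewrite integral_gauss// -EFinM lee_fin -Y /D /B.
rewrite le_eqVlt; apply/orP; left; apply/eqP; rewrite -/M -/N.
move: (M `^ u) (N `^ (1 - w)) ((pi * u * (1 - u)) `^ _) ((pi * w * (1 - w)) `^ _).
move: ((pi * s * (1 - s)) `^ _) (Num.sqrt _) => x1 x2 x3 x4 x5 x6.
by ring.
Qed.

End bilinear_bound.

(** * From the bilinear form to the norm of the convolution *)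

Section young_generic.
Context {R : realType}.
Local Notation mu := (@lebesgue_measure R).
Implicit Types (F G : R -> R) (p r s t u w : R).

Lemma Lfun_lty r F : 0 < r -> measurable_fun setT F ->
  (\int[mu]_x (`|F x| `^ r)%:E < +oo)%E -> F \in Lfun mu r%:E.
Proof.
move=> r0 mF H; apply/LfunE; split => //; rewrite LnormE.
by rewrite poweR_lty.
Qed.

Lemma Lfun_conv p F t : 0 < t -> 1 <= p -> F \in Lfun mu p%:E ->
  convolution F (heat t) \in Lfun mu p%:E.
Proof.
move=> t0 p1 Fp; apply: Lfun_lty; first exact: lt_le_trans p1.
  exact: (measurable_conv t0 p1 Fp).
apply: (le_lt_trans (young_contraction t0 p1 Fp)).
by have [nF _ [_ ->]] := Lfun_normP p1 Fp; rewrite ltry.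
Qed.

Lemma Lfun_normr p F : F \in Lfun mu p%:E -> (fun x => `|F x|) \in Lfun mu p%:E.
Proof.
move=> /LfunE[mF fF]; apply/LfunE; split; first exact: measurableT_comp.
rewrite [X in (X < _)%E](_ : _ = 'N[mu]_p%:E[EFin \o F]%E)// !LnormE.
by apply: (congr1 (poweR ^~ p^-1)); apply: eq_integral => x _; rewrite normr_id.
Qed.

Lemma conv_heat_semigroup p F s t x : 0 < s -> 0 < t -> 1 <= p -> F \in Lfun mu p%:E ->
  convolution (convolution F (heat s)) (heat t) x = convolution F (heat (s + t)) x.
Proof.
move=> s0 t0 p1 Fp.
have mk : measurable_fun setT (fun y : R => heat t (x - y)) by exact: measurable_heat_subl.
have kC y : `|heat t (x - y)| <= 1 * heat t (y - x).
  by rewrite mul1r heatBC ger0_norm ?heat_ge0.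
have [_ E] := conv_pairing s0 t0 p1 Fp mk kC.
rewrite [LHS]E; apply: eq_Rintegral => y _; congr (_ * _).
have := heat_semigroup_sub x y s0 t0 => /(congr1 fine) /= <-.
by apply: (congr1 fine); apply: eq_integral => z _; rewrite [heat s _]heatBC.
Qed.

(** The kernel vanishes nowhere, so a zero of the convolution at a single point already forces
    [F = 0] almost everywhere. *)
Lemma conv_heat_gt0 p F t x : 0 < t -> 1 <= p -> F \in Lfun mu p%:E ->
  (forall x, 0 <= F x) -> ~ {ae mu, forall x, F x = 0} -> 0 < convolution F (heat t) x.
Proof.
move=> t0 p1 Fp F0 nF; have iF := integrable_conv 0 x t0 p1 Fp.
have /LfunE[mF _] := Fp.
have c0 : 0 <= convolution F (heat t) x.
  by apply: Rintegral_ge0 => y _; apply: mulr_ge0 => //; exact: heat_ge0.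
rewrite lt_neqAle c0 andbT; apply/negP => /eqP c00; apply: nF.
have mh : measurable_fun setT (fun y : R => F y * heat t (x - y)).
  by apply: measurable_funM => //; exact: measurable_heat_subl.
have : ae_eq mu setT (fun y => (F y * heat t (x - y))%:E) (cst 0%E).
  apply/ae_eq_integral_abs => //; first exact/measurable_EFinP.
  transitivity (\int[mu]_y (F y * heat t (x - y))%:E)%E.
    by apply: eq_integral => y _; rewrite gee0_abs// lee_fin mulr_ge0 ?heat_ge0.
  by rewrite -EFin_Rintegral//; congr (_%:E).
apply: ae_imply => y /(_ I) [] /eqP; rewrite mulf_eq0 => /orP[/eqP//|].
by rewrite gt_eqF// heat_gt0.
Qed.

Lemma le_at_left (phi : R -> R) (a t : R) : 0 < t -> {for t, continuous phi} ->
  (forall d, 0 < d < t -> a <= phi d) -> a <= phi t.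
Proof.
move=> t0 cphi H; rewrite leNgt; apply/negP => ta.
have L : phi x @[x --> t^'-] --> phi t by exact: cvg_at_left_filter.
have [d [dt ad]] : exists d, 0 < d < t /\ phi d < a.
  near t^'- => d; exists d; split; near: d.
    by near=> d; apply/andP; split; near: d; [exact: nbhs_left_gt|exact: nbhs_left_lt].
  exact: cvgr_lt L _ ta.
by have := H d dt; rewrite leNgt ad.
Unshelve. all: by end_near. Qed.

End young_generic.

Section young_interior.
Context {R : realType}.
Local Notation mu := (@lebesgue_measure R).
Implicit Types (F G : R -> R) (p r s t u w : R).

(** The full factor [K_ p q r * t ^ decay_rate q] in the variables [u = 1/p] and [w = 1/r]. *)
Definition young_const u w t : R :=
  (young_cst u * young_cst (1 + w - u) / young_cst w) `^ 2^-1 * heat_norm t (1 + w - u).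

Lemma young_const_ge0 u w t : 0 <= young_const u w t.
Proof. by rewrite mulr_ge0 ?powR_ge0 ?heat_norm_ge0. Qed.

(** Apply [bilinear_bound] to [f = F^(1/u)] and [h = g^(1/w)] with [g = F * heat t]. Then
    [h^(1-w) = g^(1/w-1)], and the form is the integral of [g^(1/w)], which thus occurs on both
    sides. *)
Lemma young_positive F t u w (nF : R) : 0 < t -> 0 < w -> w < u -> u < 1 ->
  continuous F -> (forall x, 0 < F x) -> 0 <= nF ->
  (\int[mu]_x (F x `^ u^-1)%:E = (nF `^ u^-1)%:E)%E ->
  (\int[mu]_x (convolution F (heat t) x `^ w^-1)%:E <= ((young_const u w t * nF) `^ w^-1)%:E)%E.
Proof.
move=> t0 w0 wu u1 cF F0 nF0 IF.
have u0 : 0 < u by exact: lt_trans wu.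
have p0 : 0 < u^-1 by rewrite invr_gt0.
have r0 : 0 < w^-1 by rewrite invr_gt0.
have p1 : 1 <= u^-1 by rewrite invf_ge1// ltW.
have pr : u^-1 <= w^-1 by rewrite lef_pV2 ?posrE// ltW.
have w1' : 0 < 1 - w by rewrite subr_gt0 (lt_trans wu).
have s0 : 0 < 1 + w - u by lra.
have Fn x : `|F x| = F x by rewrite ger0_norm// ltW.
have mF : measurable_fun setT F by exact: continuous_measurable_fun.
have Fp : F \in Lfun mu (u^-1)%:E.
  apply: Lfun_lty => //.
  suff -> : (\int[mu]_x (`|F x| `^ u^-1)%:E = (nF `^ u^-1)%:E)%E by rewrite ltry.
  by rewrite -IF; apply: eq_integral => x _; rewrite Fn.
pose g := convolution F (heat t).
have iF y : mu.-integrable setT (EFin \o (fun x => F x * heat t (y - x))).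
  exact: (integrable_conv 0 y t0 p1 Fp).
have nae : ~ {ae mu, forall x, F x = 0}.
  move=> H; have : {ae mu, forall x : R, False}.
    by apply: ae_imply H => x Fx0; have := F0 x; rewrite Fx0 ltxx.
  move=> [N [mN N0 H0]]; have := @lebesgue_measureT_gt0 R.
  suff -> : [set: R] = N by rewrite N0 ltxx.
  by apply/seteqP; split => // x _; apply: H0 => /=.
have g0 x : 0 < g x by apply: (conv_heat_gt0 x t0 p1 Fp _ nae) => y; exact: ltW.
have cg : continuous g by exact: (continuous_conv (k := 0) t0 p1 Fp).
pose f x := F x `^ u^-1; pose h x := g x `^ w^-1.
have cf : continuous f by exact: continuous_powR_fun.
have ch : continuous h by exact: continuous_powR_fun.
have f0 x : 0 < f x by exact: powR_gt0.
have h0 x : 0 < h x by exact: powR_gt0.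
have fi : mu.-integrable setT (EFin \o f).
  apply/integrableP; split; first by apply/measurable_EFinP; exact: continuous_measurable_fun.
  suff -> : (\int[mu]_x `|(EFin \o f) x| = (nF `^ u^-1)%:E)%E by rewrite ltry.
  by rewrite -IF; apply: eq_integral => x _; rewrite gee0_abs ?lee_fin// ltW.
have [B hB] := conv_heatD_bounded 0 t0 p1 Fp.
have gB x : g x <= B by apply: le_trans (ler_norm _) (hB x).
have B0 : 0 <= B by apply: le_trans (gB 0); exact: ltW.
(* Finiteness has to precede the division below: [g] is bounded by [B] and lies in [L^p], so
   [g^r <= B^(r-p) g^p]. *)
have hi : mu.-integrable setT (EFin \o h).
  apply/integrableP; split; first by apply/measurable_EFinP; exact: continuous_measurable_fun.
  apply: (@le_lt_trans _ _ (\int[mu]_x ((B `^ (w^-1 - u^-1))%:E * (`|g x| `^ u^-1)%:E))%E).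
    apply: ge0_le_integral => //.
    - by apply: measurableT_comp => //; apply/measurable_EFinP; exact: continuous_measurable_fun.
    - apply: measurable_funeM; apply/measurable_EFinP; apply: measurable_fun_powR.
      by apply: measurableT_comp => //; exact: continuous_measurable_fun.
    - move=> x _; rewrite gee0_abs ?lee_fin; last exact: ltW.
      rewrite ger0_norm; last exact: ltW.
      rewrite -[leLHS]/(g x `^ w^-1) -{1}(subrK u^-1 w^-1) powRD; last by rewrite (gt_eqF (g0 x)) implybT.
      apply: ler_wpM2r; first exact: powR_ge0.
      by apply: ge0_ler_powR; rewrite ?nnegrE ?subr_ge0// ltW.
  rewrite ge0_integralZl//; first last.
  - by rewrite lee_fin powR_ge0.
  - apply/measurable_EFinP; apply: measurable_fun_powR.
    by apply: measurableT_comp => //; exact: continuous_measurable_fun.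
  have := young_contraction t0 p1 Fp.
  have [n2 _ [_ ->]] := Lfun_normP p1 Fp => HH.
  apply: (@le_lt_trans _ _ ((B `^ (w^-1 - u^-1))%:E * (n2 `^ u^-1)%:E)%E); last by rewrite -EFinM ltry.
  by apply: lee_wpmul2l; [rewrite lee_fin powR_ge0|exact: HH].
have IG : (\int[mu]_x (heat t x `^ (1 + w - u)^-1)%:E = (heat_norm t (1 + w - u) `^ (1 + w - u)^-1)%:E)%E.
  have q0 : 0 < (1 + w - u)^-1 by rewrite invr_gt0.
  by have := integral_heat_powR t0 q0; rewrite invrK; apply.
have hp y : h y `^ (1 - w) = g y `^ (w^-1 - 1).
  by rewrite /h -powRrM; congr (_ `^ _); field; rewrite gt_eqF.
have BB := bilinear_bound w0 wu u1 erefl cf f0 fi ch h0 hi (continuous_heat (t := t))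
  (fun x => heat_gt0 x t0) (heat_norm_ge0 t (1 + w - u)) IG.
have E : (\int[mu]_y \int[mu]_x (f x `^ u * h y `^ (1 - w) * heat t (x - y))%:E = \int[mu]_y (h y)%:E)%E.
  apply: eq_integral => y _.
  transitivity (\int[mu]_x ((h y `^ (1 - w))%:E * (F x * heat t (y - x))%:E))%E.
    apply: eq_integral => x _; rewrite -EFinM; congr (_%:E).
    rewrite /f -powRrM mulVf ?gt_eqF// powRr1; last exact: ltW.
    by rewrite [in RHS]heatBC -[LHS]mulrA [LHS]mulrCA.
  rewrite ge0_integralZl//.
  - rewrite -EFin_Rintegral// -EFinM hp /h; congr (_%:E).
    by rewrite [RHS]powR_pred ?(ltW (g0 y)).
  - by have /integrableP[] := iF y.
  - by move=> x _; rewrite lee_fin; apply: mulr_ge0; [exact: ltW|exact: heat_ge0].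
  - by rewrite lee_fin powR_ge0.
rewrite E in BB.
pose I := \int[mu]_x h x.
have I0 : 0 < I by exact: lt_trans (cdf_gt0 ch h0 hi 0) (cdf_lt ch h0 hi 0).
have EI : (\int[mu]_y (h y)%:E = I%:E)%E by rewrite /I -EFin_Rintegral.
have If : (\int[mu]_x f x) `^ u = nF.
  by rewrite /Rintegral /f IF /= -powRrM mulVf ?gt_eqF// powRr1.
rewrite EI lee_fin If in BB.
have {}BB : I <= young_const u w t * (nF * I `^ (1 - w)) by exact: BB.
rewrite -/g (_ : (\int[mu]_x _)%E = I%:E)// lee_fin.
(* Cancels the positive finite factor [I ^ (1 - w)]. *)
have Iw : I `^ w <= young_const u w t * nF.
  rewrite -(ler_pM2r (powR_gt0 (1 - w) I0)) -powRD ?subrKC ?(gt_eqF I0) ?implybT//.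
  by rewrite powRr1 ?(ltW I0)// -mulrA.
have -> : I = (I `^ w) `^ w^-1 by rewrite -powRrM divff ?gt_eqF// powRr1 ?(ltW I0).
apply: ge0_ler_powR => //; first exact: ltW.
  by rewrite nnegrE powR_ge0.
by rewrite nnegrE; apply: mulr_ge0 => //; exact: young_const_ge0.
Qed.

(* [young_positive] applies to [|F| * heat (t - d)], which is positive and
   continuous, with the kernel [heat d]; then [d] tends to [t]. *)
Lemma young_heat_interior F t u w (nF : R) : 0 < t -> 0 < w -> w < u -> u < 1 ->
  F \in Lfun mu (u^-1)%:E -> 0 <= nF ->
  (\int[mu]_x (`|F x| `^ u^-1)%:E = (nF `^ u^-1)%:E)%E ->
  (\int[mu]_x (`|convolution F (heat t) x| `^ w^-1)%:E <= ((young_const u w t * nF) `^ w^-1)%:E)%E.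
Proof.
move=> t0 w0 wu u1 Fp nF0 IF.
have u0 : 0 < u by exact: lt_trans wu.
have p0 : 0 < u^-1 by rewrite invr_gt0.
have r0 : 0 < w^-1 by rewrite invr_gt0.
have p1 : 1 <= u^-1 by rewrite invf_ge1// ltW.
have s0 : 0 < 1 + w - u by lra.
have /LfunE[mF _] := Fp.
have mc : measurable_fun setT (convolution F (heat t)) by exact: measurable_conv t0 p1 Fp.
(* When [F] vanishes almost everywhere its smoothing is not positive, but the convolution is [0]. *)
have [ae0|nae] := pselect {ae mu, forall x, F x = 0}.
  suff -> : (\int[mu]_x (`|convolution F (heat t) x| `^ w^-1)%:E = 0)%E by rewrite lee_fin powR_ge0.
  apply: integral0_eq => x _; suff -> : convolution F (heat t) x = 0 by rewrite normr0 powR0// gt_eqF.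
  have mFh : measurable_fun setT (fun y : R => F y * heat t (x - y)).
    by apply: measurable_funM => //; exact: measurable_heat_subl.
  transitivity (\int[mu]_x (cst (0 : R) x)).
    apply: (ae_eq_Rintegral mFh) => //.
    by apply: ae_imply ae0 => y Fy0; rewrite Fy0 mul0r.
  by rewrite Rintegral_cst// mul0r.
pose G x := `|F x|; have Gp : G \in Lfun mu (u^-1)%:E by exact: Lfun_normr.
have /LfunE[mG _] := Gp.
have G0 x : 0 <= G x by exact: normr_ge0.
have naeG : ~ {ae mu, forall x, G x = 0}.
  by move=> H; apply: nae; apply: ae_imply H => x /normr0_eq0.
have mcG : measurable_fun setT (convolution G (heat t)) by exact: measurable_conv t0 p1 Gp.
have cG0 x : 0 < convolution G (heat t) x by exact: (conv_heat_gt0 x t0 p1 Gp G0 naeG).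
apply: (@le_trans _ _ (\int[mu]_x (convolution G (heat t) x `^ w^-1)%:E)%E).
  apply: ge0_le_integral => //.
  - by apply/measurable_EFinP; apply: measurable_fun_powR; exact: measurableT_comp.
  - by apply/measurable_EFinP; exact: measurable_fun_powR.
  - move=> x _; rewrite lee_fin; apply: ge0_ler_powR; first exact: ltW.
    + by rewrite nnegrE.
    + by rewrite nnegrE ltW.
    + rewrite -lee_fin; apply: (le_trans (le_abse_conv x t0 p1 Fp)).
      by rewrite EFin_Rintegral//; exact: (integrable_conv 0 x t0 p1 Gp).
pose c0 := ((young_cst u * young_cst (1 + w - u) / young_cst w) `^ 2^-1 *
  (1 + w - u) `^ ((1 + w - u) / 2) * nF) `^ w^-1.
(* The bound as a function of the time, in a form whose continuity at [t] is visible. *)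
pose phi d := c0 * expR (- ((1 - (1 + w - u)) / 2) * w^-1 * ln (4 * pi * d)).
have pi0 : 0 < pi :> R by exact: pi_gt0.
have phiE d : 0 < d -> (young_const u w d * nF) `^ w^-1 = phi d.
  move=> d0; rewrite /young_const /heat_norm /phi /c0.
  set a := _ `^ 2^-1; set b := (1 + w - u) `^ _; set c := (4 * pi * d) `^ _.
  have -> : a * (c * b) * nF = a * b * nF * c by ring.
  rewrite powRM ?powR_ge0//; last by apply: mulr_ge0 => //; apply: mulr_ge0; exact: powR_ge0.
  have d40 : 0 < 4 * pi * d by rewrite !mulr_gt0.
  by rewrite /c -powRrM (powR_expln _ d40).
have cphi : {for t, continuous phi}.
  apply: cvgM; first exact: cvg_cst.
  apply: continuous_comp; last exact: continuous_expR.
  apply: cvgM; first exact: cvg_cst.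
  apply: continuous_comp; last by apply: continuous_ln; rewrite !mulr_gt0.
  by apply: cvgM; [exact: cvg_cst|exact: cvg_id].
set L := (\int[mu]_x _)%E.
have Lle d : 0 < d < t -> (L <= ((young_const u w d * nF) `^ w^-1)%:E)%E.
  move=> /andP[d0 dt]; have td0 : 0 < t - d by rewrite subr_gt0.
  pose F1 := convolution G (heat (t - d)).
  have F1p : F1 \in Lfun mu (u^-1)%:E by exact: Lfun_conv.
  have [n1 n10 [_ IF1]] := Lfun_normP p1 F1p.
  have cF1 : continuous F1 by exact: (continuous_conv (k := 0) td0 p1 Gp).
  have F10 x : 0 < F1 x by exact: (conv_heat_gt0 x td0 p1 Gp G0 naeG).
  have IF1' : (\int[mu]_x (F1 x `^ u^-1)%:E = (n1 `^ u^-1)%:E)%E.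
    by rewrite -IF1; apply: eq_integral => x _; rewrite ger0_norm// ltW.
  have := young_positive d0 w0 wu u1 cF1 F10 n10 IF1'.
  have -> : (\int[mu]_x (convolution F1 (heat d) x `^ w^-1)%:E = L)%E.
    by apply: eq_integral => x _; rewrite (conv_heat_semigroup x td0 d0 p1 Gp) subrK.
  move=> /le_trans; apply; rewrite lee_fin.
  have n1nF : n1 <= nF.
    have := young_contraction td0 p1 Gp; rewrite IF1.
    have -> : (\int[mu]_x (`|G x| `^ u^-1)%:E = (nF `^ u^-1)%:E)%E.
      by rewrite -IF; apply: eq_integral => x _; rewrite normr_id.
    rewrite lee_fin leNgt => /negP H; rewrite leNgt; apply/negP => nn; apply: H.
    by apply: gt0_ltr_powR; rewrite ?nnegrE.
  apply: ge0_ler_powR; first exact: ltW.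
  - by rewrite nnegrE; apply: mulr_ge0 => //; exact: young_const_ge0.
  - by rewrite nnegrE; apply: mulr_ge0 => //; exact: young_const_ge0.
  - by apply: ler_wpM2l => //; exact: young_const_ge0.
have Lf : (L \is a fin_num)%E.
  have /Lle : 0 < t / 2 < t by rewrite divr_gt0//= ltr_pdivrMr// ltr_pMr// ltr1n.
  move=> H; rewrite ge0_fin_numE; first by apply: (le_lt_trans H); exact: ltry.
  by apply: integral_ge0 => x _; rewrite lee_fin powR_ge0.
rewrite -(fineK Lf) lee_fin phiE//; apply: (le_at_left t0 cphi) => d dt.
have /andP[d0 _] := dt; rewrite -phiE// -lee_fin fineK//; exact: Lle.
Qed.

End young_interior.

(** * Young's inequality for all exponents, with the constants of the statement *)

Section young_inequality.
Context {R : realType}.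
Local Notation mu := (@lebesgue_measure R).
Implicit Types (F G : R -> R) (p s t u w : R) (q r : \bar R).

Lemma fine_inve_itv q : (1 <= q)%E -> 0 <= fine q^-1%E <= 1.
Proof.
case: q => [q|_|//]; last by rewrite invey/= lexx ler01.
rewrite lee_fin => q1; have q0 : 0 < q by exact: lt_le_trans q1.
by rewrite fine_invr invr_ge0 ltW//= invf_le1.
Qed.

Lemma c_E q : (1 <= q)%E -> c_ q = young_cst (fine q^-1%E).
Proof.
case: q => [q|_|//]; last by rewrite invey/= /young_cst subr0 powR1 powRr0 divr1.
rewrite lee_fin => q1; have q0 : 0 < q by exact: lt_le_trans q1.
rewrite fine_invr /= /young_cst; have [->|qn1] := eqVneq q 1.
  by rewrite invr1 subrr powRr0 powR1 divr1.
have q1' : 1 < q by rewrite lt_neqAle eq_sym qn1.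
have qm0 : 0 < q - 1 by rewrite subr_gt0.
have -> : fine (hoelder_conjugate q%:E) = q / (q - 1).
  rewrite /hoelder_conjugate/= eqe (gt_eqF q0) -EFinB inver subr_eq0 (negbTE qn1).
  by [].
have -> : 1 - q^-1 = (q / (q - 1))^-1 by field; rewrite !gt_eqF.
have qq0 : 0 < q / (q - 1) by rewrite divr_gt0.
rewrite [(q / (q - 1))^-1 `^ _](_ : _ = ((q / (q - 1)) `^ (q / (q - 1))^-1)^-1); last first.
  by rewrite !powR_expln ?invr_gt0// lnV ?posrE// mulrN expRN.
rewrite [q^-1 `^ _](_ : _ = (q `^ q^-1)^-1) ?invrK 1?mulrC//.
by rewrite !powR_expln ?invr_gt0// lnV ?posrE// mulrN expRN.
Qed.

Lemma alpha_decay q t : (1 <= q)%E -> 0 < t ->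
  alpha_ q * t `^ decay_rate q = heat_norm t (fine q^-1%E).
Proof.
have pi0 : 0 < pi :> R by exact: pi_gt0.
have sp0 : 0 < 2 * Num.sqrt pi :> R by rewrite mulr_gt0 ?sqrtr_gt0.
have ls : ln (2 * Num.sqrt pi) = ln (4 * pi) / 2 :> R.
  have -> : 4 * pi = (2 * Num.sqrt pi) ^+ 2 :> R by rewrite exprMn sqr_sqrtr ?ltW//; ring.
  by rewrite lnXn// mulr2n; field.
move=> q1 t0; have pt0 : 0 < 4 * pi * t by rewrite !mulr_gt0.
have lpt : ln (4 * pi * t) = ln (4 * pi) + ln t by rewrite lnM ?posrE ?mulr_gt0.
rewrite /decay_rate /heat_norm (powR_expln _ pt0) lpt (powR_expln _ t0).
case: q q1 => [q|_|//]; last first.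
  rewrite invey/= mul0r powRr0 mulr1 (inv_expln sp0) ls -expRD; congr expR.
  by move: (ln _) (ln _) => a b; field.
rewrite lee_fin => q1; have q0 : 0 < q by exact: lt_le_trans q1.
rewrite fine_invr /=; have [->|qn1] := eqVneq q 1.
  rewrite invr1 subrr powR1 mulr1 mul1r; congr expR.
  by move: (ln _) (ln _) => a b; field.
rewrite (powR_expln _ sp0) (powR_expln _ q0) ls -expRD -expRN (powR_expln _ (_ : 0 < q^-1)) ?invr_gt0//.
rewrite -2!expRD; congr expR; rewrite lnV ?posrE//.
by move: (ln _) (ln _) (ln _) => a b c; field; rewrite gt_eqF.
Qed.

Lemma young_cst0 : young_cst 0 = 1 :> R.
Proof. by rewrite /young_cst subr0 powR1 powRr0 divr1. Qed.

Lemma young_cst1 : young_cst 1 = 1 :> R.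
Proof. by rewrite /young_cst subrr powRr0 powR1 divr1. Qed.

Lemma young_cst_gt0 u : 0 <= u <= 1 -> 0 < young_cst u.
Proof.
move=> /andP[]; rewrite le_eqVlt => /orP[/eqP <- _|u0]; first by rewrite young_cst0.
rewrite le_eqVlt => /orP[/eqP ->|u1]; first by rewrite young_cst1.
by rewrite divr_gt0 ?powR_gt0 ?subr_gt0.
Qed.

(** Translates the exponents: the relation between [p], [q], [r] determines [1/q], and [q >= 1]
    becomes [w <= 1/p]. *)
Lemma K_E p q r t : 1 <= p -> (1 <= q)%E -> (1 <= r)%E -> (p%:E^-1 + q^-1 = 1 + r^-1)%E -> 0 < t ->
  let w := fine r^-1%E in
  [/\ fine q^-1%E = 1 + w - p^-1, w <= p^-1, 0 <= w &
    K_ p q r * t `^ decay_rate q = young_const p^-1 w t].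
Proof.
move=> p1 q1 r1 pqr t0 w.
have p0 : 0 < p by exact: lt_le_trans p1.
have fq : (q^-1 \is a fin_num)%E.
  case: q q1 {pqr} => [q|_|//]; last by rewrite invey.
  by rewrite lee_fin => q1; rewrite inver gt_eqF// (lt_le_trans ltr01).
have fr : (r^-1 \is a fin_num)%E.
  case: r r1 {pqr w} => [r|_|//]; last by rewrite invey.
  by rewrite lee_fin => r1; rewrite inver gt_eqF// (lt_le_trans ltr01).
have sE : fine q^-1%E = 1 + w - p^-1.
  move: pqr => /(congr1 fine); rewrite fineD//; last by rewrite inver gt_eqF.
  by rewrite fineD// fine_invr /= -/w => <-; rewrite addrAC subrr add0r.
have /andP[s0 s1] := fine_inve_itv q1; have /andP[w0 w1] := fine_inve_itv r1.
split => //; first by move: s1; rewrite sE; lra.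
by rewrite /K_ mulrAC mulrC mulrCA alpha_decay// !c_E// sE /young_const fine_invr.
Qed.

(** With the next two lemmas, identifies the sharp constant on the boundary [w = u], [u = 1],
    [w = 0] of the transport argument with the one given by the elementary inequalities. *)
Lemma young_const_w1 u t : 0 <= u <= 1 -> 0 < t -> young_const u u t = 1.
Proof.
move=> u01 t0; rewrite /young_const addrK young_cst1 mulr1 divff ?gt_eqF ?young_cst_gt0//.
by rewrite powR1 mul1r /heat_norm subrr mul0r oppr0 powRr0 powR1 mulr1.
Qed.

Lemma young_const_u1 w t : 0 <= w <= 1 -> young_const 1 w t = heat_norm t w.
Proof.
move=> w01; rewrite /young_const addrAC subrr add0r young_cst1 mul1r divff ?gt_eqF ?young_cst_gt0//.
by rewrite powR1 mul1r.
Qed.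

Lemma young_const_w0 u t : 0 <= u <= 1 -> young_const u 0 t = heat_norm t (1 - u).
Proof.
move=> u01; have /andP[u0 u1] := u01; rewrite /young_const addr0 young_cst0 divr1.
have -> : young_cst u * young_cst (1 - u) = 1.
  rewrite /young_cst subKr mulf_div [u `^ u * _]mulrC divff//.
  rewrite gt_eqF//; have := young_cst_gt0 u01; rewrite /young_cst.
  move: u0; rewrite le_eqVlt => /orP[/eqP <- _|u0']; first by rewrite subr0 powR1 powRr0 mulr1.
  move: u1; rewrite le_eqVlt => /orP[/eqP -> _|u1' _]; first by rewrite subrr powR1 powRr0 mulr1.
  by rewrite mulr_gt0 ?powR_gt0 ?subr_gt0.
by rewrite powR1 mul1r.
Qed.

(** The cases are [r = +oo] (Hoelder, or a pointwise bound on the kernel when [p = 1]), [r = p]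
    (contraction), [p = 1] (weight [|F|]), and the interior, left to transport. *)
Lemma young_heat p r F t : 0 < t -> 1 <= p -> (1 <= r)%E -> fine r^-1%E <= p^-1 ->
  F \in Lfun mu p%:E ->
  ('N[mu]_r[EFin \o convolution F (heat t)] <=
   (young_const p^-1 (fine r^-1%E) t)%:E * 'N[mu]_p%:E[EFin \o F])%E.
Proof.
move=> t0 p1 r1 wu Fp.
have p0 : 0 < p by exact: lt_le_trans p1.
have u01 : 0 <= p^-1 <= 1 by rewrite invr_ge0 (ltW p0)/= invf_le1.
have [nF nF0 [NF IF]] := Lfun_normP p1 Fp.
case: r r1 wu => [r|_|//]; last first.
  rewrite invey/= young_const_w0// => _; rewrite LnormyE; apply/ess_supP; apply: aeW => x /=.
  rewrite muleC; have [p_eq1|pn1] := eqVneq p 1.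
    by move: Fp; rewrite p_eq1 => Fp; rewrite invr1 subrr; exact: conv_heat_le_L1.
  have u1 : 0 < 1 - p^-1 by rewrite subr_gt0 invf_lt1// lt_neqAle eq_sym pn1.
  have := conv_heat_le_Lnorm x t0 p1 (_ : 0 < (1 - p^-1)^-1) _ Fp.
  by rewrite !invrK invr_gt0 subrKC; apply.
rewrite lee_fin => r1 wu; have r0 : 0 < r by exact: lt_le_trans r1.
have w01 : 0 <= r^-1 <= 1 by rewrite invr_ge0 (ltW r0)/= invf_le1.
rewrite fine_invr in wu *; rewrite NF -EFinM; apply: Lnorm_le_real => //.
  by rewrite mulr_ge0// young_const_ge0.
have [rp|rnp] := eqVneq r p.
  rewrite rp young_const_w1// mul1r -IF; exact: young_contraction.
have wu' : r^-1 < p^-1 by rewrite lt_neqAle wu andbT (inj_eq invr_inj).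
have [p_eq1|pn1] := eqVneq p 1.
  rewrite p_eq1 in Fp IF *.
  rewrite invr1 young_const_u1// powRM ?heat_norm_ge0// EFinM muleC.
  apply: (le_trans (young_L1 t0 r1 Fp)); rewrite integral_heat_powR//.
  have -> : (\int[mu]_x `|F x|%:E = nF%:E)%E.
    by rewrite -[nF]powRr1// -IF; apply: eq_integral => x _; rewrite powRr1.
  by rewrite poweR_EFin.
have u1 : p^-1 < 1 by rewrite invf_lt1// lt_neqAle eq_sym pn1.
have := @young_heat_interior R F t p^-1 r^-1 nF t0; rewrite !invrK invr_gt0; exact.
Qed.

Lemma Lfun_conv_heat p r F t : 0 < t -> 1 <= p -> (1 <= r)%E -> fine r^-1%E <= p^-1 ->
  F \in Lfun mu p%:E -> convolution F (heat t) \in Lfun mu r.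
Proof.
move=> t0 p1 r1 wu Fp; apply/LfunE; split; first exact: (measurable_conv t0 p1 Fp).
apply: (le_lt_trans (young_heat t0 p1 r1 wu Fp)).
by have [nF _ [-> _]] := Lfun_normP p1 Fp; rewrite -EFinM ltry.
Qed.

Lemma LpD_conv_norm_heat p r f F t : 0 < t -> 1 <= p -> (1 <= r)%E -> fine r^-1%E <= p^-1 ->
  LpD p f -> is_primitive p f F ->
  LpD_conv_norm p r f (heat t) = 'N[mu]_r[EFin \o convolution F (heat t)]%E.
Proof.
move=> t0 p1 r1 wu fp fF; apply: (LpD_conv_normE p1 r1 fp fF t0).
exact: Lfun_conv_heat fF.1.
Qed.

Lemma heat_estimate_young p r f t : 0 < t -> 1 <= p -> (1 <= r)%E -> fine r^-1%E <= p^-1 ->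
  LpD p f ->
  (LpD_conv_norm p r f (heat t) <= (young_const p^-1 (fine r^-1%E) t)%:E * LpD_norm p f)%E.
Proof.
move=> t0 p1 r1 wu fp; have fF := is_primitive_primitive fp.
rewrite (LpD_conv_norm_heat t0 p1 r1 wu fp fF) (LpD_norm_primitive p1 fp fF).
by apply: young_heat => //; exact: fF.1.
Qed.

End young_inequality.

(** * Sharpness *)

Section lower_bounds.
Context {R : realType}.
Local Notation mu := (@lebesgue_measure R).
Implicit Types (F G : R -> R) (p s t u w a c : R) (q r : \bar R).

Lemma heat_norm_gt0 t u : 0 < t -> 0 <= u -> 0 < heat_norm t u.
Proof.
move=> t0 u0; apply: mulr_gt0; first by rewrite powR_gt0 ?mulr_gt0 ?pi_gt0.
move: u0; rewrite le_eqVlt => /orP[/eqP <-|u0]; first by rewrite mul0r powRr0.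
exact: powR_gt0.
Qed.

Lemma heat_norm_scale c t u : 0 < c -> 0 < t -> heat_norm (c * t) u = c `^ (- ((1 - u) / 2)) * heat_norm t u.
Proof.
move=> c0 t0; have pi0 : 0 < pi :> R by exact: pi_gt0.
have pt0 : 0 <= 4 * pi * t by rewrite ltW// !mulr_gt0.
by rewrite /heat_norm mulrCA (powRM _ (ltW c0) pt0) mulrA.
Qed.

Lemma heat0E t : 0 < t -> heat t 0 = heat_norm t 0.
Proof.
move=> t0; have pi0 : 0 < pi :> R by exact: pi_gt0.
rewrite heat_expln// expr0n/= mul0r subr0 /heat_norm mul0r powRr0 mulr1 powR_expln ?mulr_gt0//.
by congr expR; move: (ln _) => l; field.
Qed.

Lemma ae_le_continuous F (c : R) : continuous F -> {ae mu, forall x, F x <= c} -> forall x, F x <= c.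
Proof.
move=> cF Fc x; rewrite leNgt; apply/negP => cx.
have [e e0 He] : exists2 e : R, 0 < e & forall y, `|x - y| < e -> c < F y.
  have : \forall y \near x, c < F y by exact: cvgr_gt (cF x) _ cx.
  move=> /nbhs_ballP[e e0 He].
  by exists e => // y xy; apply: He.
move: Fc => [N [mN N0 HN]].
have : (mu `]x, (x + e)%R[ <= mu N)%E.
  apply: le_measure; rewrite ?inE//; move=> y /=; rewrite in_itv/= => /andP[xy ye].
  apply: HN => /= Fy; have := He y; rewrite distrC ger0_norm ?subr_ge0 ?ltW// ltrBlDl ye.
  by move=> /(_ isT); rewrite ltNge Fy.
by rewrite N0 lebesgue_measure_itv/= lte_fin ltrDl e0 -EFinB [x + e]addrC addrK lee_fin leNgt e0.
Qed.

(** The maximum of [G] and [F] equals [G] almost everywhere and lies above [F] everywhere. *)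
Lemma le_Rintegral_ae F G : mu.-integrable setT (EFin \o F) -> mu.-integrable setT (EFin \o G) ->
  {ae mu, forall x, F x <= G x} -> \int[mu]_x F x <= \int[mu]_x G x.
Proof.
move=> iF iG FG; pose H x := Num.max (G x) (F x).
have /integrableP[/measurable_EFinP mF _] := iF.
have /integrableP[/measurable_EFinP mG fG] := iG.
have mH : measurable_fun setT H by exact: measurable_maxr.
have GH : {ae mu, forall x, G x = H x}.
  by apply: ae_imply FG => x Fx; apply/esym/max_idPl.
have iH : mu.-integrable setT (EFin \o H).
  apply/integrableP; split; first exact/measurable_EFinP.
  rewrite (_ : (\int[mu]_x `|(EFin \o H) x|)%E = (\int[mu]_x `|(EFin \o G) x|)%E)//.
  apply: ae_eq_integral => //.
  - by apply: measurableT_comp => //; exact/measurable_EFinP.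
  - by apply: measurableT_comp => //; exact/measurable_EFinP.
  - by apply: ae_imply GH => x /= -> _.
rewrite (ae_eq_Rintegral mG mH GH); apply: le_Rintegral => // x _.
by rewrite le_max lexx orbT.
Qed.

Lemma le_Lnorm r F G : (1 <= r)%E -> measurable_fun setT F -> measurable_fun setT G ->
  (forall x, 0 <= F x <= G x) -> ('N[mu]_r[EFin \o F] <= 'N[mu]_r[EFin \o G])%E.
Proof.
move=> r1 mF mG FG.
have nFG x : `|F x| <= `|G x|.
  by have /andP[F0 FGx] := FG x; rewrite !ger0_norm// (le_trans F0).
case: r r1 => [r r1|_|//]; last first.
  by rewrite !LnormyE; apply: le_ess_sup; apply: aeW => x /=; rewrite lee_fin.
rewrite lee_fin in r1; have r0 : 0 < r by exact: lt_le_trans r1.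
rewrite !LnormE; apply: le_poweR; first by rewrite invr_ge0 ltW.
  by apply: integral_ge0 => x _; rewrite lee_fin powR_ge0.
apply: ge0_le_integral => //.
- by apply/measurable_EFinP; apply: measurable_fun_powR; exact: measurableT_comp.
- by apply/measurable_EFinP; apply: measurable_fun_powR; exact: measurableT_comp.
- by move=> x _; rewrite lee_fin; apply: ge0_ler_powR; rewrite ?nnegrE// ltW.
Qed.

Lemma Lnorm_heat c t p : 0 <= c -> 0 < t -> 1 <= p ->
  'N[mu]_p%:E[EFin \o (fun x => (c * heat t x)%R)]%E = (c * heat_norm t p^-1)%:E.
Proof.
move=> c0 t0 p1; have p0 : 0 < p by exact: lt_le_trans p1.
rewrite LnormE.
have -> : (\int[mu]_x (`|(c * heat t x)%R| `^ p)%:E = (c `^ p)%:E * \int[mu]_x (heat t x `^ p)%:E)%E.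
  rewrite -ge0_integralZl//.
  - apply: eq_integral => x _; rewrite -EFinM; congr (_%:E).
    rewrite normrM (ger0_norm c0) (ger0_norm (heat_ge0 x t0)).
    by rewrite (powRM _ c0 (heat_ge0 x t0)).
  - by apply/measurable_EFinP; apply: measurable_fun_powR; exact: measurable_heat.
  - by move=> x _; rewrite lee_fin powR_ge0.
  - by rewrite lee_fin powR_ge0.
rewrite integral_heat_powR// -EFinM -powRM ?heat_norm_ge0// poweR_EFin -powRrM divff ?gt_eqF//.
by rewrite powRr1// mulr_ge0// heat_norm_ge0.
Qed.

(** For [r = +oo], continuity lets an almost everywhere bound be evaluated at the peak [x = 0]. *)
Lemma Lnorm_heat_ge c t r : 0 <= c -> 0 < t -> (1 <= r)%E ->
  ((c * heat_norm t (fine r^-1%E))%:E <= 'N[mu]_r[EFin \o (fun x => c * heat t x)%R])%E.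
Proof.
move=> c0 t0; case: r => [r|_|//]; first by rewrite lee_fin fine_invr => r1; rewrite Lnorm_heat.
rewrite invey/= LnormyE -heat0E//; apply: le_ereal_inf_tmp => -[y|_|].
- move=> /= H; rewrite lee_fin; apply: (@ae_le_continuous (fun x => c * heat t x)).
    by move=> x; apply: cvgM; [exact: cvg_cst|exact: continuous_heat].
  by apply: ae_imply H => x; rewrite lee_fin => /(le_trans (ler_norm _)).
- by rewrite leey.
(* An essential bound [-oo] would make the whole line a null set. *)
move=> /= [N [mN N0 HN]]; have := @lebesgue_measureT_gt0 R.
suff -> : [set: R] = N by rewrite N0 ltxx.
by apply/seteqP; split => // x _; apply: HN => /=; rewrite leeNy_eq.
Qed.

Lemma conv_heat_heat a t x : 0 < a -> 0 < t -> convolution (heat a) (heat t) x = heat (a + t) x.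
Proof.
move=> a0 t0; have := heat_semigroup_sub x 0 a0 t0 => /(congr1 fine) /=; rewrite subr0 => <-.
by apply: (congr1 fine); apply: eq_integral => y _; rewrite subr0 mulrC.
Qed.

Lemma Lfun_heat a p : 0 < a -> 1 <= p -> heat a \in Lfun mu p%:E.
Proof.
move=> a0 p1; apply/LfunE; split; first exact: measurable_heat.
suff -> : 'N[mu]_p%:E[EFin \o heat a]%E = (1 * heat_norm a p^-1)%:E by rewrite ltry.
rewrite -(Lnorm_heat (@ler01 R) a0 p1); congr (Lnorm _ _ (_ \o _)).
by apply/funext => x; rewrite mul1r.
Qed.

(** Positivity of the kernel carries a Gaussian minorant of [G] through the convolution, where the
    variances add. The sharpness of the constant, that of the rate, and (e) all rest on it. *)
Lemma Lnorm_conv_heat_ge c a t p r G : 0 <= c -> 0 < a -> 0 < t -> 1 <= p -> (1 <= r)%E ->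
  G \in Lfun mu p%:E -> {ae mu, forall x, c * heat a x <= G x} ->
  ((c * heat_norm (a + t) (fine r^-1%E))%:E <= 'N[mu]_r[EFin \o convolution G (heat t)])%E.
Proof.
move=> c0 a0 t0 p1 r1 Gp cG; have at0 : 0 < a + t by rewrite addr_gt0.
apply: (le_trans (Lnorm_heat_ge c0 at0 r1)).
apply: le_Lnorm => //.
- by apply: measurable_funM => //; exact: measurable_heat.
- exact: measurable_conv t0 p1 Gp.
move=> x; apply/andP; split; first by apply: mulr_ge0 => //; exact: heat_ge0.
have /LfunE[mG _] := Gp.
have hp := Lfun_heat a0 p1.
have iH := integrable_conv 0 x t0 p1 hp.
rewrite -(conv_heat_heat x a0 t0) /convolution -RintegralZl//.
apply: le_Rintegral_ae.
- have := integrableZl measurableT c iH; exact: eq_integrable.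
- exact: (integrable_conv 0 x t0 p1 Gp).
- apply: ae_imply cG => y cy; rewrite mulrA; apply: ler_wpM2r => //; exact: heat_ge0.
Qed.

End lower_bounds.

Section condense.
Context {R : realType}.
Local Notation mu := (@lebesgue_measure R).

(** [G] is the [p]-th root of the sum of [2^-(k+1) F_k^p]. Summing powers makes the [L^p] bound a
    termwise integration; the domination holds where the sum is finite, that is, almost
    everywhere. *)
Lemma condense (p : R) (F : nat -> R -> R) : 1 <= p ->
  (forall k, measurable_fun setT (F k)) -> (forall k x, 0 <= F k x) ->
  (forall k, (\int[mu]_x (F k x `^ p)%:E <= 1)%E) ->
  exists G : R -> R, G \in Lfun mu p%:E /\
    forall k, {ae mu, forall x, (2 ^ k.+1)%:R^-1 * F k x <= G x}.
Proof.
move=> p1 mF F0 IF; have p0 : 0 < p by exact: lt_le_trans p1.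
pose c k : R := (2 ^ k.+1)%:R^-1.
have c0 k : 0 < c k by rewrite invr_gt0 ltr0n expn_gt0.
have c1 k : c k <= 1 by rewrite invf_le1 ?ltr0n ?expn_gt0// ler1n expn_gt0.
pose e k x : \bar R := (c k * F k x `^ p)%:E.
have me k : measurable_fun setT (e k).
  by apply/measurable_EFinP; apply: measurable_funM => //; exact: measurable_fun_powR.
have e0 k x : (0 <= e k x)%E by rewrite lee_fin mulr_ge0 ?powR_ge0// ltW.
pose S x : \bar R := (\sum_(0 <= k <oo) e k x)%E.
have mS : measurable_fun setT S by apply: ge0_emeasurable_sum => // k x _; exact: e0.
have S0 x : (0 <= S x)%E by exact: nneseries_ge0.
have IS : (\int[mu]_x S x <= 1)%E.
  rewrite integral_nneseries//.
  apply: le_trans (epsilon_trick0 xpredT (@ler01 R)).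
  apply: lee_nneseries => [k *|k *]; first by apply: integral_ge0 => x _; exact: e0.
  rewrite div1r -/(c k) /e; under eq_integral do rewrite EFinM.
  rewrite ge0_integralZl//; first last.
  - by rewrite lee_fin ltW.
  - by move=> x _; rewrite lee_fin powR_ge0.
  - by apply/measurable_EFinP; apply: measurable_fun_powR; exact: mF.
  by rewrite -[leRHS]mule1; apply: lee_wpmul2l; [rewrite lee_fin ltW|exact: IF].
have iS : mu.-integrable setT S.
  apply/integrableP; split => //.
  under eq_integral do rewrite gee0_abs//.
  by apply: (le_lt_trans IS); exact: ltry.
have mG : measurable_fun setT (fun x => fine (S x) `^ p^-1).
  by apply: measurable_fun_powR; exact: measurableT_comp.
exists (fun x => fine (S x) `^ p^-1); split.
  apply: Lfun_lty => //; apply: (@le_lt_trans _ _ (\int[mu]_x S x)%E); last first.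
    by apply: (le_lt_trans IS); exact: ltry.
  apply: ge0_le_integral => //.
    by apply/measurable_EFinP; apply: measurable_fun_powR; exact: measurableT_comp.
  move=> x _; rewrite ger0_norm ?powR_ge0// -powRrM mulVf ?gt_eqF// powRr1 ?fine_ge0//.
  by have := S0 x; case: (S x) => [y|_|]//; rewrite leey.
move=> k; apply: ae_imply (integrable_ae measurableT iS) => x /(_ I) Sfin.
have ck : c k * F k x `^ p <= fine (S x).
  rewrite -lee_fin fineK//; apply: le_trans (nneseries_lim_ge k.+1 _); last by move=> n _ _; exact: e0.
  rewrite big_nat_recr//=; apply: (@le_trans _ _ (0 + e k x)%E); first by rewrite add0e.
  by apply: leeD => //; apply: sume_ge0.
rewrite -/(c k); have cF0 : 0 <= c k * F k x by rewrite mulr_ge0// ltW.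
rewrite -[leLHS](powRr1 cF0) -(divff (lt0r_neq0 p0)) powRrM.
apply: ge0_ler_powR; rewrite ?nnegrE ?powR_ge0 ?fine_ge0 ?invr_ge0 ?(ltW p0)//.
(* Here [c k ^ p <= c k], because [0 < c k <= 1 <= p]. *)
apply: le_trans ck; rewrite powRM// ?(ltW (c0 k))//; apply: ler_wpM2r; first exact: powR_ge0.
by rewrite -[leRHS](powRr1 (ltW (c0 k))); apply: ger_powR => //; rewrite c0 c1.
Qed.

End condense.

Section sharpness.
Context {R : realType}.
Local Notation mu := (@lebesgue_measure R).
Implicit Types (F G : R -> R) (p s t u w a b c k : R) (q r : \bar R).

Lemma heat_norm1 t : heat_norm t 1 = 1.
Proof. by rewrite /heat_norm subrr mul0r oppr0 powRr0 powR1 mulr1. Qed.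

(** Continuity at [e = 0] leaves the room to replace a degenerate extremal Gaussian by a genuine
    one. *)
Lemma lt_powR1D k H c : k < H -> exists2 e : R, 0 < e & k < (1 + e) `^ c * H.
Proof.
move=> kH; pose phi (e : R) : R := expR (c * ln (1 + e)) * H.
have phi0 : phi 0 = H by rewrite /phi addr0 ln1 mulr0 expR0 mul1r.
have cphi : {for 0, continuous phi}.
  apply: cvgM; last exact: cvg_cst.
  apply: (@continuous_comp _ _ _ (fun e : R => c * ln (1 + e)) expR); last exact: continuous_expR.
  apply: cvgM; first exact: cvg_cst.
  apply: (@continuous_comp _ _ _ (fun e : R => 1 + e) (@ln R)); last by apply: continuous_ln; rewrite addr0.
  by apply: cvgD; [exact: cvg_cst|exact: cvg_id].
have L : phi x @[x --> 0^'+] --> H by rewrite -phi0; exact: cvg_at_right_filter.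
near (0 : R)^'+ => e.
have e0 : 0 < e by near: e; exact: nbhs_right_gt.
exists e => //; rewrite powR_expln ?addr_gt0// -/(phi e).
by near: e; exact: cvgr_gt L _ kH.
Unshelve. all: by end_near. Qed.

(* The Gaussian of parameter [(1 - u) / (u - w)] is extremal; it degenerates to
   [0] when [u = 1] and to [+oo] when [w = u]. *)
Lemma young_const_sup u w k : 0 <= w -> w <= u -> u <= 1 -> 0 < u -> k < young_const u w 1 ->
  exists2 a : R, 0 < a & k * heat_norm a u < heat_norm (a + 1) w.
Proof.
move=> w0 wu u1 u0 kK; have pi0 : 0 < pi :> R by exact: pi_gt0.
have [u1E|un1] := eqVneq u 1.
  rewrite u1E in wu kK *; rewrite young_const_u1 ?w0// in kK.
  have [e e0 He] := lt_powR1D (- ((1 - w) / 2)) kK.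
  exists e => //; rewrite -[e + 1]mulr1 [e + 1]addrC heat_norm_scale// ?addr_gt0//.
  by rewrite heat_norm1 mulr1.
have [wuE|wnu] := eqVneq w u.
  rewrite wuE young_const_w1 ?(ltW u0)// in kK *.
  have [e e0 He] := lt_powR1D (- ((1 - u) / 2)) kK.
  exists e^-1; first by rewrite invr_gt0.
  have -> : e^-1 + 1 = (1 + e) * e^-1 by field; rewrite gt_eqF.
  have e1 : 0 < 1 + e by rewrite addr_gt0.
  have ei : 0 < e^-1 by rewrite invr_gt0.
  rewrite (heat_norm_scale u e1 ei).
  by rewrite ltr_pM2r ?heat_norm_gt0 ?(ltW u0)//; move: He; rewrite mulr1.
have wu' : w < u by rewrite lt_neqAle wnu.
have u1' : 0 < 1 - u by rewrite subr_gt0 lt_neqAle un1.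
have w1' : 0 < 1 - w by lra.
have s0 : 0 < 1 + w - u by lra.
have s1 : 0 < 1 - (1 + w - u) by lra.
have D0 : 0 < u - w by lra.
exists ((1 - u) / (u - w)); first exact: divr_gt0.
have a0 : 0 < (1 - u) / (u - w) by exact: divr_gt0.
(* The value [v = 0] occurs for [w = 0], that is [r = +oo]; both sides are then [1]. *)
have pw v : 0 <= v -> forall c, v `^ (v * c) = expR (v * c * ln v).
  rewrite le_eqVlt => /orP[/eqP <- c|v0 c]; last by rewrite powR_expln.
  by rewrite !mul0r powRr0 expR0.
have E (x : R) : 0 <= x -> 0 < 1 - x -> young_cst x = expR ((1 - x) * ln (1 - x) - x * ln x).
  move=> x0 x1; have := pw x x0 1; rewrite mulr1 => px.
  by rewrite /young_cst powR_expln// px expRB.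
have HN t v : 0 < t -> 0 <= v -> heat_norm t v = expR (- ((1 - v) / 2) * (ln (4 * pi) + ln t) + v / 2 * ln v).
  move=> t0 v0; have t40 : 0 < 4 * pi * t by rewrite !mulr_gt0.
  rewrite /heat_norm (pw v v0) (powR_expln _ t40) -expRD.
  by rewrite lnM ?posrE ?mulr_gt0.
(* Away from the degenerate cases the supremum is attained: this Gaussian gives equality. *)
suff <- : young_const u w 1 * heat_norm ((1 - u) / (u - w)) u = heat_norm ((1 - u) / (u - w) + 1) w.
  by rewrite ltr_pM2r// heat_norm_gt0// ltW.
have -> : (1 - u) / (u - w) + 1 = (1 - w) / (u - w) by field; rewrite gt_eqF.
rewrite /young_const !E ?(ltW u0) ?(ltW s0)// -expRD -expRB -expRM.
rewrite !HN ?(ltW u0) ?(ltW s0) ?divr_gt0// -!expRD; congr expR.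
rewrite !ln_div ?posrE// ln1 (_ : 1 - (1 + w - u) = u - w); last by ring.
move: (ln (4 * pi)) (ln u) (ln (1 - u)) (ln w) (ln (1 - w)) (ln (u - w)) (ln (1 + w - u)) => x1 x2 x3 x4 x5 x6 x7.
by field.
Qed.

Lemma LpD_norm_heat a p : 0 < a -> 1 <= p ->
  let f := distr_deriv (distr_of_fun (heat a)) in
  LpD p f /\ is_primitive p f (heat a) /\ LpD_norm p f = (heat_norm a p^-1)%:E.
Proof.
move=> a0 p1 f; have [h1 h2] := LpD_distr_deriv p1 (Lfun_heat a0 p1).
split => //; split => //; rewrite (LpD_norm_primitive p1 h1 h2).
have -> : (EFin \o heat a) = (EFin \o (fun x => (1 * heat a x)%R)).
  by apply/funext => x /=; rewrite mul1r.
by rewrite Lnorm_heat// mul1r.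
Qed.

(** Testing at [t = 1] makes the power of [t] equal to [1] for any [b], and a nearly extremal
    Gaussian contradicts the smaller constant. *)
Lemma constant_sharp_young p r b : 1 <= p -> (1 <= r)%E -> fine r^-1%E <= p^-1 ->
  constant_sharp p r (young_const p^-1 (fine r^-1%E) 1) b.
Proof.
move=> p1 r1 wu k kK H; have p0 : 0 < p by exact: lt_le_trans p1.
have /andP[w0 _] := fine_inve_itv r1.
have u0 : 0 < p^-1 by rewrite invr_gt0.
have u1 : p^-1 <= 1 by rewrite invf_le1.
have [a a0] := young_const_sup w0 wu u1 u0 kK.
have [h1 [h2 hN]] := LpD_norm_heat a0 p1.
rewrite ltNge => /negP; apply.
have := H _ h1 1 ltr01; rewrite hN powR1 mule1 -EFinM.
rewrite (LpD_conv_norm_heat ltr01 p1 r1 wu h1 h2) => HH.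
rewrite -lee_fin; apply: le_trans HH; have a10 : 0 < a + 1 by rewrite addr_gt0.
have := Lnorm_conv_heat_ge (c := 1) ler01 a0 ltr01 p1 r1 (Lfun_heat a0 p1).
rewrite mul1r; apply; apply: aeW => x; by rewrite mul1r.
Qed.

Lemma heat_condense p (a : nat -> R) : 1 <= p -> (forall n, 0 < a n) ->
  exists G, G \in Lfun mu p%:E /\
    forall n, {ae mu, forall x, (2 ^ n.+1)%:R^-1 / heat_norm (a n) p^-1 * heat (a n) x <= G x}.
Proof.
move=> p1 a0; have p0 : 0 < p by exact: lt_le_trans p1.
have N0 n : 0 < heat_norm (a n) p^-1 by rewrite heat_norm_gt0// invr_ge0 ltW.
have [||n|G [Gp HG]] := @condense R p (fun n x => (heat_norm (a n) p^-1)^-1 * heat (a n) x) p1.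
- by move=> n; apply: measurable_funM => //; exact: measurable_heat.
- by move=> n x; apply: mulr_ge0; [rewrite invr_ge0 ltW|exact: heat_ge0].
- have Ni : 0 <= (heat_norm (a n) p^-1)^-1 by rewrite invr_ge0 ltW.
  rewrite (_ : (\int[mu]_x _)%E = (((heat_norm (a n) p^-1)^-1 `^ p)%:E * \int[mu]_x (heat (a n) x `^ p)%:E)%E).
    rewrite integral_heat_powR// -EFinM -powRM ?heat_norm_ge0// mulVf ?gt_eqF// powR1.
    exact: lexx.
  rewrite -ge0_integralZl//.
  - apply: eq_integral => x _; rewrite -EFinM; congr (_%:E).
    by rewrite (powRM _ Ni (heat_ge0 x (a0 n))).
  - by apply/measurable_EFinP; apply: measurable_fun_powR; exact: measurable_heat.
  - by move=> x _; rewrite lee_fin powR_ge0.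
  - by rewrite lee_fin powR_ge0.
by exists G; split => // n; move: (HG n); apply: ae_imply => x; rewrite mulrA.
Qed.

Lemma nat_pow2_unbounded (D M : R) : 0 < D -> (forall n : nat, (2 ^ n)%:R * D <= M) -> False.
Proof.
move=> D0 H; have M0 : 0 <= M by apply: le_trans (H 0%N); rewrite mulr_ge0// ltW.
have MD0 : 0 <= M / D by rewrite divr_ge0// ltW.
have := H (Num.bound (M / D)); rewrite -ler_pdivlMr// leNgt => /negP; apply.
apply: (lt_le_trans (archi_boundP MD0)); rewrite ler_nat.
by rewrite ltnW// ltn_expl.
Qed.

End sharpness.

Section sharp_rate.
Context {R : realType}.
Local Notation mu := (@lebesgue_measure R).
Implicit Types (F G : R -> R) (p s t u w a b c k : R) (q r : \bar R).

Lemma heat_norm_powE t u : 0 < t -> heat_norm t u = t `^ (- ((1 - u) / 2)) * heat_norm 1 u.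
Proof. by move=> t0; rewrite -[t in LHS]mulr1 heat_norm_scale. Qed.

(** Condensation uses only one good time for each [e], and both limits supply it; this treats them
    together. *)
Lemma littleo_small (psi : R -> R) b (e : R) : (forall t, 0 < t -> 0 < psi t) -> 0 < e ->
  psi =o_ (0^'+) (fun t => t `^ b) \/ psi =o_ (+oo) (fun t => t `^ b) ->
  exists t, 0 < t /\ psi t <= e * t `^ b.
Proof.
move=> psi0 e0 [/eqoP H|/eqoP H].
  near (0 : R)^'+ => t; exists t; have t0 : 0 < t by near: t; exact: nbhs_right_gt.
  split => //; rewrite -[leLHS]ger0_norm ?(ltW (psi0 _ t0))//.
  rewrite -[t `^ b]ger0_norm ?powR_ge0//; near: t; exact: H.
near (pinfty_nbhs R) => t; exists t; have t0 : 0 < t by near: t; exact: nbhs_pinfty_gt.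
split => //; rewrite -[leLHS]ger0_norm ?(ltW (psi0 _ t0))//.
rewrite -[t `^ b]ger0_norm ?powR_ge0//; near: t; exact: H.
Unshelve. all: by end_near. Qed.

(** [G] contains a normalized Gaussian of variance parameter [a n] for each [n], and is tested at
    the time [a n] itself, where the decay has exactly the order [a n ^ b]. *)
Lemma rate_sharp_young p r b : 1 <= p -> (1 <= r)%E -> fine r^-1%E <= p^-1 ->
  b = (fine r^-1%E - p^-1) / 2 -> rate_sharp p r b.
Proof.
move=> p1 r1 wu bE psi psi0 H; have p0 : 0 < p by exact: lt_le_trans p1.
have u0 : 0 <= p^-1 by rewrite invr_ge0 ltW.
have /andP[w0 _] := fine_inve_itv r1.
set w := fine r^-1%E in wu bE w0 *.
(* The square supplies two factors [2^(n+1)]: one offsets the condensation weight, the other makes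
   the quotient unbounded. *)
have /choice[a Ha] (n : nat) : exists t, 0 < t /\ psi t <= ((2 ^ n.+1)%:R ^+ 2)^-1 * t `^ b.
  by apply: littleo_small => //; rewrite invr_gt0 exprn_gt0// ltr0n expn_gt0.
have a0 n : 0 < a n by have [] := Ha n.
have [G [Gp HG]] := heat_condense p1 a0.
have [h1 h2] := LpD_distr_deriv p1 Gp.
exists (distr_deriv (distr_of_fun G)) => // -[M HM].
(* By scaling, the norm at time [2 * a n] divided by the normalization at [a n] is [D * a n ^ b],
   with [D] independent of [n]. *)
pose D := heat_norm 2 w / heat_norm 1 p^-1.
have D0 : 0 < D by rewrite divr_gt0 ?heat_norm_gt0.
apply: (@nat_pow2_unbounded R D M D0) => n.
pose c : R := (2 ^ n.+1)%:R^-1 / heat_norm (a n) p^-1.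
have c0 : 0 <= c by rewrite divr_ge0 ?heat_norm_ge0// invr_ge0.
have L := Lnorm_conv_heat_ge c0 (a0 n) (a0 n) p1 r1 Gp (HG n).
have := HM _ (a0 n); rewrite (LpD_conv_norm_heat (a0 n) p1 r1 wu h1 h2) => HM'.
have pa := psi0 _ (a0 n).
have : ((c * heat_norm (a n + a n) w)%:E / (psi (a n))%:E <= M%:E)%E.
  apply: le_trans HM'; apply: lee_wpmul2r L.
  by rewrite inver gt_eqF// lee_fin invr_ge0 ltW.
rewrite inver (gt_eqF pa) -EFinM lee_fin; apply: le_trans.
have -> : c * heat_norm (a n + a n) w = (2 ^ n.+1)%:R^-1 * D * a n `^ b.
  rewrite -mulr2n -[a n *+ 2]mulr_natl mulrC heat_norm_scale// mulrC.
  rewrite /c /D [heat_norm (a n) _]heat_norm_powE// [heat_norm (a n) w]heat_norm_powE//.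
  rewrite [heat_norm 2 w]heat_norm_powE//.
  have -> : a n `^ b = a n `^ (- ((1 - w) / 2)) / a n `^ (- ((1 - p^-1) / 2)).
    rewrite !(powR_expln _ (a0 n)) -expRB bE; congr expR.
    by move: p^-1 (ln _) => x y; field.
  by field; rewrite !gt_eqF ?powR_gt0 ?heat_norm_gt0 ?ltr0n ?expn_gt0.
rewrite ler_pdivlMr//.
apply: (@le_trans _ _ ((2 ^ n)%:R * D * (((2 ^ n.+1)%:R ^+ 2)^-1 * a n `^ b))).
  by apply: ler_wpM2l; [rewrite mulr_ge0// ltW|have [] := Ha n].
rewrite [leRHS]mulrAC [leLHS](_ : _ = (2 ^ n)%:R * ((2 ^ n.+1)%:R ^+ 2)^-1 * a n `^ b * D); last by ring.
apply: ler_wpM2r; first exact: ltW.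
apply: ler_wpM2r; first exact: powR_ge0.
have N0 : 0 < (2 ^ n.+1)%:R :> R by rewrite ltr0n expn_gt0.
rewrite expr2 invfM mulrA -[leRHS]mul1r; apply: ler_wpM2r; first by rewrite invr_ge0 ltW.
by rewrite ler_pdivrMr// mul1r ler_nat leq_exp2l.
Qed.

(** For [s < p] the [L^s] norm of a wide Gaussian exceeds its [L^p] norm by a factor growing like
    the power [d] of its variance, and a fixed time [t] does not change this. Condensing ever wider
    Gaussians gives an infinite [L^s] norm. *)
Lemma not_LpD_lower p s t : 1 <= s -> s < p -> 0 < t ->
  exists2 f, LpD p f & ~ LpD s (distr_of_fun (LpD_conv p f (heat t))).
Proof.
move=> s1 sp t0; have p1 : 1 <= p by rewrite (le_trans s1)// ltW.
have p0 : 0 < p by exact: lt_le_trans p1.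
have s0 : 0 < s by exact: lt_le_trans s1.
have uv : p^-1 < s^-1 by rewrite ltf_pV2.
have d0 : 0 < (s^-1 - p^-1) / 2 by rewrite divr_gt0// subr_gt0.
set d := (s^-1 - p^-1) / 2 in d0.
(* The power gives [a n ^ d >= (2^(n+1))^2], enough to beat the condensation weight; the factor
   [1 + t] ensures [t <= a n]. *)
pose a n : R := (1 + t) * ((2 ^ n.+1)%:R ^+ 2) `^ d^-1.
have N1 n : 1 <= (2 ^ n.+1)%:R ^+ 2 :> R by rewrite exprn_ege1// ler1n expn_gt0.
have P1 n : 1 <= ((2 ^ n.+1)%:R ^+ 2 : R) `^ d^-1.
  rewrite -[leLHS](_ : 1 `^ d^-1 = 1 :> R); last by rewrite powR1.
  apply: ge0_ler_powR; rewrite ?nnegrE//.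
    by rewrite invr_ge0 ltW.
have ta n : t <= a n.
  by rewrite (@le_trans _ _ (1 + t)) ?lerDr// ler_peMr// addr_ge0// ltW.
have a0 n : 0 < a n by exact: lt_le_trans (ta n).
have [G [Gp HG]] := heat_condense p1 a0.
have [h1 h2] := LpD_distr_deriv p1 Gp.
exists (distr_deriv (distr_of_fun G)) => // Hs.
have wu : fine (p%:E^-1)%E <= p^-1 by rewrite fine_invr.
have Vp := Lfun_conv_heat t0 p1 (p1 : (1 <= p%:E)%E) wu Gp.
have [h3 h4] := LpD_conv_primitive p1 p1 h1 h2 t0 Vp.
have hs := is_primitive_primitive Hs.
(* A primitive in [L^s] would coincide almost everywhere with [G * heat t], whose [L^s] norm would
   then be finite. *)
have AE := primitive_unique p1 s1 h4 hs.
have /LfunE[mV _] := Vp; have /LfunE[mA _] := hs.1.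
have Es : 'N[mu]_s%:E[EFin \o convolution G (heat t)]%E =
    'N[mu]_s%:E[EFin \o primitive s (distr_of_fun (LpD_conv p (distr_deriv (distr_of_fun G)) (heat t)))]%E.
  by apply: eq_Lnorm_ae => //.
have [M _ [NM _]] := Lfun_normP s1 hs.1.
rewrite NM in Es.
have u0 : 0 <= p^-1 by rewrite invr_ge0 ltW.
have v0 : 0 <= s^-1 by rewrite invr_ge0 ltW.
pose D := heat_norm 2 s^-1 / heat_norm 1 p^-1.
have D0 : 0 < D by rewrite divr_gt0 ?heat_norm_gt0.
apply: (@nat_pow2_unbounded R D M D0) => n.
pose c : R := (2 ^ n.+1)%:R^-1 / heat_norm (a n) p^-1.
have c0 : 0 <= c by rewrite divr_ge0 ?heat_norm_ge0// invr_ge0.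
have := Lnorm_conv_heat_ge c0 (a0 n) t0 p1 (s1 : (1 <= s%:E)%E) Gp (HG n).
rewrite Es lee_fin fine_invr; apply: le_trans.
have v1 : s^-1 <= 1 by rewrite invf_le1.
(* Norms decrease in time because [1/s <= 1]; replacing [t] by [a n] makes the scaling exact. *)
have mono : heat_norm (a n + a n) s^-1 <= heat_norm (a n + t) s^-1.
  apply: ler_wpM2r; first exact: powR_ge0.
  have pi0 : 0 < pi :> R by exact: pi_gt0.
  have P4 : 0 < 4 * pi :> R by rewrite mulr_gt0.
  have q1 : 0 < 4 * pi * (a n + a n) by rewrite pmulr_rgt0// addr_gt0.
  have q2 : 0 < 4 * pi * (a n + t) by rewrite pmulr_rgt0// addr_gt0.
  rewrite !powRN lef_pV2 ?posrE ?powR_gt0//.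
  apply: ge0_ler_powR; rewrite ?nnegrE ?(ltW q1) ?(ltW q2) ?divr_ge0 ?subr_ge0//.
  by rewrite ler_pM2l// lerD2l.
apply: (@le_trans _ _ (c * heat_norm (a n + a n) s^-1)); last exact: ler_wpM2l.
have -> : c * heat_norm (a n + a n) s^-1 = (2 ^ n.+1)%:R^-1 * D * a n `^ d.
  rewrite -mulr2n -[a n *+ 2]mulr_natl mulrC heat_norm_scale// mulrC.
  rewrite /c /D [heat_norm (a n) _]heat_norm_powE// [heat_norm (a n) s^-1]heat_norm_powE//.
  rewrite [heat_norm 2 s^-1]heat_norm_powE//.
  have -> : a n `^ d = a n `^ (- ((1 - s^-1) / 2)) / a n `^ (- ((1 - p^-1) / 2)).
    rewrite !(powR_expln _ (a0 n)) -expRB /d; congr expR.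
    by move: p^-1 s^-1 (ln _) => x z y; field.
  by field; rewrite !gt_eqF ?powR_gt0 ?heat_norm_gt0 ?ltr0n ?expn_gt0.
have ad : (2 ^ n.+1)%:R ^+ 2 <= a n `^ d.
  rewrite /a powRM ?powR_ge0 ?addr_ge0 ?(ltW t0)// -powRrM mulVf ?gt_eqF// powRr1; last by rewrite (le_trans ler01).
  rewrite ler_peMl ?(le_trans ler01)//.
  rewrite -[leLHS](_ : 1 `^ d = 1 :> R); last by rewrite powR1.
  apply: ge0_ler_powR; rewrite ?nnegrE ?(ltW d0) ?addr_ge0 ?(ltW t0)//.
  by rewrite lerDl ltW.
have N0 : 0 < (2 ^ n.+1)%:R :> R by rewrite ltr0n expn_gt0.
apply: (@le_trans _ _ ((2 ^ n.+1)%:R^-1 * D * (2 ^ n.+1)%:R ^+ 2)); last first.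
  by apply: ler_wpM2l => //; rewrite mulr_ge0 ?invr_ge0 ?ltW.
rewrite [leRHS](_ : _ = (2 ^ n.+1)%:R * D); last by field; rewrite gt_eqF.
by apply: ler_wpM2r; [exact: ltW|rewrite ler_nat leq_exp2l].
Qed.

End sharp_rate.

Theorem theorem2p1 (R : realType) (p : R) (hp : 1 <= p) :
  (forall (f : schwartz R -> R) (F : R -> R),
    LpD p f -> is_primitive p f F ->
    let v := fun t x : R => LpD_conv p f (heat t) x in
    (* (a) *)
    (forall t : R, 0 < t ->
      [/\ convolvable F (derive1 (heat t)), convolvable (derive1 (heat t)) F
        & convolvable F (heat t)] /\
      (forall x : R,
        [/\ v t x = LpD_int p f (fun y => heat t (x - y)),
            v t x = convolution F (derive1 (heat t)) x,
            v t x = convolution (derive1 (heat t)) F x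
          & is_derive x 1 (convolution F (heat t)) (v t x)]) /\
      unif_continuous (v t)) /\
    (* (b) *)
    (forall (n : nat) (t x : R), (1 <= n)%N -> 0 < t ->
      derive1n n (v t) x = LpD_conv p f (derive1n n (heat t)) x /\
      derive1n n (fun s => v s x) t = LpD_conv p f (heat_dt n t) x) /\
    (forall t : R, 0 < t -> smooth_on setT (v t)) /\
    (forall x : R, smooth_on [set t | 0 < t] (fun s => v s x)) /\
    (* (c) *)
    (forall s t : R, p <= s -> 0 < t ->
      LpD s (distr_of_fun (LpD_conv p f (heat t))))) /\
  (* (d) *)
  (forall q r : \bar R, (1 <= q)%E -> (1 <= r)%E ->
    ((p%:E)^-1 + q^-1 = 1 + r^-1)%E ->
    [/\ heat_estimate p r (K_ p q r) (decay_rate q),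
        rate_sharp p r (decay_rate q)
      & constant_sharp p r (K_ p q r) (decay_rate q)]) /\
  [/\ forall f, LpD p f -> forall t : R, 0 < t ->
        (LpD_conv_norm p p%:E f (heat t) <= LpD_norm p f)%E,
      rate_sharp p p%:E 0
    & constant_sharp p p%:E 1 0] /\
  (* (e) *)
  (forall s t : R, 1 <= s -> s < p -> 0 < t ->
    exists2 f, LpD p f & ~ LpD s (distr_of_fun (LpD_conv p f (heat t)))).
Proof.
split.
  move=> f F fp fF v; have Fp := fF.1.
  have vE t : 0 < t -> v t = convolution F (heatD 1 t).
    by move=> t0; exact: (LpD_conv_heatD 0 hp fp fF t0).
  have dE t : 0 < t -> derive1 (heat t) = heatD 1 t by move=> t0; exact: (derive1n_heat 1 t0).
  have [mF _] : measurable_fun setT F /\ True by have /LfunE[] := Fp.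
  split; [|split; [|split; [|split]]].
  - move=> t t0; rewrite dE//; split; [|split].
    + split.
      * by move=> x; exact: (integrable_conv 1 x t0 hp Fp).
      * move=> x; have := integrable_subl x (integrable_conv 1 x t0 hp Fp).
        by apply: eq_integrable => // y _; rewrite /= subKr mulrC.
      * by move=> x; exact: (integrable_conv 0 x t0 hp Fp).
    + move=> x; split.
      * by [].
      * by rewrite vE.
      * rewrite vE// /convolution -(@Rintegral_subl _ x (fun y => F y * heatD 1 t (x - y))).
          by apply: eq_Rintegral => y _; rewrite subKr mulrC.
        apply: measurable_funM => //.
        by have [mh _ _] := tame_subl x (tame_heatD 1 t0).
      * by rewrite vE//; exact: (is_derive_conv 0 x t0 hp Fp).
    (* The derivative of [v t] is a convolution with [heatD 2 t], hence bounded, so [v t] is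
       Lipschitz. *)
    + have [B hB] := conv_heatD_bounded 2 t0 hp Fp.
      rewrite vE//; apply: (unif_continuous_bounded_derive (u' := convolution F (heatD 2 t)) (B := B)) => //.
      by move=> x; exact: (is_derive_conv 1 x t0 hp Fp).
  - move=> n t x _ t0; split.
      rewrite vE// (derive1n_conv n t0 hp Fp) derive1n_heat//.
      by rewrite (LpD_conv_heatD n hp fp fF t0).
    have -> : heat_dt n t = heatD n.*2 t by apply/funext => y; exact: heat_dtE.
    rewrite (LpD_conv_heatD n.*2 hp fp fF t0).
    by apply: (derive1n_conv_time n hp Fp) => // s s0; rewrite vE.
  - move=> t t0 n x _; rewrite vE// (derive1n_conv n t0 hp Fp).
    by have [] := is_derive_conv n.+1 x t0 hp Fp.
  - move=> x n t /= t0.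
    have vx s : 0 < s -> v s x = convolution F (heatD 1 s) x by move=> s0; rewrite vE.
    suff : is_derive t 1 (derive1n n (v^~ x)) (convolution F (heatD n.*2.+3 t) x) by case.
    apply: (is_derive_near (is_derive_conv_time n.*2.+1 x t0 hp Fp)).
    near=> s; apply/esym; apply: (derive1n_conv_time n hp Fp vx).
    by near: s; exact: lt_nbhsr.
  - move=> s t ps t0; have s1 : 1 <= s by exact: le_trans ps.
    have wu : fine (s%:E^-1)%E <= p^-1.
      by rewrite fine_invr lef_pV2 ?posrE ?(lt_le_trans ltr01).
    have Vs := Lfun_conv_heat t0 hp (s1 : (1 <= s%:E)%E) wu Fp.
    by have [] := LpD_conv_primitive hp s1 fp fF t0 Vs.
have p0 : 0 < p by exact: lt_le_trans hp.
have est q r : (1 <= q)%E -> (1 <= r)%E -> (p%:E^-1 + q^-1 = 1 + r^-1)%E ->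
    [/\ heat_estimate p r (K_ p q r) (decay_rate q),
        rate_sharp p r (decay_rate q)
      & constant_sharp p r (K_ p q r) (decay_rate q)].
  move=> q1 r1 pqr; have [sE wu w0 _] := K_E hp q1 r1 pqr ltr01.
  split.
  - move=> f fp t t0; have [_ _ _ KE] := K_E hp q1 r1 pqr t0.
    by rewrite muleAC -EFinM KE; exact: heat_estimate_young.
  - apply: rate_sharp_young => //; rewrite /decay_rate sE.
    by congr (_ / _); move: p^-1 (fine _) => a b; ring.
  - have [_ _ _] := K_E hp q1 r1 pqr ltr01; rewrite powR1 mulr1 => ->.
    exact: constant_sharp_young.
split; first exact: est.
(* The [L^p] contraction is the case [q = 1], [r = p], where the constant is [1] and the rate
   [0]. *)
have H : (p%:E^-1 + 1^-1 = 1 + p%:E^-1)%E by rewrite inve1 addeC.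
have [E1 E2 E3] := est 1%E p%:E (lexx 1%E) hp H.
have dr : decay_rate 1 = 0 :> R by rewrite /decay_rate inve1/= subrr oppr0 mul0r.
have K1 : K_ p 1 p%:E = 1.
  have [_ _ _] := K_E hp (lexx 1%E) (hp : (1 <= p%:E)%E) H ltr01.
  by rewrite powR1 mulr1 fine_invr young_const_w1// invr_ge0 (ltW p0) invf_le1.
split.
  split.
  - by move=> f fp t t0; have := E1 _ fp _ t0; rewrite K1 dr powRr0 mul1e mule1.
  - by move: E2; rewrite dr.
  - by move: E3; rewrite K1 dr.
by move=> s t s1 sp t0; exact: not_LpD_lower.
Unshelve. all: by end_near. Qed.
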